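(* Let $w\in S_n$ be a cograssmannian permutation with unique right ascent $s_z$, and let $A_w$, $|t|$ and $x(t)$ (for $t\in A_w$) be as defined in the context. Then, in the Hecke algebra of $S_n$, \[ C'_w = q^{-\frac{1}{2}\ell(w)} \sum_{t\in A_w} q^{\,|t|+\frac{1}{2}\ell(x(t))}\, B'_{x(t)}. \]
   Context: $S_n$ is the Coxeter group generated by adjacent transpositions $s_1,\ldots,s_{n-1}$; $s_i$ is a right ascent of $w$ if $\ell(ws_i)>\ell(w)$ and a right descent otherwise. $w$ is cograssmannian if it has at most one right ascent; here we assume it has exactly one, $s_z$. Hecke algebra $\mathcal{H}$: the $\mathbb{Z}[q^{1/2},q^{-1/2}]$-algebra with basis $\{T_x\}$, relations $T_sT_x=T_{sx}$ if $\ell(sx)>\ell(x)$, $T_sT_x=(q-1)T_x+qT_{sx}$ otherwise. The Kazhdan–Lusztig basis element is $C'_w=q^{-\frac12\ell(w)}\sum_{x\le w}P_{x,w}(q)T_x$ (the unique bar-invariant element of this form with $P_{w,w}=1$ and $\deg P_{x,w}\le (\ell(w)-\ell(x)-1)/2$ for $x<w$, bar involution $\overline{q^{1/2}}=q^{-1/2}$, $\overline{T_x}=T_{x^{-1}}^{-1}$), and $B'_x=q^{-\frac12\ell(x)}\sum_{y\le x}T_y$ (Bruhat order). Construction. Let $J=\{s_1,\ldots,s_{n-1}\}\setminus\{s_z\}$, $w_0^J$ the longest element of the parabolic subgroup $W_J$, and write $w=vw_0^J$ with $v$ the minimal-length representative of $wW_J$ ($v$ has unique right descent $s_z$ and is fully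 commutative). Fix the reduced word $\mathsf{w}=\mathsf{w}_1\cdots\mathsf{w}_\ell$ consisting of a reduced word for $v$ followed by $(s_1s_2\cdots s_{z-1})(s_1\cdots s_{z-2})\cdots(s_1)$ and $(s_{n-1}s_{n-2}\cdots s_{z+1})(s_{n-1}\cdots s_{z+2})\cdots(s_{n-1})$. The heap of $\mathsf{w}$ is the poset on positions $\{1,\ldots,\ell\}$ given by the transitive closure of $i\prec j$ whenever $i>j$ and $\mathsf{w}_i,\mathsf{w}_j$ do not commute; position $i$ lies in column $k$ if $\mathsf{w}_i=s_k$, and ''above'' means greater in this poset. The columns containing entries of (the positions of) $v$ form an interval; in each such column take the maximal $v$-entry. For each pair of consecutive such columns $k,k+1$ the two maximal entries are comparable; record ''('' if the one in column $k$ is above the one in column $k+1$ and '')'' otherwise, reading $k$ from left to right. Build a rooted tree $T(w)$: its non-root vertices are the matched pairs ''$(\cdots)$'' of this parenthesis string, one vertex a descendant of another iff its pair is enclosed by the other's, plus a root adjacent to all maximal such vertices. The leaves are the pairs of consecutive symbols ''()'', called valleys; the valley column is the column $k$ such that ''('' is recorded between columns $k-1,k$ and '')'' between $k,k+1$. The capacity of a valley is the number of entries of $v$ in its column. $A_w$ is the set of labelings of the edges of $T(w)$ by nonnegative integers that weakly increase along every path from the root to a leaf and such that the label of each edge incident to a leaf does not exceed that leaf's capacity; $|t|$ is the sum of the labels of $t$. For $t\in A_w$, start with the all-ones mask on $\mathsf{w}$; for each valley column with leaf-edge label $m$, set to $0$ the top $m$ entries of that column together with all heap entries above them; $x(t)$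 is the product, in order, of the $\mathsf{w}_i$ whose mask value is $1$. *)

(* Defs.v *)
From HB Require Import structures.
From mathcomp Require Import all_boot all_order all_algebra all_fingroup.
From mathcomp Require Import boolp.
From mathcomp Require classical_sets.
From mathcomp Require Import zify.

Set Implicit Arguments.
Unset Strict Implicit.
Unset Printing Implicit Defensive.

Import GRing.Theory.

(* S_{n+1} is 'S_n.+1, with Coxeter generators s_1, ..., s_n. Permutations    *)
(* compose from left to right in MathComp; everything below is expressed      *)
(* through the group law, the generators and the Coxeter length, hence does   *)
(* not depend on that choice.                                                 *)
Section Coxeter.
Variable n : nat.
Implicit Types (w x y : 'S_n.+1) (u : seq nat) (k : nat).

Definition gen k : 'S_n.+1 := tperm (inord k.-1) (inord k).

Definition word_prod u : 'S_n.+1 := (\prod_(k <- u) gen k)%g.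

Definition is_word u := all (fun k => 0 < k <= n) u.

Definition inversions w : {set 'I_n.+1 * 'I_n.+1} :=
  [set p : 'I_n.+1 * 'I_n.+1 | (p.1 < p.2) && (w p.2 < w p.1)].

Definition inv w := #|inversions w|.

Lemma genE k (x : 'I_n.+1) : 0 < k <= n ->
  gen k x = (if x == k.-1 :> nat then k else if x == k :> nat then k.-1 else x) :> nat.
Proof.
case/andP=> k0 kn.
have Ea : (inord k.-1 : 'I_n.+1) = k.-1 :> nat by rewrite inordK //; lia.
have Eb : (inord k : 'I_n.+1) = k :> nat by rewrite inordK.
rewrite /gen; case: tpermP => [->|->|/eqP h1 /eqP h2]; rewrite ?Ea ?Eb ?eqxx //.
  by case: eqP => // ->.
by move: h1 h2; rewrite -!val_eqE /= Ea Eb => /negPf -> /negPf ->.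
Qed.

Lemma genK k : (gen k * gen k = 1)%g. Proof. exact: tperm2. Qed.
Lemma genV k : ((gen k)^-1 = gen k)%g. Proof. exact: tpermV. Qed.

Lemma val_inord k (h : k <= n) : (inord k : 'I_n.+1) = k :> nat.
Proof. by rewrite inordK. Qed.

Lemma gen_mono k (i j : 'I_n.+1) : 0 < k <= n -> i < j ->
  (i, j) != (inord k.-1, inord k) -> gen k i < gen k j.
Proof.
move=> hk lij; case/andP: (hk) => k0 kn.
rewrite xpair_eqE -!val_eqE /= !val_inord; try lia.
move=> ne; rewrite !genE //.
by do ![case: eqP => ?]; lia.
Qed.

Lemma inv_gen_lt k w : 0 < k <= n -> w (inord k.-1) < w (inord k) ->
  inv (gen k * w)%g = (inv w).+1.
Proof.
move=> hk ltw; case/andP: (hk) => k0 kn.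
set a : 'I_n.+1 := inord k.-1; set b : 'I_n.+1 := inord k.
pose f (p : 'I_n.+1 * 'I_n.+1) := (gen k p.1, gen k p.2).
have fK : involutive f.
  by move=> [i j]; rewrite /f /= /gen !tpermK.
have gab : gen k a = b by rewrite /gen tpermL.
have gba : gen k b = a by rewrite /gen tpermR.
have ab : a < b by rewrite !val_inord; lia.
have inab : (a, b) \in inversions (gen k * w)%g.
  by rewrite inE /= ab !permM gab gba.
rewrite /inv (cardsD1 (a, b)) inab add1n; congr _.+1.
rewrite -(card_imset _ (inv_inj fK)); apply: eq_card => -[i j].
rewrite -[(i, j)]fK mem_imset; last exact: inv_inj fK.
rewrite /f /= !inE /= !permM.
have gK (x : 'I_n.+1) : gen k (gen k x) = x by rewrite /gen tpermK.
rewrite !gK; apply/andP/andP.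
  move=> [ne /andP[lij ->]]; split=> //.
  by have := gen_mono hk lij ne; rewrite !gK.
move=> [lij ltw']; split.
  apply/eqP => -[ea eb]; move: lij.
  by rewrite -[i]gK -[j]gK ea eb gab gba ltnNge (ltnW ab).
rewrite ltw' andbT gen_mono //.
by apply/eqP => -[ea eb]; move: ltw'; rewrite ea eb -/a -/b ltnNge (ltnW ltw).
Qed.

Lemma inv_gen k w : 0 < k <= n ->
  inv (gen k * w)%g =
    if w (inord k.-1) < w (inord k) then (inv w).+1 else (inv w).-1.
Proof.
move=> hk; case: ifP => [|h]; first exact: inv_gen_lt.
have := inv_gen_lt (w := (gen k * w)%g) hk.
rewrite mulgA genK mul1g !permM /gen tpermL tpermR => -> //.
rewrite ltn_neqAle leqNgt h andbT.
case/andP: hk => k0 kn.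
by rewrite (inj_eq val_inj) (inj_eq perm_inj) -val_eqE /= !val_inord; lia.
Qed.

Lemma inv_gen_gt k w : 0 < k <= n ->
  (inv w < inv (gen k * w)%g) = (w (inord k.-1) < w (inord k)).
Proof. by move=> hk; rewrite inv_gen //; case: ifP => // _; lia. Qed.

Lemma inv1 : inv 1%g = 0.
Proof.
apply/eqP; rewrite cards_eq0 -subset0; apply/subsetP => p.
by rewrite !inE !perm1; lia.
Qed.

Lemma invV w : inv w^-1%g = inv w.
Proof.
pose f (p : 'I_n.+1 * 'I_n.+1) := (w p.2, w p.1).
have fI : injective f by move=> [i j] [i' j'] [] /perm_inj -> /perm_inj ->.
rewrite /inv -[in RHS](card_imset _ fI); apply: eq_card => -[i j].
have -> : (i, j) = f (w^-1 j, w^-1 i)%g by rewrite /f /= !permKV.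
rewrite mem_imset // !inE /f /=; move: (w^-1 j)%g (w^-1 i)%g => {}i {}j.
by rewrite !permK andbC.
Qed.

Lemma inv0 w : (forall k, 0 < k <= n -> w (inord k.-1) < w (inord k)) -> w = 1%g.
Proof.
move=> h.
have ge k : k <= n -> k <= w (inord k).
  elim: k => // k IH kn; apply: leq_ltn_trans (IH (ltnW kn)) _.
  exact: (h k.+1 kn).
have le k : k <= n -> w (inord (n - k)) <= n - k.
  elim: k => [|k IH] kn; first by rewrite subn0 -ltnS ltn_ord.
  have := h (n - k); have := IH (ltnW kn).
  rewrite (_ : (n - k).-1 = n - k.+1); last by lia.
  by move=> h1 h2; have := h2 _; lia.
apply/permP => i; rewrite perm1; apply/val_inj/eqP => /=.
have lei : i <= n by rewrite -ltnS.
have := ge i lei; have := le (n - i) (leq_subr _ _).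
rewrite subKn // inord_val; lia.
Qed.

Lemma exists_word w : exists u, [&& is_word u, word_prod u == w & size u == inv w].
Proof.
move: (ltnSn (inv w)); move: {2}(inv w).+1 => m; elim: m w => // m IH w hw.
have [h|] := pselect (forall k, 0 < k <= n -> w (inord k.-1) < w (inord k)).
  by rewrite (inv0 h); exists [::]; rewrite /word_prod big_nil inv1 !eqxx.
move=> /existsNP [k /not_implyP[hk /negP hw']].
have := inv_gen_lt (w := (gen k * w)%g) hk.
rewrite mulgA genK mul1g !permM /gen tpermL tpermR => hlt.
have {}hlt : inv w = (inv (gen k * w)%g).+1.
  apply: hlt; move: hw'; rewrite -leqNgt leq_eqVlt => /orP[|//].
  case/andP: hk => k0 kn.
  by rewrite (inj_eq val_inj) (inj_eq perm_inj) -val_eqE /= !val_inord; lia.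
have lt_m : inv (gen k * w)%g < m by rewrite -hlt.
have [u /and3P[uw /eqP up /eqP us]] := IH _ lt_m.
exists (k :: u); rewrite /= uw hk us hlt eqxx andbT /word_prod big_cons.
by rewrite -/(word_prod u) up mulgA genK mul1g eqxx.
Qed.

Lemma is_wordP u : is_word u ->
  exists t : (size u).-tuple 'I_n, map (fun i : 'I_n => i.+1) t = u.
Proof.
elim: u => [|k u IH] /=; first by exists [tuple].
case/andP=> hk /IH[t tE].
have lt_k : k.-1 < n by lia.
by exists [tuple of Ordinal lt_k :: t]; rewrite /= tE prednK //; lia.
Qed.

Lemma exists_word_size w :
  exists l, [exists u : l.-tuple 'I_n, word_prod (map (fun i : 'I_n => i.+1) u) == w].
Proof.
have [u /and3P[uw /eqP <- _]] := exists_word w.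
have [t tE] := is_wordP uw.
by exists (size u); apply/existsP; exists t; rewrite tE.
Qed.

Definition cox_length w : nat := ex_minn (exists_word_size w).

Lemma inv_word u : is_word u -> inv (word_prod u) <= size u.
Proof.
elim: u => [|k u IH] /=; first by rewrite /word_prod big_nil inv1.
case/andP=> hk /IH le_u; rewrite /word_prod big_cons -/(word_prod u) inv_gen //.
by case: ifP; lia.
Qed.

Lemma lengthE w : cox_length w = inv w.
Proof.
rewrite /cox_length; case: ex_minnP => l /existsP[u /eqP uw] lmin.
apply/eqP; rewrite eqn_leq; apply/andP; split.
  have [v /and3P[vw /eqP vp /eqP vs]] := exists_word w.
  have [t tE] := is_wordP vw.
  by rewrite -vs; apply: lmin; apply/existsP; exists t; rewrite tE vp.
have uw' : is_word (map (fun i : 'I_n => i.+1) u).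
  by apply/allP => _ /mapP[i _ ->] /=.
by have := inv_word uw'; rewrite uw size_map size_tuple.
Qed.

Definition reduced_word u w := [&& is_word u, word_prod u == w & size u == cox_length w].

Lemma exists_reduced w : exists u, reduced_word u w.
Proof. by have [u hu] := exists_word w; exists u; rewrite /reduced_word lengthE. Qed.

Lemma length1 : cox_length 1%g = 0.
Proof. by rewrite lengthE inv1. Qed.

Lemma length_word u : is_word u -> cox_length (word_prod u) <= size u.
Proof. by rewrite lengthE; apply: inv_word. Qed.

Lemma lengthV w : cox_length w^-1%g = cox_length w.
Proof. by rewrite !lengthE invV. Qed.

Lemma length_genl k w : 0 < k <= n -> cox_length (gen k * w)%g <= (cox_length w).+1.
Proof. by move=> hk; rewrite !lengthE inv_gen //; case: ifP => _; lia. Qed.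

Lemma length_genr k w : 0 < k <= n -> cox_length (w * gen k)%g <= (cox_length w).+1.
Proof.
move=> hk; rewrite -(lengthV (w * gen k)%g) invMg genV -(lengthV w).
exact: length_genl.
Qed.

Lemma length_wordr u w : is_word u -> cox_length (w * word_prod u)%g <= size u + cox_length w.
Proof.
elim: u w => [|k u IH] w /=; first by rewrite /word_prod big_nil mulg1.
case/andP=> hk hu; rewrite /word_prod big_cons -/(word_prod u) mulgA.
apply: leq_trans (IH _ hu) _; rewrite addSn -addnS leq_add2l.
exact: length_genr.
Qed.

Lemma asc_left k w : 0 < k <= n ->
  (cox_length w < cox_length (gen k * w)%g) = (w (inord k.-1) < w (inord k)).
Proof. by move=> hk; rewrite !lengthE inv_gen_gt. Qed.

Lemma asc_leftV k w : (cox_length w < cox_length (w * gen k)%g) =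
  (cox_length w^-1%g < cox_length (gen k * w^-1)%g).
Proof. by rewrite !lengthE -[inv w]invV -[inv (w * _)%g]invV invMg genV. Qed.

Lemma desc_left k w : 0 < k <= n ->
  (cox_length (gen k * w)%g < cox_length (gen k * (gen k * w))%g) =
  ~~ (cox_length w < cox_length (gen k * w)%g).
Proof.
move=> hk; rewrite !asc_left // !permM /gen tpermL tpermR -leqNgt.
rewrite [RHS]leq_eqVlt (inj_eq val_inj) (inj_eq perm_inj) -val_eqE /=.
by rewrite !val_inord; lia.
Qed.

Lemma asc_comm j k w : 0 < j <= n -> 0 < k <= n ->
  (gen j * w <> w * gen k)%g ->
  (cox_length (w * gen k)%g < cox_length (gen j * (w * gen k))%g) =
  (cox_length w < cox_length (gen j * w)%g).
Proof.
move=> hj hk ne; rewrite !asc_left // !permM.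
set a := w (inord j.-1); set b := w (inord j).
have nab : a != b.
  rewrite (inj_eq perm_inj) -val_eqE /= !val_inord; lia.
have conj : (gen j * w = w * tperm a b)%g.
  by rewrite /gen -[tperm a b]tpermJ /conjg !mulgA mulgV mul1g.
have n1 : (a, b) != (inord k.-1, inord k).
  by apply/eqP => -[ea eb]; apply: ne; rewrite conj ea eb.
have n2 : (b, a) != (inord k.-1, inord k).
  by apply/eqP => -[ea eb]; apply: ne; rewrite conj ea eb tpermC.
case: (ltngtP a b) => [lt|lt|/val_inj e]; last by rewrite e eqxx in nab.
  exact: gen_mono.
by apply/negbTE; rewrite -leqNgt ltnW // gen_mono.
Qed.

End Coxeter.

(* The Hecke algebra of S_{n+1} with parameter q: the free A-module on the    *)
(* T_w, with the product determined by                                        *)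
(*   T_s T_w = T_{sw}                  if l(sw) > l(w),                       *)
(*   T_s T_w = (q - 1) T_w + q T_{sw}  otherwise (Ts_mul below).              *)
Definition hecke (A : comNzRingType) (q : A) (n : nat) : Type :=
  {ffun 'S_n.+1 -> A^o}.

HB.instance Definition _ (A : comNzRingType) (q : A) n := Choice.on (hecke q n).
HB.instance Definition _ (A : comNzRingType) (q : A) n :=
  GRing.Lmodule.copy (hecke q n) {ffun 'S_n.+1 -> A^o}.

Section Hecke.
Local Open Scope ring_scope.
Variables (A : comNzRingType) (q : A) (n : nat).
Notation H := (hecke q n).
Implicit Types (w x y : 'S_n.+1) (h a b c : H).

Definition coef h w : A := (h : {ffun _ -> A^o}) w.

Definition Tb w : H := [ffun x => (x == w)%:R : A^o].

Lemma heckeE h : h = \sum_w coef h w *: Tb w.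
Proof.
apply/ffunP => x; rewrite sum_ffunE (bigD1 x) //= big1 ?addr0 => [|y ne].
  by rewrite !ffunE eqxx; rewrite /GRing.scale /= mulr1.
by rewrite !ffunE eq_sym (negPf ne); rewrite /GRing.scale /= mulr0.
Qed.

(* The linear map sending each T_w to F w. *)
Definition extend (F : 'S_n.+1 -> H) h : H := \sum_w coef h w *: F w.

Lemma extend_is_linear F : linear (extend F).
Proof.
move=> k a b; rewrite /extend scaler_sumr -big_split /=; apply: eq_bigr => w _.
by rewrite scalerA -scalerDl /coef !ffunE.
Qed.
HB.instance Definition _ F :=
  GRing.isLinear.Build A H H *:%R (extend F) (extend_is_linear F).

Lemma extendT F w : extend F (Tb w) = F w.
Proof.
rewrite /extend (bigD1 w) //= big1 => [|y ne].
  by rewrite /coef ffunE eqxx scale1r addr0.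
by rewrite /coef ffunE (negPf ne) scale0r.
Qed.

Lemma extend_eq (f g : {linear H -> H}) : (forall w, f (Tb w) = g (Tb w)) -> f =1 g.
Proof.
move=> fg h; rewrite [h]heckeE !linear_sum; apply: eq_bigr => w _.
by rewrite !linearZ /= fg.
Qed.

Definition redw w : seq nat := xchoose (exists_reduced w).

Lemma redwP w : reduced_word (redw w) w. Proof. exact: (xchooseP (exists_reduced w)). Qed.

(* Left and right multiplication by T_{s_k}, then by T_w. *)
Definition Ls k : H -> H := extend (fun w =>
  if (cox_length w < cox_length (gen n k * w)%g)%N then Tb (gen n k * w)%g
  else (q - 1) *: Tb w + q *: Tb (gen n k * w)%g).

Definition Rs k : H -> H := extend (fun w =>
  if (cox_length w < cox_length (w * gen n k)%g)%N then Tb (w * gen n k)%g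
  else (q - 1) *: Tb w + q *: Tb (w * gen n k)%g).

HB.instance Definition _ k := GRing.Linear.copy (Ls k) (Ls k).
HB.instance Definition _ k := GRing.Linear.copy (Rs k) (Rs k).

Definition Lw w h : H := foldr Ls h (redw w).
Definition Rw w h : H := foldl (fun h k => Rs k h) h (redw w).

Lemma foldL_linear u : linear (fun h : H => foldr Ls h u).
Proof. by move=> k a b; elim: u => //= j u ->; rewrite linearP. Qed.

Lemma foldR_linear u : linear (fun h : H => foldl (fun h k => Rs k h) h u).
Proof. by move=> k a b; elim: u a b => //= j u IH a b; rewrite linearP IH. Qed.

HB.instance Definition _ w := GRing.isLinear.Build A H H *:%R (Lw w) (foldL_linear _).
HB.instance Definition _ w := GRing.isLinear.Build A H H *:%R (Rw w) (foldR_linear _).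

Lemma LsT k w : Ls k (Tb w) =
  if (cox_length w < cox_length (gen n k * w)%g)%N then Tb (gen n k * w)%g
  else (q - 1) *: Tb w + q *: Tb (gen n k * w)%g.
Proof. exact: extendT. Qed.

Lemma RsT k w : Rs k (Tb w) =
  if (cox_length w < cox_length (w * gen n k)%g)%N then Tb (w * gen n k)%g
  else (q - 1) *: Tb w + q *: Tb (w * gen n k)%g.
Proof. exact: extendT. Qed.

Lemma comm_eq (V : lmodType A) (f g : {linear V -> V}) (a b : V) (x : bool) :
  f a = (if x then b else (q - 1) *: a + q *: b) -> f a = g a -> f b = g b ->
  f (g a) = g (f a).
Proof.
move=> fa ga gb; rewrite -ga fa.
by case: x fa => fa; rewrite ?linearD ?linearZ /= -?ga gb.
Qed.

Lemma comm_ne (V : lmodType A) (f g : {linear V -> V}) (a b c d : V) (x y : bool) :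
  f a = (if x then b else (q - 1) *: a + q *: b) ->
  g a = (if y then c else (q - 1) *: a + q *: c) ->
  f c = (if x then d else (q - 1) *: c + q *: d) ->
  g b = (if y then d else (q - 1) *: b + q *: d) ->
  f (g a) = g (f a).
Proof.
move=> fa ga fc gb; rewrite fa ga.
case: x fa fc; case: y ga gb => ga gb fa fc;
  rewrite ?linearD ?linearZ /= ?fa ?fc ?ga ?gb //.
by rewrite !scalerDr !scalerA ![(q * (q - 1))%R]mulrC addrACA.
Qed.

Lemma Ls_Rs j k h : (0 < j <= n)%N -> (0 < k <= n)%N -> Ls j (Rs k h) = Rs k (Ls j h).
Proof.
move=> hj hk.
pose f : {linear H -> H} := Ls j \o Rs k; pose g : {linear H -> H} := Rs k \o Ls j.
apply: (extend_eq (f := f) (g := g)) => w.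
change (Ls j (Rs k (Tb w)) = Rs k (Ls j (Tb w))); clear f g.
have [e|/eqP ne] := eqVneq (gen n j * w)%g (w * gen n k)%g.
  have ssw : (gen n j * (gen n j * w) = w)%g by rewrite mulgA genK mul1g.
  have wtt : (gen n j * w * gen n k = w)%g by rewrite e -mulgA genK mulg1.
  have E1 : Ls j (Tb w) = Rs k (Tb w) by rewrite LsT RsT e.
  have E2 : Ls j (Tb (gen n j * w)%g) = Rs k (Tb (gen n j * w)%g).
    by rewrite LsT RsT ssw wtt.
  exact: (comm_eq (f := Ls j) (g := Rs k) (LsT j w) E1 E2).
have dl := asc_comm hj hk ne.
have dr : (cox_length (gen n j * w)%g < cox_length (gen n j * w * gen n k)%g)%N =
          (cox_length w < cox_length (w * gen n k)%g)%N.
  have ne' : (gen n k * w^-1 <> w^-1 * gen n j)%g.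
    move=> /(congr1 (fun x => x^-1)%g); rewrite !invMg !invgK !genV => e.
    by apply: ne; rewrite e.
  have := asc_comm hk hj ne'.
  rewrite (asc_leftV k w) (asc_leftV k (gen n j * w)%g).
  by rewrite (invMg (gen n j)) (genV n j).
have E1 := LsT j (w * gen n k)%g; have E2 := RsT k (gen n j * w)%g.
rewrite dl mulgA in E1; rewrite dr in E2.
exact: (comm_ne (f := Ls j) (g := Rs k) (LsT j w) (RsT k w) E1 E2).
Qed.

Lemma Lw_Rs w k h : (0 < k <= n)%N -> Lw w (Rs k h) = Rs k (Lw w h).
Proof.
move=> hk; have /and3P[+ _ _] := redwP w; rewrite /Lw.
elim: (redw w) => [_|j u IH /andP[hj hu]]; first by [].
exact: etrans (congr1 (Ls j) (IH hu)) (Ls_Rs _ hj hk).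
Qed.

Lemma Lw_Rw w x h : Lw w (Rw x h) = Rw x (Lw w h).
Proof.
have /and3P[+ _ _] := redwP x; rewrite /Rw.
elim: (redw x) h => [h _|k u IH h /andP[hk hu]]; first by [].
by rewrite [LHS]/= [RHS]/= IH // Lw_Rs.
Qed.

Lemma Ls_word u : is_word n u -> size u = cox_length (word_prod n u) ->
  foldr Ls (Tb 1%g) u = Tb (word_prod n u).
Proof.
elim: u => [|k u IH]; first by rewrite /word_prod big_nil.
case/andP=> hk hu; rewrite /word_prod big_cons -/(word_prod n u) => /= eu.
have lek := length_word hu; have lek' := length_genl (word_prod n u) hk.
have e : size u = cox_length (word_prod n u) by lia.
by rewrite IH // LsT ifT // -e -eu.
Qed.

Lemma Rs_word u w : is_word n u -> (size u + cox_length w)%N = cox_length (w * word_prod n u)%g ->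
  foldl (fun h k => Rs k h) (Tb w) u = Tb (w * word_prod n u)%g.
Proof.
elim: u w => [|k u IH] w; first by rewrite /word_prod big_nil mulg1.
case/andP=> hk hu; rewrite /word_prod big_cons -/(word_prod n u) mulgA => /= eu.
have le1 := length_genr w hk; have := length_wordr (w * gen n k)%g hu.
rewrite -eu => le3.
have e : cox_length (w * gen n k)%g = (cox_length w).+1 by lia.
rewrite RsT ifT ?e // IH // -eu e; lia.
Qed.

Lemma Lw1 w : Lw w (Tb 1%g) = Tb w.
Proof.
have /and3P[hu /eqP e /eqP hs] := redwP w.
by rewrite /Lw Ls_word // ?e.
Qed.

Lemma Rw1 w : Rw w (Tb 1%g) = Tb w.
Proof.
have /and3P[hu /eqP e /eqP hs] := redwP w.
by rewrite /Rw Rs_word // mul1g ?e // length1 addn0.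
Qed.

Lemma redw1 : redw 1%g = [::].
Proof. by have /and3P[_ _ /eqP] := redwP 1%g; rewrite length1; case: redw. Qed.

Definition mulh a b : H := extend (fun w => Lw w b) a.
Definition mulhr c b : H := extend (fun w => Rw w b) c.

Lemma mulhDr a : {morph mulh a : b c / b + c}.
Proof.
move=> b c; rewrite /mulh /extend -big_split; apply: eq_bigr => w _ /=.
by rewrite linearD scalerDr.
Qed.

Lemma mulhZr a k b : mulh a (k *: b) = k *: mulh a b.
Proof.
rewrite /mulh /extend scaler_sumr; apply: eq_bigr => w _.
by rewrite linearZ /= !scalerA mulrC.
Qed.

Lemma mulhrP a b c : mulh a (mulhr c b) = mulhr c (mulh a b).
Proof.
have mulh_sum (I : finType) (F : I -> H) : mulh a (\sum_i F i) = \sum_i mulh a (F i).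
  apply: (big_morph _ (mulhDr a)).
  by have := mulhZr a 0 0; rewrite !scale0r.
rewrite /mulhr /extend mulh_sum; apply: eq_bigr => x _; rewrite mulhZr; congr (_ *: _).
rewrite /mulh /extend linear_sum; apply: eq_bigr => w _.
by rewrite linearZ /= Lw_Rw.
Qed.

Lemma mulhr1 c : mulhr c (Tb 1%g) = c.
Proof. by rewrite [RHS]heckeE; apply: eq_bigr => w _; rewrite Rw1. Qed.

Lemma mulh1 a : mulh a (Tb 1%g) = a.
Proof. by rewrite [RHS]heckeE; apply: eq_bigr => w _; rewrite Lw1. Qed.

Lemma mul1h a : mulh (Tb 1%g) a = a.
Proof. by rewrite /mulh extendT /Lw redw1. Qed.

Lemma mulhE a c : mulh a c = mulhr c a.
Proof. by rewrite -{1}[c]mulhr1 mulhrP mulh1. Qed.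

Lemma mulhA : associative mulh.
Proof. by move=> a b c; rewrite [RHS]mulhE -mulhrP -mulhE. Qed.

Lemma mulhDl : left_distributive mulh +%R.
Proof. by move=> a b c; rewrite /mulh linearD. Qed.

Lemma hecke_neq0 : Tb 1%g != 0.
Proof.
apply/eqP => /(congr1 (fun h => coef h 1%g)) /eqP.
by rewrite /coef !ffunE eqxx oner_eq0.
Qed.

HB.instance Definition _ := GRing.Zmodule_isNzRing.Build H
  mulhA mul1h mulh1 mulhDl mulhDr hecke_neq0.

Lemma hecke_scaleAl k a b : k *: (a * b) = (k *: a) * b.
Proof. by rewrite /GRing.mul /= /mulh linearZ. Qed.
HB.instance Definition _ := GRing.LSemiModule_isLSemiAlgebra.Build A H hecke_scaleAl.

Lemma hecke_scaleAr k a b : k *: (a * b) = a * (k *: b).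
Proof. by rewrite [RHS]mulhZr. Qed.
HB.instance Definition _ := GRing.LSemiAlgebra_isSemiAlgebra.Build A H hecke_scaleAr.

Lemma one_heckeE : 1 = Tb 1%g :> H.
Proof. by []. Qed.

Lemma Ts_mul k w : (0 < k <= n)%N -> Tb (gen n k) * Tb w =
  if (cox_length w < cox_length (gen n k * w)%g)%N then Tb (gen n k * w)%g
  else (q - 1) *: Tb w + q *: Tb (gen n k * w)%g.
Proof.
move=> hk; rewrite -LsT.
have -> : Tb (gen n k) = Ls k (Tb 1%g).
  rewrite LsT ifT ?mulg1 // length1 lengthE -[gen n k]mulg1 inv_gen // !perm1 inv1.
  by case/andP: (hk) => k0 kn; rewrite ifT // !val_inord; lia.
rewrite [LHS]mulhE.
have e h : mulhr (Tb w) h = Rw w h by rewrite /mulhr extendT.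
rewrite e -(Rw1 w) /Rw; have /and3P[+ _ _] := redwP w.
elim: (redw w) (Tb 1%g) => //= j u IH h /andP[hj hu].
by rewrite -Ls_Rs // IH.
Qed.
End Hecke.

Section ClassicalInverse.
Local Open Scope ring_scope.
Variable R : nzRingType.
Implicit Types x y : R.

Definition invertible x := exists y, y * x = 1 /\ x * y = 1.
Definition cunit : pred R := fun x => `[< invertible x >].
Definition cinv x : R := if pselect (invertible x) is left e then sval (cid e) else x.

Lemma cinvP x : invertible x -> cinv x * x = 1 /\ x * cinv x = 1.
Proof. by move=> ux; rewrite /cinv; case: pselect => // e; exact: (svalP (cid e)). Qed.

Lemma mulVc : {in cunit, left_inverse 1 cinv *%R}.
Proof. by move=> x /asboolP /cinvP[]. Qed.

Lemma divcc : {in cunit, right_inverse 1 cinv *%R}.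
Proof. by move=> x /asboolP /cinvP[]. Qed.

Lemma cunitP x y : y * x = 1 /\ x * y = 1 -> cunit x.
Proof. by move=> h; apply/asboolP; exists y. Qed.

Lemma cinv_out : {in [predC cunit], cinv =1 id}.
Proof. by move=> x /asboolPn ux; rewrite /cinv; case: pselect. Qed.
End ClassicalInverse.

HB.instance Definition _ (A : comNzRingType) (q : A) n :=
  GRing.NzRing_hasMulInverse.Build (hecke q n)
    (@mulVc (hecke q n)) (@divcc (hecke q n)) (@cunitP (hecke q n))
    (@cinv_out (hecke q n)).

(* Z[q^(1/2), q^(-1/2)], as the ring of fractions p / 'X^k (p in Z['X]) inside *)
(* Q('X); the indeterminate stands for q^(1/2).                               *)
Section Laurent.
Local Open Scope ring_scope.

Lemma frac_sub (F : fieldType) (a b x y : F) : a != 0 -> b != 0 ->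
  x / a - y / b = (x * b - y * a) / (a * b).
Proof. by move=> a0 b0; rewrite -mulNr addf_div // mulNr. Qed.

Lemma cross_mul (R : comNzRingType) (a b ak ck al cl : R) :
  ak * ck = 1 -> al * cl = 1 -> a * ak = b * al -> a * cl = b * ck.
Proof.
move=> k1 l1 e; rewrite -[a]mulr1 -k1 mulrA e -!mulrA; congr (_ * _).
by rewrite mulrCA l1 mulr1.
Qed.

Lemma sub_mul (R : comNzRingType) (a b ak ck al cl : R) :
  ak * ck = 1 -> al * cl = 1 ->
  (a * al - b * ak) * (ck * cl) = a * ck - b * cl.
Proof.
move=> k1 l1; rewrite mulrBl; congr (_ - _).
  by rewrite -mulrA [al * _]mulrCA l1 mulr1.
by rewrite -mulrA [ak * _]mulrA k1 mul1r.
Qed.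

Definition laurent_pred : {pred {fraction {poly int}}} := fun x =>
  `[< exists pk : {poly int} * nat, x = (tofrac pk.1 / tofrac ('X ^+ pk.2)) >].

Lemma X_neq0 k : tofrac ('X ^+ k) != 0 :> {fraction {poly int}}.
Proof. by rewrite tofrac_eq0 expf_neq0 // polyX_eq0. Qed.

Lemma laurent_subring : subring_closed laurent_pred.
Proof.
split.
- by apply/asboolP; exists (1, 0); rewrite expr0 tofrac1 divr1.
- move=> x y /asboolP[[p k] /= ->] /asboolP[[p' k'] /= ->]; apply/asboolP.
  exists (p * 'X ^+ k' - p' * 'X ^+ k, (k + k')%N) => /=.
  by rewrite tofracB !tofracM exprD tofracM; apply: frac_sub; apply: X_neq0.
- move=> x y /asboolP[[p k] /= ->] /asboolP[[p' k'] /= ->]; apply/asboolP.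
  exists (p * p', (k + k')%N) => /=.
  by rewrite tofracM exprD tofracM; apply: mulf_div.
Qed.
HB.instance Definition _ := GRing.isSubringClosed.Build _ laurent_pred laurent_subring.

Record laurent := Laurent { laurent_val :> {fraction {poly int}};
                            _ : laurent_val \in laurent_pred }.
HB.instance Definition _ := [isSub for laurent_val].
HB.instance Definition _ := [Choice of laurent by <:].
HB.instance Definition _ := [SubChoice_isSubComNzRing of laurent by <:].
HB.instance Definition _ := GRing.NzRing_hasMulInverse.Build laurent
  (@mulVc laurent) (@divcc laurent) (@cunitP laurent) (@cinv_out laurent).

Lemma qhalf_subproof : tofrac 'X \in laurent_pred.
Proof. by apply/asboolP; exists ('X, 0); rewrite expr0 tofrac1 divr1. Qed.

Lemma qhalfV_subproof : (tofrac 'X)^-1 \in laurent_pred.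
Proof. by apply/asboolP; exists (1, 1); rewrite tofrac1 div1r. Qed.

Definition qhalf : laurent := Laurent qhalf_subproof.

Lemma qhalf_unit : qhalf \is a GRing.unit.
Proof.
have e : qhalf * Laurent qhalfV_subproof = 1.
  by apply: val_inj; rewrite /= divff // -['X]expr1 X_neq0.
by apply/unitrP; exists (Laurent qhalfV_subproof); rewrite mulrC e.
Qed.

Lemma qhalfVK k : qhalf^-1 ^+ k * qhalf ^+ k = 1.
Proof. by rewrite -exprMn mulVr ?qhalf_unit // expr1n. Qed.

Lemma laurent_fracP (x : laurent) :
  exists pk : {poly int} * nat, laurent_val x = tofrac pk.1 / tofrac ('X ^+ pk.2).
Proof. by case: x => x /= /asboolP. Qed.

(* The involution q^(1/2) |-> q^(-1/2): a fraction p('X) / 'X^k is sent to     *)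
(* p(q^(-1/2)) q^(k/2); by bar_frac the choice of p and k is irrelevant.       *)
Definition bar (x : laurent) : laurent :=
  let pk := sval (cid (laurent_fracP x)) in
  (map_poly intr pk.1).[qhalf^-1] * qhalf ^+ pk.2.

Lemma bar_frac (x : laurent) p k : laurent_val x = tofrac p / tofrac ('X ^+ k) ->
  bar x = (map_poly intr p).[qhalf^-1] * qhalf ^+ k.
Proof.
rewrite /bar; case: cid => -[p' k'] /= -> e.
have {e} : p' * 'X ^+ k = p * 'X ^+ k'.
  apply/eqP; rewrite -tofrac_eq !tofracM -eqr_div ?X_neq0 //; exact/eqP.
move=> /(congr1 (fun r => (map_poly (intr : int -> laurent) r).[qhalf^-1])).
rewrite !rmorphM /= !map_polyXn !hornerM !hornerXn => e.
exact: cross_mul (qhalfVK k) (qhalfVK k') e.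
Qed.

Lemma bar_qhalf : bar qhalf = qhalf^-1.
Proof.
rewrite (@bar_frac qhalf 'X 0) /= ?expr0 ?tofrac1 ?divr1 //.
by rewrite map_polyX hornerX mulr1.
Qed.

Lemma bar_is_zmod_morphism : zmod_morphism bar.
Proof.
move=> x y; have [[p k] /= ex] := laurent_fracP x; have [[p' k'] /= ey] := laurent_fracP y.
rewrite (bar_frac ex) (bar_frac ey) (@bar_frac _ (p * 'X ^+ k' - p' * 'X ^+ k) (k + k')).
  rewrite rmorphB !rmorphM /= !map_polyXn hornerD hornerN !hornerM !hornerXn.
  by rewrite exprD; apply: sub_mul; apply: qhalfVK.
change (laurent_val x - laurent_val y =
  tofrac (p * 'X ^+ k' - p' * 'X ^+ k) / tofrac ('X ^+ (k + k'))).
by rewrite ex ey tofracB !tofracM exprD tofracM; apply: frac_sub; apply: X_neq0.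
Qed.

Lemma bar_is_monoid_morphism : monoid_morphism bar.
Proof.
split=> [|x y].
  rewrite (@bar_frac 1 1 0) /= ?expr0 ?tofrac1 ?divr1 //.
  by rewrite rmorph1 hornerC mulr1.
have [[p k] /= ex] := laurent_fracP x; have [[p' k'] /= ey] := laurent_fracP y.
rewrite (bar_frac ex) (bar_frac ey) (@bar_frac _ (p * p') (k + k')).
  by rewrite rmorphM hornerM exprD mulrACA.
change (laurent_val x * laurent_val y = tofrac (p * p') / tofrac ('X ^+ (k + k'))).
by rewrite ex ey tofracM exprD tofracM; apply: mulf_div.
Qed.

HB.instance Definition _ := GRing.isZmodMorphism.Build laurent laurent bar
  bar_is_zmod_morphism.
HB.instance Definition _ := GRing.isMonoidMorphism.Build laurent laurent bar
  bar_is_monoid_morphism.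
End Laurent.

Notation heckeL n := (hecke (qhalf ^+ 2)%R n).

Lemma gen_unit n k : 0 < k <= n -> (Tb _ (gen n k) : heckeL n) \is a GRing.unit.
Proof.
move=> hk; set t : heckeL n := Tb _ _.
have tt : (t * t = (qhalf ^+ 2 - 1) *: t + (qhalf ^+ 2)%:A)%R.
  rewrite /t Ts_mul // genK ifF // length1; exact: ltn0.
have qK : (qhalf^-1 ^+ 2 * qhalf ^+ 2 = 1 :> laurent)%R.
  by rewrite -exprMn mulVr ?qhalf_unit // expr1n.
have e1 : (t * (t - (qhalf ^+ 2 - 1)%:A) = (qhalf ^+ 2)%:A)%R.
  by rewrite mulrBr tt -scalerAr mulr1 addrC addKr.
have e2 : ((t - (qhalf ^+ 2 - 1)%:A) * t = (qhalf ^+ 2)%:A)%R.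
  by rewrite mulrBl tt -scalerAl mul1r addrC addKr.
apply/unitrP; exists (qhalf^-1 ^+ 2 *: (t - (qhalf ^+ 2 - 1)%:A))%R.
by rewrite -scalerAl -scalerAr e1 e2 scalerA qK scale1r.
Qed.

Lemma Tb_unit n (w : 'S_n.+1) : (Tb _ w : heckeL n) \is a GRing.unit.
Proof.
have [u /and3P[hu /eqP <- /eqP]] := exists_reduced w; elim: u hu => [|k u IH] /=.
  by rewrite /word_prod big_nil -one_heckeE unitr1.
case/andP=> hk hu; rewrite /word_prod big_cons -/(word_prod n u) => eu.
have lek := length_word hu.
have lek' : cox_length (gen n k * word_prod n u)%g <= (cox_length (word_prod n u)).+1.
  by rewrite !lengthE inv_gen //; case: ifP; lia.
have -> : (Tb _ (gen n k * word_prod n u)%g = Tb _ (gen n k) * Tb _ (word_prod n u) :> heckeL n)%R.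
  by rewrite Ts_mul // ifT //; lia.
by rewrite unitrMl ?gen_unit // IH //; lia.
Qed.

Section KazhdanLusztig.
Local Open Scope ring_scope.
Variable n : nat.
Implicit Types w x y : 'S_n.+1.

Definition bruhat_step : rel 'S_n.+1 := fun x y =>
  (cox_length x < cox_length y)%N &&
  [exists i : 'I_n.+1, exists j : 'I_n.+1, (i != j) && (y == x * tperm i j)%g].

Definition bruhat_le : rel 'S_n.+1 := connect bruhat_step.

(* The bar involution: semilinear with respect to [bar], and inverting        *)
(* T_{w^-1}, which is a unit by Tb_unit. *)
Definition barH (h : heckeL n) : heckeL n :=
  \sum_w bar (coef h w) *: (Tb (qhalf ^+ 2) (w^-1)%g)^-1.

Definition Bprime x : heckeL n :=
  qhalf ^- cox_length x *: \sum_(y | bruhat_le y x) Tb _ y.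

(* The second clause is deg P_{x,w} <= (l(w) - l(x) - 1) / 2. *)
Definition is_KL w (C : heckeL n) := exists P : 'S_n.+1 -> {poly int},
  [/\ P w = 1,
      forall x, bruhat_le x w -> x != w ->
        (2 * (size (P x)).-1 + cox_length x + 1 <= cox_length w)%N,
      C = qhalf ^- cox_length w *:
          \sum_(x | bruhat_le x w) (map_poly intr (P x)).[qhalf ^+ 2] *: Tb _ x
    & barH C = C].

(* C'_w, picked by classical choice as the element satisfying is_KL. *)
Definition KL w : heckeL n := classical_sets.xget 0 (is_KL w).
End KazhdanLusztig.

Section Cograssmannian.
Variable n : nat.
Implicit Types (w x : 'S_n.+1) (k z : nat).

Definition right_ascent w k := cox_length w < cox_length (w * gen n k)%g.

Definition cograssmannian w := forall j k, 0 < j <= n -> 0 < k <= n ->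
  right_ascent w j -> right_ascent w k -> j = k.

(* W_J for J = {s_1, ..., s_n} \ {s_z} *)
Definition parabolic z : {group 'S_n.+1} :=
  <<[set gen n k.+1 | k : 'I_n & k.+1 != z]>>%G.

Definition min_coset_rep z w : 'S_n.+1 :=
  [arg min_(x < w | x \in (w *: parabolic z)%g) cox_length x].

(* (s_1 ... s_{z-1})(s_1 ... s_{z-2}) ... (s_1) followed by                   *)
(* (s_n ... s_{z+1})(s_n ... s_{z+2}) ... (s_n): a reduced word for w_0^J.    *)
Definition w0J_word z : seq nat :=
  flatten [seq iota 1 (z - 1 - j) | j <- iota 0 (z - 1)] ++
  flatten [seq rev (iota (z + 1 + j) (n - z - j)) | j <- iota 0 (n - z)].

(* From here on, a is a reduced word of the minimal coset representative.     *)
Variables (z : nat) (a : seq nat).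

Definition full_word : seq nat := a ++ w0J_word z.

(* Positions are counted from 0; those smaller than size a are the entries of *)
(* the minimal coset representative.                                          *)
Definition position := 'I_(size full_word).
Implicit Types i j : position.

Definition column i : nat := nth 0 full_word i.

Definition heap_step : rel position := fun i j =>
  (j < i) && (gen n (column i) * gen n (column j) != gen n (column j) * gen n (column i))%g.

Definition heap_le : rel position := connect heap_step.

Definition heap_lt : rel position := fun i j => (i != j) && heap_le i j.

Definition is_top k i := [&& i < size a, column i == k &
  [forall j : position, (j < size a) && (column j == k) ==> heap_le j i]].

(* A symbol is recorded between the columns k and k+1. *)
Definition has_symbol k := (k \in a) && (k.+1 \in a).

Definition lparen k := has_symbol k &&
  [exists i : position, exists j : position,
     [&& is_top k i, is_top k.+1 j & heap_lt j i]].

Definition rparen k := has_symbol k && ~~ lparen k.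

(* Parenthesis strings: true stands for an opening parenthesis. *)
Definition balanced (b : seq bool) :=
  (count negb b == count id b) &&
  all (fun m => count negb (take m b) <= count id (take m b)) (iota 0 (size b)).

Definition matched k l :=
  [&& lparen k, rparen l, k < l, all has_symbol (iota k.+1 (l - k.+1)) &
      balanced [seq lparen m | m <- iota k.+1 (l - k.+1)]].

(* Non-root vertices of T(w). An edge is identified with its endpoint that is *)
(* farther from the root, so these also index the edges.                      *)
Definition vertex := {p : 'I_n * 'I_n | matched p.1 p.2}.
Implicit Types p : vertex.

Definition descendant p' p :=
  ((val p).1 < (val p').1) && ((val p').2 < (val p).2).

Definition is_leaf p := nat_of_ord (val p).2 == (val p).1.+1.

(* For a leaf: the column between its two symbols. *)
Definition valley_column p : nat := (val p).2.

Definition capacity k := count_mem k a.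

Definition admissible (t : vertex -> nat) :=
  [forall p, forall p', descendant p' p ==> (t p <= t p')] &&
  [forall p, is_leaf p ==> (t p <= capacity (valley_column p))].

Lemma leaf_below p : exists2 p', is_leaf p' & p' = p \/ descendant p' p.
Proof.
case: p => -[k l] kl; have /and5P[lk rl ltkl /allP hs bal] := kl.
rewrite /= in lk rl ltkl hs bal.
have [e|ne] := eqVneq (nat_of_ord l) k.+1.
  exists (exist _ (k, l) kl); first by rewrite /is_leaf /= e.
  by left.
set b := [seq lparen m | m <- _] in bal.
have szb : size b = l - k.+1 by rewrite size_map size_iota.
have nthb m : m < l - k.+1 -> nth true b m = lparen (k.+1 + m).
  by move=> hm; rewrite (nth_map 0) ?size_iota // nth_iota.
case/andP: bal => /eqP eqb /allP pre.
have cnt : count id b + count negb b = size b by rewrite -(count_predC id b); congr (_ + _).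
have hasb : has negb b by rewrite has_count; lia.
have b0 : nth true b 0.
  have : count negb (take 1 b) <= count id (take 1 b).
    by apply: pre; rewrite mem_iota; move: hasb; rewrite has_count; lia.
  by case: (b) => [|x c] //=; rewrite take0; case: x.
set m := find negb b.
have ltm : m < l - k.+1 by rewrite -szb -has_find.
have m0 : 0 < m.
  by rewrite lt0n; apply/eqP => m0; have := nth_find true hasb; rewrite -/m m0 b0.
have bm : ~~ lparen (k.+1 + m) by rewrite -nthb //; apply: nth_find.
have bm1 : lparen (k + m).
  have lt : m.-1 < find negb b by rewrite -/m; lia.
  have := before_find true lt; rewrite nthb; last by lia.
  by rewrite (_ : k.+1 + m.-1 = k + m); [case: lparen | lia].
have lt1 : k + m < n by have := ltn_ord l; lia.
have lt2 : k.+1 + m < n by have := ltn_ord l; lia.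
have hm : matched (k + m) (k.+1 + m).
  rewrite /matched bm1 /rparen bm hs ?mem_iota /=; last by lia.
  by rewrite addSn ltnSn subnn.
exists (exist (fun p : 'I_n * 'I_n => matched p.1 p.2) (Ordinal lt1, Ordinal lt2) hm).
  by rewrite /is_leaf /= addSn.
by right; rewrite /descendant /=; lia.
Qed.

Lemma admissible_bound t p : admissible t -> t p <= size a.
Proof.
case/andP=> /forallP mono /forallP cap.
have [p' leaf_p' h] := leaf_below p.
have := implyP (cap p') leaf_p'; have := count_size (pred1 (valley_column p')) a.
rewrite -/(capacity _) => le1 le2.
apply: leq_trans (leq_trans le2 le1).
by case: h => [-> //|d]; apply: (implyP (forallP (mono p) p') d).
Qed.

(* Labels of admissible labelings never exceed size a (admissible_bound), so  *)
(* this ranges over all of them.                                              *)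
Definition labeling := {ffun vertex -> 'I_(size a).+1}.

Definition labelings : {set labeling} :=
  [set t : labeling | admissible (fun p => t p)].

Variable t : labeling.

Definition weight := \sum_p t p.

Definition among_top m j :=
  #|[set i : position | (column i == column j) && heap_lt j i]| < m.

Definition masked i := [exists p, exists j : position,
  [&& is_leaf p, column j == valley_column p, among_top (t p) j & heap_le j i]].

Definition masked_prod : 'S_n.+1 :=
  (\prod_(i < size full_word | ~~ masked i) gen n (column i))%g.
End Cograssmannian.

(* Main.v *)
(* Encode a left coset of W_J by the word of n+1 parentheses whose i-th letter *)
(* (counted from 0) closes when w i >= z. Left multiplication by s_k swaps the *)
(* letters k-1 and k, and below a longest coset representative the Bruhat *)
(* order is dominance of heights, where the height of w at k is the number of *)
(* closing letters among the first k. On functions of words, *)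
(* q^(1/2) - q^(-1/2) T_s acts as a Temperley-Lieb generator, a cap followed *)
(* by a cup. Closing all the matched pairs of a word by caps yields *)
(* functionals that commute with the bar involution up to a constant, and the *)
(* candidate elements are dual to them: a cap sends the candidate of a word X *)
(* to the candidate of X with a pair () deleted, or to 0. Hence the candidates *)
(* are bar invariant. For the Deodhar-type sum, y <= x(t) holds if and only if *)
(* the heights of y are at most those of w, by a margin of at least the leaf *)
(* label at every valley; so the coefficient of T_y counts the labelings *)
(* bounded by the height differences inside each matched pair, which are the *)
(* labelings of the candidate. The degree bound follows by charging the label *)
(* of every pair to its two sites, as l(w) - l(x(t)) is the sum over all sites *)
(* of the height differences. *)

From HB Require Import structures.
Require Import Defs.
From mathcomp Require Import all_boot all_order all_algebra all_fingroup.
From mathcomp Require Import boolp zify ring.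

Set Implicit Arguments.
Unset Strict Implicit.
Unset Printing Implicit Defensive.

Import GRing.Theory.

(** * Functionals and candidates on words of parentheses *)

Section Words.
Local Open Scope ring_scope.
Variables (R : comUnitRingType) (v : R).
Implicit Types (X Y s : seq bool) (S : seq nat) (x y : seq bool -> R) (b i j p m : nat).

Fixpoint cap i x : seq bool -> R :=
  match i with
  | 0 => fun s => x [:: false, true & s] - v^-1 * x [:: true, false & s]
  | i'.+1 => fun s => if s is c :: s' then cap i' (fun r => x (c :: r)) s' else 0
  end.

Fixpoint cup i y : seq bool -> R :=
  match i with
  | 0 => fun s => match s with
                  | [:: false, true & s'] => v * y s'
                  | [:: true, false & s'] => - y s'
                  | _ => 0
                  end
  | i'.+1 => fun s => if s is c :: s' then cup i' (fun r => y (c :: r)) s' else 0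
  end.

(* The matched pairs of X, read after b pending opening letters, are closed *)
(* by caps; the unmatched letters are evaluated as they stand. *)
Fixpoint dual b X x : R :=
  match X, b with
  | [::], _ => x (nseq b false)
  | false :: X', _ => dual b.+1 X' x
  | true :: X', 0 => dual 0 X' (fun r => x (true :: r))
  | true :: X', b'.+1 => dual b' X' (cap b' x)
  end.

(* LS X Y 0 0 [:: 1] is v^(l(y) - l(w)) P_{y,w}(v^2) for X, Y the words of w *)
(* and y, both longest in their cosets. Here p and m count the closing letters *)
(* already read in X and Y. The stack S holds, for each opening letter of X *)
(* still open, the number of labels allowed for its pair; its bottom entry *)
(* detects failing dominance. *)
Fixpoint LS X Y p m S : R :=
  match X, Y with
  | [::], [::] => (all (fun b => 0 < b)%N S)%:R
  | c :: X', d :: Y' =>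
      let p' := (p + c)%N in let m' := (m + d)%N in let e := (p'.+1 - m')%N in
      v^-1 ^+ e.-1 *
      (if c then
         match S with
         | [:: b1, b0 & S'] =>
             \sum_(0 <= j < b1) v ^+ (2 * j) * LS X' Y' p' m' (minn b0 (minn j.+1 e) :: S')
         | [:: b] => LS X' Y' p' m' [:: minn b e]
         | [::] => 0
         end
       else LS X' Y' p' m' (e :: S))
  | _, _ => 0
  end.

Lemma LS_eq0 X Y p m F S : LS X Y p m (F ++ 0%N :: S) = 0.
Proof.
elim: X Y p m F S => [|c X IH] [|d Y] p m F S //=.
  by rewrite all_cat /= andbF.
case: c.
  case: F => [|b1 [|b0 F]] /=.
  - case: S => [|b0 S]; rewrite ?big_geq ?mulr0 //.
    by rewrite min0n (IH Y _ _ [::] [::]) mulr0.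
  - rewrite big1 ?mulr0 // => j _; rewrite min0n (IH Y _ _ [::] S) mulr0 //.
  - rewrite big1 ?mulr0 // => j _; rewrite -cat_cons IH mulr0 //.
by rewrite -cat_cons IH mulr0.
Qed.

Lemma LS_min X Y p m F S b c c' : minn b c = minn b c' ->
  LS X Y p m (F ++ [:: b, c & S]) = LS X Y p m (F ++ [:: b, c' & S]).
Proof.
elim: X Y p m F b => [|l X IH] [|d Y] p m F b //= bc.
  congr (_%:R : R); congr nat_of_bool; rewrite !all_cat /=; congr (_ && _).
  by rewrite !andbA; congr (_ && _); lia.
congr (_ * _); case: l; last by rewrite -!cat_cons IH.
case: F => [|b1 [|b0 F]] /=.
- rewrite !big_nat; apply: eq_bigr => j hj.
  by congr (_ * LS _ _ _ _ (_ :: _)); lia.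
- apply: eq_bigr => j _; congr (_ * _); apply: (IH _ _ _ [::]); lia.
- by apply: eq_bigr => j _; rewrite -!cat_cons IH.
Qed.

Lemma LS_shift X Y p m S : LS X Y p.+1 m.+1 S = LS X Y p m S.
Proof.
elim: X Y p m S => [|c X IH] [|d Y] p m S //=.
rewrite !addSn subSS IH; congr (_ * _); case: c => //; case: S => [|b1 [|b0 S]] //.
by apply: eq_bigr => j _; rewrite IH.
Qed.

Definition head_le S e := if S is b :: _ then (b <= e)%N else false.

Definition low_at i X := (nth true X i == false) && (nth false X i.+1 == true).
Definition del i X := take i X ++ drop i.+2 X.

Lemma capZ i k x : cap i (fun s => k * x s) =1 (fun s => k * cap i x s).
Proof.
elim: i x => [|i IH] x s /=; first by rewrite mulrBr [in RHS]mulrCA.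
case: s => [|c s]; rewrite ?mulr0 //.
by rewrite (IH (fun r => x (c :: r))).
Qed.

Lemma cap_sum i r (f : nat -> seq bool -> R) s :
  cap i (fun s => \sum_(j <- r) f j s) s = \sum_(j <- r) cap i (f j) s.
Proof.
elim: i f s => [|i IH] f s /=; first by rewrite mulr_sumr sumrB.
case: s => [|c s]; first by rewrite big1.
by rewrite (IH (fun j t => f j (c :: t))).
Qed.

Fixpoint swap i s :=
  match i, s with
  | 0, [:: c, d & s'] => [:: d, c & s']
  | i'.+1, c :: s' => c :: swap i' s'
  | _, _ => s
  end.

Lemma cap_ext i x y s :
  (forall r, size r = (size s).+2 -> count id r = (count id s).+1 -> x r = y r) ->
  cap i x s = cap i y s.
Proof.
elim: i x y s => [|i IH] x y s xy /=; first by rewrite !xy.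
by case: s xy => [|c s] xy //; apply: IH => r hr hc; apply: xy; rewrite /= ?hr ?hc ?addnS.
Qed.

Lemma dual_ext b X x y :
  (forall s, size s = (b + size X)%N -> count id s = count id X -> x s = y s) ->
  dual b X x = dual b X y.
Proof.
elim: X b x y => [|[] X IH] b x y xy /=.
- by rewrite xy ?size_nseq ?addn0 //= count_nseq.
- case: b xy => [|b] xy; apply: IH => s hs hc; first by apply: xy; rewrite /= ?hs ?hc.
  by apply: cap_ext => r hr hc'; apply: xy; rewrite ?hr ?hs ?hc' ?hc /=; lia.
- by apply: IH => s hs hc; apply: xy; rewrite ?hs ?hc /=; lia.
Qed.

Lemma capB i x y s : cap i (fun s => x s - y s) s = cap i x s - cap i y s.
Proof.
elim: i x y s => [|i IH] x y s /=; first by rewrite mulrBr opprB !opprD !opprK; ring.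
by case: s => [|c s]; rewrite ?subr0 // (IH (fun r => x (c :: r)) (fun r => y (c :: r))).
Qed.

Lemma dualB b X x y : dual b X (fun s => x s - y s) = dual b X x - dual b X y.
Proof.
elim: X b x y => [|[] X IH] [|b] x y //=; rewrite -?IH //.
by apply: dual_ext => s _ _; rewrite capB.
Qed.

Lemma dualZ b X k x : dual b X (fun s => k * x s) = k * dual b X x.
Proof.
elim: X b x => [|[] X IH] [|b] x //=; rewrite -?IH //.
by apply: dual_ext => s _ _; rewrite capZ.
Qed.

Lemma dual_nseq b c X x : dual b (nseq c false ++ X) x = dual (c + b) X x.
Proof. by elim: c b => // c IH b; rewrite /= IH addnS. Qed.

Lemma dual_sorted X x : sorted (fun c d => d ==> c) X -> dual 0 X x = x X.
Proof.
elim: X x => [|[] X IH] x //= h.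
  rewrite IH //; case: X h {IH} => //= d X /andP[_ //].
suff -> : X = nseq (size X) false.
  by rewrite -[nseq _ _]cats0 dual_nseq cats0 addn1.
elim: X h {IH} => //= -[] X IH //= h.
by rewrite -IH.
Qed.

Lemma cap0 i x s : (forall r, x r = 0) -> cap i x s = 0.
Proof.
elim: i x s => [|i IH] x s x0 /=; first by rewrite !x0 mulr0 subr0.
by case: s => // c s; apply: IH.
Qed.

Lemma capN i x s : cap i (fun s => - x s) s = - cap i x s.
Proof.
by rewrite -mulN1r -[RHS](capZ i (-1) x s); congr (cap _ _ _); apply/funext => r; rewrite mulN1r.
Qed.

Lemma dualN b X x : dual b X (fun s => - x s) = - dual b X x.
Proof.
elim: X b x => [|[] X IH] [|b] x //=; rewrite -?IH //.
by apply: dual_ext => s _ _; rewrite capN.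
Qed.

Lemma dual_drop b X x : (forall s, x (true :: s) = 0) ->
  dual b.+1 X x = dual b X (fun s => x (false :: s)).
Proof.
elim: X b x => [|[] X IH] b x x0 //=; last by rewrite IH.
case: b => [|b] /=.
  by apply: dual_ext => s; rewrite x0 mulr0 subr0.
by rewrite IH // => s; apply: cap0 => r; rewrite x0.
Qed.

Lemma swapK i s : swap i (swap i s) = s.
Proof. by elim: i s => [|i IH] [|c [|d s]] //=; rewrite ?IH // -[d :: s]IH. Qed.

Fixpoint num s := if s is c :: s' then (c * 2 ^ size s' + num s')%N else 0%N.

Lemma num_lt s : (num s < 2 ^ size s)%N.
Proof. by elim: s => //= c s IH; rewrite expnS; case: c; lia. Qed.

Lemma num_cat s r : num (s ++ r) = (num s * 2 ^ size r + num r)%N.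
Proof. by elim: s => //= c s ->; rewrite size_cat expnD mulnDl mulnA addnA. Qed.

Lemma num_nseq b : num (nseq b false) = 0%N. Proof. by elim: b => //= b ->. Qed.

Lemma capE i x s : (i <= size s)%N -> cap i x s =
  x (take i s ++ [:: false, true & drop i s]) - v^-1 * x (take i s ++ [:: true, false & drop i s]).
Proof.
elim: i x s => [|i IH] x s; first by rewrite take0 drop0.
by case: s => //= c s hs; rewrite IH.
Qed.

Lemma dual_lead b X x :
  (forall s, size s = (b + size X)%N -> (num X < num s)%N -> x s = 0) ->
  dual b X x = x (nseq b false ++ X).
Proof.
elim: X b x => [|[] X IH] b x hx /=; first by rewrite cats0.
- case: b hx => [|b] hx.
    rewrite IH // => s hs hn; apply: hx => /=; rewrite hs add0n //; lia.
  have lX := num_lt X.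
  rewrite IH => [|s hs hn].
    rewrite capE ?size_cat ?size_nseq ?leq_addr // take_size_cat ?size_nseq //.
    rewrite drop_size_cat ?size_nseq // [X in _ - _ * X]hx ?mulr0 ?subr0.
    + by congr x; elim: (b) => //= k ->.
    + by rewrite size_cat size_nseq /=; lia.
    by rewrite num_cat num_nseq /= !expnS; lia.
  rewrite capE ?hs ?leq_addr // !hx ?mulr0 ?subr0 //.
  + by rewrite size_cat /= size_take_min size_drop hs; lia.
  + rewrite num_cat /= size_drop hs addKn !expnS; have := num_lt (drop b s).
    by rewrite size_drop hs addKn; lia.
  + by rewrite size_cat /= size_take_min size_drop hs; lia.
  rewrite -[s](cat_take_drop b) num_cat size_drop hs addKn in hn.
  rewrite num_cat /= size_drop hs addKn !expnS /=; nia.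
- rewrite IH => [|s hs hn]; last by apply: hx => //; rewrite hs /=; lia.
  by congr x; elim: (b) => //= k ->.
Qed.

Lemma dual_inj n (P : pred (seq bool)) x :
  (forall s, size s = n -> ~~ P s -> x s = 0) ->
  (forall s, size s = n -> P s -> dual 0 s x = 0) ->
  forall s, size s = n -> x s = 0.
Proof.
move=> hP hd.
have : forall c s, size s = n -> (2 ^ n <= num s + c)%N -> x s = 0.
  elim=> [|c IH] s hs hc; first by have := num_lt s; rewrite hs; lia.
  case: (boolP (P s)) => [Ps|]; last exact: hP.
  have := dual_lead (b := 0) (X := s) (x := x); rewrite hd // => -> // r hr lr.
  by apply: IH; rewrite ?hr //; lia.
by move=> h s hs; apply: (h (2 ^ n)%N) => //; lia.
Qed.

Lemma LS_nseq b S : LS (nseq b false) (nseq b false) 0 0 S = (all (leq 1) S)%:R.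
Proof. by elim: b S => //= b IH S; rewrite IH /= expr0 mul1r. Qed.

Lemma count0_nseq l : count id l = 0%N -> l = nseq (size l) false.
Proof. by elim: l => //= -[] l IH //= /IH <-. Qed.

Lemma dual0 b X x : (forall s, x s = 0) -> dual b X x = 0.
Proof.
move=> x0; rewrite -[RHS]oppr0; elim: X b x x0 => [|[] X IH] [|b] x x0 /=;
  rewrite ?x0 ?oppr0 // IH ?oppr0 // => s; exact: cap0.
Qed.

Lemma low_split b l : low_at b l ->
  [/\ (b.+1 < size l)%N & l = take b l ++ [:: false, true & drop b.+2 l]].
Proof.
move=> /andP[/eqP h1 /eqP h2].
have lt2 : (b.+1 < size l)%N by rewrite ltnNge; apply/negP => h; rewrite nth_default in h2.
split=> //; rewrite -{1}(cat_take_drop b l) (drop_nth true) ?(drop_nth false lt2) ?h1 ?h2 //.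
exact: ltnW.
Qed.

Hypothesis v_unit : v \is a GRing.unit.

Lemma cap_LS i X Y p m S : (i <= size Y)%N -> size X = (size Y).+2 ->
  head_le S (p.+1 - m) ->
  cap i (fun s => LS X s p m S) Y =
    if low_at i X then LS (del i X) Y p m S else 0.
Proof.
elim: i X Y p m S => [|i IH].
  move=> X Y p m S.
  move=> _; case: X => [|c1 [|c2 X]] //= _; case: S => [|b S] // hb.
  change (LS [:: c1, c2 & X] [:: false, true & Y] p m (b :: S) -
    v^-1 * LS [:: c1, c2 & X] [:: true, false & Y] p m (b :: S) =
    if (c1 == false) && (c2 == true) then LS (drop 0 X) Y p m (b :: S) else 0).
  rewrite drop0.
  have [b0|bp] := posnP b.
    by subst b; rewrite !(LS_eq0 _ _ _ _ [::] S) !mulr0 subr0 if_same.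
  have [e0 ep] : exists e0, p = (m + e0)%N by exists (p - m)%N; move: hb => /=; lia.
  have E1 : ((m + e0).+1 - m = e0.+1)%N by lia.
  have E2 : ((m + e0).+1 - m.+1 = e0)%N by lia.
  have E3 : ((m + e0).+2 - m.+1 = e0.+1)%N by lia.
  have E4 : ((m + e0).+2 - m = e0.+2)%N by lia.
  have E5 : ((m + e0).+3 - m.+1 = e0.+2)%N by lia.
  subst p; move: hb; case: c1; case: c2; rewrite /= ?addn0 ?addn1 ?(E1, E2, E3, E4, E5) => hb.
  - rewrite mulrA -exprS -mulrBr /=; case: S => [|b0 S].
      by rewrite -mulrBr (_ : minn b e0.+2 = minn b e0.+1) ?subrr ?mulr0 //; lia.
    rewrite -sumrB big_nat big1 ?mulr0 // => j hj; rewrite -mulrBr -mulrBr.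
    by rewrite (_ : minn j.+1 e0.+2 = minn j.+1 e0.+1) ?subrr ?mulr0 //; lia.
  - rewrite mulrA -exprS -mulrBr /=; case: S => [|b0 S].
      by rewrite -mulrBr (_ : minn b e0.+2 = minn b e0.+1) ?subrr ?mulr0 //; lia.
    rewrite -sumrB big_nat big1 ?mulr0 // => j hj; rewrite -mulrBr -mulrBr.
    by rewrite (_ : minn j.+1 e0.+2 = minn j.+1 e0.+1) ?subrr ?mulr0 //; lia.
  - rewrite big_nat_recr //=; set Sg := \sum_(0 <= j < e0) _.
    have -> : v^-1 * (v^-1 ^+ e0.-1 * (v^-1 ^+ e0 * Sg)) = v^-1 ^+ e0 * (v^-1 ^+ e0 * Sg).
      rewrite {}/Sg; case: (e0) => [|e] /=; first by rewrite big_geq // !mulr0.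
      by rewrite mulrA -exprS.
    rewrite !mulrDr addrAC subrr add0r minnn (_ : minn b _ = b); last by lia.
    rewrite LS_shift !mulrA -exprD addnn -mul2n -exprMn mulVr // expr1n mul1r //.
  - case: e0 {E1 E2 E3 E4 E5} hb => [|e0] hb /=.
      by rewrite !(LS_eq0 _ _ _ _ [::]) !mulr0 subr0.
    rewrite [v^-1 * (_ * (_ * _))]mulrA -exprS -mulrBr -mulrBr (@LS_min _ _ _ _ [::] _ _ e0.+2
      e0.+1); last by lia.
    by rewrite subrr !mulr0.
case=> [|c X] [|d Y] //= p m [|b S] //= hi [hX] hb.
change (low_at i.+1 (c :: X)) with (low_at i X); rewrite capZ.
change (take i X ++ drop i.+2 X) with (del i X); set e := ((p + c).+1 - (m + d))%N.
case: c @e => e; last by rewrite IH //=; case: ifP => _; rewrite ?mulr0.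
case: S => [|b0 S].
  by rewrite IH //= ?geq_minr //; case: ifP => _; rewrite ?mulr0.
rewrite cap_sum; case: ifP => hl.
  congr (_ * _); apply: eq_bigr => j _; rewrite capZ IH // ?hl //=; lia.
rewrite big1 ?mulr0 // => j _; rewrite capZ IH // ?hl ?mulr0 //=; lia.
Qed.

Lemma cup_capE i x s : cup i (cap i x) s =
  if (i.+1 < size s)%N && (nth true s i != nth true s i.+1) then
    if nth true s i then v^-1 * x s - x (swap i s) else v * x s - x (swap i s)
  else 0.
Proof.
elim: i x s => [|i IH] x s; last first.
  by case: s => [|c s] //=; rewrite (IH (fun r => x (c :: r))).
case: s => [|[] [|[] s]] //=.
  by rewrite opprB.
by rewrite mulrBr mulrA mulrV // mul1r.
Qed.

Lemma zigzag i y s : (i < size s)%N -> cap i (cup i.+1 y) s = - y s.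
Proof.
elim: i y s => [|i IH] y [|c s] //= hs; last by rewrite -(IH (fun r => y (c :: r))).
case: c => /=; last by rewrite mulr0 subr0 //.
by rewrite mulrA mulVr // mul1r sub0r.
Qed.

Lemma dual_raise b X : ~~ sorted (fun c d => d ==> c) (nseq b false ++ X) ->
  exists i, low_at i (nseq b false ++ X) /\
   forall x, dual b X x = - dual 0 (swap i (nseq b false ++ X)) (cup i (cap i x)).
Proof.
elim: X b => [|[] X IH] b.
- rewrite cats0 => /negP[]; case: b => // b.
  by elim: b => //= b; case: b.
- case: b => [|b]; last first.
    move=> _; exists b; split.
      by rewrite /low_at !nth_cat !size_nseq ltnSn ltnn subnn nth_nseq ltnSn.
    move=> x /=; rewrite (_ : swap b _ = nseq b false ++ [:: true, false & X]); last first.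
      by elim: (b) => //= k ->.
    rewrite dual_nseq addn0; case: b => [|b].
      by rewrite /= dual_drop // -dualN; apply: dual_ext => s _ _ /=; rewrite opprK.
    change (dual b.+1 X (cap b.+1 x) = - dual b.+1 X (cap b (cup b.+1 (cap b.+1 x)))).
    by rewrite -dualN; apply: dual_ext => s hs _; rewrite zigzag ?opprK // hs; lia.
  rewrite [nseq 0 _ ++ _]/= => h.
  have {h}/IH[i [li hi]] : ~~ sorted (fun c d => d ==> c) (nseq 0 false ++ X).
    apply: contra h; case: X {IH} => //= d X -> ; by rewrite implybT.
  exists i.+1; split=> // x; by rewrite /= hi.
rewrite (_ : nseq b false ++ _ = nseq b.+1 false ++ X); last first.
  by elim: b => //= b ->.
by move=> /IH[i [li hi]]; exists i; split.
Qed.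

Lemma dual_LS b X l : size l = (b + size X)%N -> count id l = count id X ->
  dual b X (fun s => LS l s 0 0 [:: 1%N]) = (l == nseq b false ++ X)%:R.
Proof.
elim: X b l => [|[] X IH] b l /= hs hc.
- rewrite addn0 in hs.
  by rewrite (count0_nseq hc) hs cats0 LS_nseq eqxx.
- case: b hs => [|b] hs.
    case: l hs hc => [|[] l] //= [hs] hc.
      rewrite -(IH 0%N) //; last by lia.
      by apply: dual_ext => s _ _; rewrite expr0 mul1r LS_shift.
    by rewrite dual0 // => s; rewrite (LS_eq0 _ _ _ _ [::]) mulr0.
  rewrite (@dual_ext _ _ _ (fun s => if low_at b l then LS (del b l) s 0 0 [:: 1%N] else 0)); last first.
    by move=> s hs' _; rewrite cap_LS ?hs' ?hs //=; lia.
  have E c : nseq c.+1 false ++ true :: X = nseq c false ++ [:: false, true & X].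
    by elim: c => //= c ->.
  case hl: (low_at b l); last first.
    rewrite dual0 //; case: eqP => // e; rewrite e E /low_at !nth_cat !size_nseq in hl.
    by rewrite ltnn ltnNge leqnSn subnn subSnn in hl.
  have [lt2 e] := low_split hl.
  have st : size (take b l) = b by rewrite size_takel //; lia.
  rewrite IH.
  + congr (nat_of_bool _)%:R; rewrite [in RHS]e E /del !eqseq_cat ?size_nseq ?st //.
  + by rewrite /del size_cat st size_drop hs; lia.
  by move: hc; rewrite /del {1}e !count_cat /=; lia.
- rewrite IH //; last by rewrite hs; lia.
  by congr (nat_of_bool (_ == _))%:R; elim: (b) => //= k ->.
Qed.
End Words.

(** * The bar involution and uniqueness of Kazhdan-Lusztig elements *)

Section HeckeCoef.
Local Open Scope ring_scope.
Variables (A : comNzRingType) (q : A) (n : nat).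
Notation H := (hecke q n).
Implicit Types (w x y : 'S_n.+1) (h a b c : H) (k : nat).

Lemma hecke_coefD a b x : coef (a + b) x = coef a x + coef b x.
Proof. by rewrite /coef !ffunE. Qed.

Lemma hecke_coefN a x : coef (- a) x = - coef a x.
Proof. by rewrite /coef !ffunE. Qed.

Lemma hecke_coefZ r a x : coef (r *: a) x = r * coef a x.
Proof. by rewrite /coef !ffunE. Qed.

Lemma hecke_coef0 x : coef (0 : H) x = 0.
Proof. by rewrite /coef !ffunE. Qed.

Lemma hecke_coef_sum I (r : seq I) (P : pred I) (F : I -> H) x :
  coef (\sum_(i <- r | P i) F i) x = \sum_(i <- r | P i) coef (F i) x.
Proof. exact: (big_morph (fun a => coef a x) (fun a b => hecke_coefD a b x) (hecke_coef0 x)). Qed.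

Lemma hecke_coefT w x : coef (Tb q w) x = (x == w)%:R.
Proof. by rewrite /coef ffunE. Qed.

Lemma hecke_coefP a b : (forall x, coef a x = coef b x) -> a = b.
Proof. by move=> ab; apply/ffunP. Qed.

Lemma TsE k h : (0 < k <= n)%N -> Tb q (gen n k) * h = Ls k h.
Proof.
move=> hk; rewrite [in LHS](heckeE h) mulr_sumr; apply: eq_bigr => w _.
by rewrite -scalerAr Ts_mul // -LsT LsT.
Qed.

Lemma redw_gen k : (0 < k <= n)%N -> exists2 j, (0 < j <= n)%N & redw (gen n k) = [:: j] /\ gen n
  j = gen n k.
Proof.
move=> hk; have lk : cox_length (gen n k) = 1%N.
  rewrite lengthE -[gen n k]mulg1 inv_gen // !perm1 inv1.
  by case/andP: (hk) => k0 kn; rewrite ifT // !val_inord; lia.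
have /and3P[+ + /eqP] := redwP (gen n k); rewrite lk.
case: (redw _) => [|j [|]] //= /andP[hj _] /eqP e _; exists j => //; split=> //.
by rewrite -e /word_prod big_seq1.
Qed.

Lemma RsE k h : (0 < k <= n)%N -> h * Tb q (gen n k) = Rs k h.
Proof.
move=> hk; rewrite [LHS]mulhE /mulhr extendT /Rw.
have [j hj [-> e]] := redw_gen hk.
by rewrite /= /Rs e.
Qed.

Lemma sum_delta (F : 'S_n.+1 -> A) x : \sum_w F w * (x == w)%:R = F x.
Proof.
rewrite (bigD1 x) //= eqxx mulr1 big1 ?addr0 // => w ne.
by rewrite eq_sym (negPf ne) mulr0.
Qed.

Lemma coef_Ts k h x : (0 < k <= n)%N -> coef (Tb q (gen n k) * h) x =
  if (cox_length x < cox_length (gen n k * x)%g)%N then q * coef h (gen n k * x)%g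
  else coef h (gen n k * x)%g + (q - 1) * coef h x.
Proof.
move=> hk; rewrite TsE // /Ls /extend hecke_coef_sum.
pose asc w := (cox_length w < cox_length (gen n k * w)%g)%N.
have gK w : (gen n k * (gen n k * w) = w)%g by rewrite mulgA genK mul1g.
under eq_bigr => w _.
  have -> : coef (coef h w *: (if asc w then Tb q (gen n k * w)%g
      else (q - 1) *: Tb q w + q *: Tb q (gen n k * w)%g)) x =
    (if asc w then 1 else q) * coef h w * ((gen n k * x)%g == w)%:R +
    (if asc w then 0 else q - 1) * coef h w * (x == w)%:R.
    rewrite hecke_coefZ -[(gen n k * x)%g == w](inj_eq (mulgI (gen n k))) gK.
    by case: ifP => _; rewrite ?hecke_coefD ?hecke_coefZ !hecke_coefT; ring.
  over.
have E : asc (gen n k * x)%g = ~~ asc x by apply: desc_left.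
rewrite big_split /= !sum_delta E -[(cox_length x < cox_length (gen n k * x)%g)%N]/(asc x).
by case: (asc x) => /=; ring.
Qed.

Lemma desc_right k x : (0 < k <= n)%N ->
  (cox_length (x * gen n k)%g < cox_length (x * gen n k * gen n k)%g)%N =
  ~~ (cox_length x < cox_length (x * gen n k)%g)%N.
Proof.
move=> hk; rewrite (asc_leftV k x) (asc_leftV k (x * gen n k)%g) invMg Defs.genV.
exact: desc_left.
Qed.

Lemma coef_Tr k h x : (0 < k <= n)%N -> coef (h * Tb q (gen n k)) x =
  if (cox_length x < cox_length (x * gen n k)%g)%N then q * coef h (x * gen n k)%g
  else coef h (x * gen n k)%g + (q - 1) * coef h x.
Proof.
move=> hk; rewrite RsE // /Rs /extend hecke_coef_sum.
pose asc w := (cox_length w < cox_length (w * gen n k)%g)%N.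
have gK w : (w * gen n k * gen n k = w)%g by rewrite -mulgA genK mulg1.
under eq_bigr => w _.
  have -> : coef (coef h w *: (if asc w then Tb q (w * gen n k)%g
      else (q - 1) *: Tb q w + q *: Tb q (w * gen n k)%g)) x =
    (if asc w then 1 else q) * coef h w * ((x * gen n k)%g == w)%:R +
    (if asc w then 0 else q - 1) * coef h w * (x == w)%:R.
    rewrite hecke_coefZ -[(x * gen n k)%g == w](inj_eq (mulIg (gen n k))) gK.
    by case: ifP => _; rewrite ?hecke_coefD ?hecke_coefZ !hecke_coefT; ring.
  over.
have E : asc (x * gen n k)%g = ~~ asc x by apply: desc_right.
rewrite big_split /= !sum_delta E -[(cox_length x < cox_length (x * gen n k)%g)%N]/(asc x).
by case: (asc x) => /=; ring.
Qed.

Lemma Tb_mulr k w : (0 < k <= n)%N -> (cox_length w < cox_length (w * gen n k)%g)%N ->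
  Tb q w * Tb q (gen n k) = Tb q (w * gen n k)%g.
Proof. by move=> hk lt; rewrite RsE // RsT lt. Qed.

End HeckeCoef.

Opaque mulh extend coef qhalf bar Tb Ls Rs.

Section Bar.
Local Open Scope ring_scope.
Variable n : nat.
Notation H := (heckeL n).
Notation q := (qhalf ^+ 2).
Implicit Types (w x y : 'S_n.+1) (h a b c : H) (k : nat).

Lemma q_unit : q \is a GRing.unit.
Proof. by rewrite unitrX // qhalf_unit. Qed.

Lemma bar_qhalfV : bar qhalf^-1 = qhalf.
Proof. by rewrite rmorphV ?qhalf_unit //= bar_qhalf invrK. Qed.

Lemma bar_q : bar q = q^-1.
Proof. by rewrite rmorphXn /= bar_qhalf exprVn. Qed.

Lemma barHD a b : barH (a + b) = barH a + barH b.
Proof.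
rewrite /barH -big_split; apply: eq_bigr => w _ /=.
by rewrite hecke_coefD rmorphD scalerDl.
Qed.

Lemma barHZ r a : barH (r *: a) = bar r *: barH a.
Proof.
rewrite /barH scaler_sumr; apply: eq_bigr => w _ /=.
by rewrite hecke_coefZ rmorphM scalerA.
Qed.

Lemma barH0 : barH (0 : H) = 0.
Proof. by have := barHZ 0 0; rewrite scale0r rmorph0 scale0r. Qed.

Lemma barHN a : barH (- a) = - barH a.
Proof. by rewrite -scaleN1r barHZ rmorphN1 scaleN1r. Qed.

Lemma barH_sum I (r : seq I) (P : pred I) (F : I -> H) :
  barH (\sum_(i <- r | P i) F i) = \sum_(i <- r | P i) barH (F i).
Proof. exact: (big_morph (@barH n) barHD barH0). Qed.

Lemma barHT w : barH (Tb q w) = (Tb q (w^-1)%g)^-1.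
Proof.
rewrite /barH (bigD1 w) //= hecke_coefT eqxx rmorph1 scale1r big1 ?addr0 // => y ne.
by rewrite hecke_coefT (negPf ne) rmorph0 scale0r.
Qed.

Lemma TsV k : (0 < k <= n)%N ->
  (Tb q (gen n k))^-1 = q^-1 *: Tb q (gen n k) + (q^-1 - 1)%:A :> H.
Proof.
move=> hk; apply: (mulrI (gen_unit hk)); rewrite divrr ?gen_unit //.
rewrite mulrDr -!scalerAr mulr1 Ts_mul // genK length1 ltn0.
rewrite scalerDr !scalerA mulVr ?q_unit // scale1r addrAC -scalerDl.
rewrite mulrBr mulVr ?q_unit // mulr1 addrA subrK subrr scale0r add0r.
by rewrite one_heckeE.
Qed.

Opaque barH.

Lemma bar_q1 : bar (q - 1) = q^-1 - 1.
Proof. by rewrite rmorphB rmorph1 [X in X - _]bar_q. Qed.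

Lemma affine_mul (r s : laurent) a b : (r *: a + s%:A) * b = s *: b + r *: (a * b).
Proof. by rewrite mulrDl -!scalerAl mul1r addrC. Qed.

Lemma barH_asc k w : (0 < k <= n)%N -> (cox_length w < cox_length (gen n k * w)%g)%N ->
  barH (Tb q (gen n k * w)%g) = (Tb q (gen n k))^-1 * barH (Tb q w).
Proof.
move=> hk lt; rewrite !barHT invMg Defs.genV -Tb_mulr // ?invrM ?gen_unit ?Tb_unit //.
by rewrite -lengthV -[X in (_ < X)%N]lengthV invMg Defs.genV !invgK.
Qed.

Lemma barH_Ts k h : (0 < k <= n)%N -> barH (Tb q (gen n k) * h) = (Tb q (gen n k))^-1 * barH h.
Proof.
move=> hk; rewrite [h]heckeE mulr_sumr !barH_sum mulr_sumr; apply: eq_bigr => w _.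
rewrite -scalerAr !barHZ -scalerAr; congr (_ *: _).
rewrite Ts_mul //; case: ifP => [|/negbT lt]; first exact: barH_asc.
have := @barH_asc k (gen n k * w)%g hk.
rewrite desc_left // lt mulgA genK mul1g => /(_ isT) e.
rewrite barHD !barHZ bar_q bar_q1.
have -> : barH (Tb q (gen n k * w)%g) = Tb q (gen n k) * barH (Tb q w).
  by rewrite e mulrA divrr ?gen_unit // mul1r.
by rewrite [RHS](congr1 (fun t => t * _) (TsV hk)); apply: esym; exact: affine_mul.
Qed.

Lemma barHM a b : barH (a * b) = barH a * barH b.
Proof.
have barHTM w c : barH (Tb q w * c) = barH (Tb q w) * barH c.
  have [u /and3P[hu /eqP <- /eqP]] := exists_reduced w; elim: u hu c => [|k u IH] /=.
    by rewrite /word_prod big_nil -one_heckeE => *; rewrite mul1r barHT invg1 -one_heckeE invr1 mul1r.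
  case/andP=> hk hu c; rewrite /word_prod big_cons -/(word_prod n u) => eu.
  have lek := length_word hu; have lek' := length_genl (word_prod n u) hk.
  have -> : (Tb q (gen n k * word_prod n u)%g = Tb q (gen n k) * Tb q (word_prod n u) :> H)%R.
    by rewrite Ts_mul // ifT //; lia.
  have eu' : size u = cox_length (word_prod n u) by lia.
  rewrite -(mulrA (Tb q (gen n k)) (Tb q (word_prod n u)) c).
  rewrite (@barH_Ts k (Tb q (word_prod n u) * c) hk) (@barH_Ts k (Tb q (word_prod n u)) hk).
  by rewrite (IH hu c eu') mulrA.
rewrite [a in LHS]heckeE mulr_suml !barH_sum mulr_suml; apply: eq_bigr => w _.
by rewrite -scalerAl !barHZ barHTM barHT scalerAl.
Qed.

Lemma coef_TsV k h x : (0 < k <= n)%N -> coef ((Tb q (gen n k))^-1 * h) x =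
  if (cox_length x < cox_length (gen n k * x)%g)%N
  then coef h (gen n k * x)%g + (q^-1 - 1) * coef h x
  else q^-1 * coef h (gen n k * x)%g.
Proof.
move=> hk; rewrite (TsV hk) affine_mul hecke_coefD !hecke_coefZ coef_Ts //.
have qV : q^-1 * q = 1 by rewrite mulVr // q_unit.
case: ifP => _; first by rewrite mulrA qV mul1r addrC.
rewrite mulrDr mulrA mulrBr mulr1 qV mulrBl mulrBl mul1r; ring.
Qed.

Lemma coef_barT w x : (cox_length w <= cox_length x)%N ->
  coef (barH (Tb q w)) x = (x == w)%:R * q^-1 ^+ cox_length w.
Proof.
have [u /and3P[hu /eqP <- /eqP]] := exists_reduced w; elim: u hu x => [|k u IH] /=.
  move=> _ x; rewrite /word_prod big_nil => _ _.
  by rewrite barHT invg1 -one_heckeE invr1 one_heckeE hecke_coefT length1 mulr1.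
case/andP=> hk hu x; rewrite /word_prod big_cons -/(word_prod n u) => eu.
set y := word_prod n u in IH eu *.
have lek := length_word hu; have lek' := length_genl y hk; rewrite -/y in lek.
rewrite barH_asc //; last by lia.
have ly : size u = cox_length y by lia.
rewrite -eu ly => lx; rewrite (coef_TsV _ _ hk).
have x_neq_y : x != y by apply/eqP => e; rewrite e ltnn in lx.
have -> : (x == (gen n k * y)%g) = ((gen n k * x)%g == y).
  by rewrite -(inj_eq (mulgI (gen n k))) mulgA genK mul1g.
have := inv_gen x hk; rewrite -!lengthE -(asc_left x hk) => e.
case: ifP e => lt e.
- have -> : ((gen n k * x)%g == y) = false by apply/eqP => e'; rewrite e' in e; lia.
  rewrite mul0r (IH hu x ly) ?(negPf x_neq_y) ?mul0r ?mulr0 ?addr0; last by lia.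
  rewrite (IH hu _ ly); last by lia.
  have -> : ((gen n k * x)%g == y) = false by apply/eqP => e'; rewrite e' in e; lia.
  by rewrite mul0r.
- by rewrite (IH hu _ ly) ?exprS 1?mulrCA //; lia.
Qed.

Lemma barH_top h x : (forall y, coef h y != 0 -> (cox_length y <= cox_length x)%N) ->
  coef (barH h) x = bar (coef h x) * q^-1 ^+ cox_length x.
Proof.
move=> hx; rewrite [in LHS](heckeE h) barH_sum hecke_coef_sum (bigD1 x) //= big1.
  by rewrite addr0 barHZ hecke_coefZ coef_barT // eqxx mul1r.
move=> y ne; rewrite barHZ hecke_coefZ; have [->|nz] := eqVneq (coef h y) 0.
  by rewrite rmorph0 mul0r.
by rewrite coef_barT ?hx // eq_sym (negPf ne) mul0r mulr0.
Qed.
End Bar.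

Section Evaluation.
Local Open Scope ring_scope.
Notation q := (qhalf ^+ 2).

Definition evalq (p : {poly int}) : laurent := (map_poly intr p).[q].

Lemma evalq_is_zmod_morphism : zmod_morphism evalq.
Proof. by move=> p r; rewrite /evalq rmorphB hornerD hornerN. Qed.
HB.instance Definition _ := GRing.isZmodMorphism.Build {poly int} laurent evalq
  evalq_is_zmod_morphism.

Lemma evalqXn m : evalq 'X^m = q ^+ m.
Proof. by rewrite /evalq map_polyXn hornerXn. Qed.

Lemma horner_map_intr (R : nzRingType) (p : {poly int}) (x : R) :
  (map_poly intr p).[x] = \sum_(i < size p) (p`_i)%:~R * x ^+ i.
Proof. by rewrite (horner_coef_wide _ (size_poly _ _)); apply: eq_bigr => i _;
  rewrite coef_map_id0 ?mulr0z. Qed.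

Lemma evalq_inj : injective evalq.
Proof.
apply: raddf_inj => p e; have {e}: evalq p = 0 by [].
rewrite /evalq horner_map_intr => /(congr1 laurent_val).
have -> : laurent_val (\sum_(i < size p) (p`_i)%:~R * q ^+ i) = tofrac (p \Po 'X^2).
  rewrite comp_polyE; under [in RHS]eq_bigr do rewrite -mul_polyC.
  rewrite rmorph_sum -[LHS]/(val _) rmorph_sum; apply: eq_bigr => i _.
  have -> : (p`_i)%:P = (p`_i)%:~R :> {poly int} by rewrite -[X in X%:P]intz rmorph_int.
  by rewrite !rmorphM !rmorph_int !rmorphXn /=.
move=> /eqP; rewrite tofrac_eq0 comp_poly_eq0 ?size_polyXn //; exact/eqP.
Qed.

Lemma bar_evalq p : bar (evalq p) = (map_poly intr p).[q^-1].
Proof.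
rewrite /evalq -horner_map [X in _.[X]]bar_q; congr (_.[_]).
by rewrite -map_poly_comp; apply: eq_map_poly => c /=; rewrite rmorph_int.
Qed.

End Evaluation.

Section Uniqueness.
Local Open Scope ring_scope.
Variable n : nat.
Notation q := (qhalf ^+ 2).
Implicit Types (w x y : 'S_n.+1).

Lemma evalq_flip_eq0 (p : {poly int}) m : p = 0 \/ (2 * (size p).-1 < m)%N ->
  q ^+ m * (map_poly intr p).[q^-1] = evalq p -> p = 0.
Proof.
case=> // hm; rewrite horner_map_intr mulr_sumr => e.
have {e} : evalq (\sum_(i < size p) p`_i *: 'X^(m - i)) = evalq p.
  rewrite -e raddf_sum; apply: eq_bigr => i _ /=.
  rewrite /evalq -mul_polyC rmorphM hornerM /= map_polyC hornerC /= map_polyXn hornerXn.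
  rewrite [RHS]mulrCA; congr (_ * _).
  have le_im : (i <= m)%N by have := ltn_ord i; lia.
  by rewrite -[in RHS](subnK le_im) exprD -mulrA -exprMn divrr ?q_unit // expr1n mulr1.
move=> /evalq_inj /(congr1 (fun r : {poly int} => r`_(size p).-1)).
rewrite coef_sum big1 => [|i _].
  by move/esym/eqP; rewrite -lead_coefE lead_coef_eq0 => /eqP.
rewrite coefZ coefXn; case: eqP => h; last by rewrite mulr0.
by have := ltn_ord i; lia.
Qed.

Lemma coef_kl_sum w (Q : 'S_n.+1 -> {poly int}) (C : heckeL n) x :
  C = qhalf ^- cox_length w *: \sum_(y | bruhat_le y w) (map_poly intr (Q y)).[q] *: Tb _ y ->
  coef C x = qhalf ^- cox_length w * (if bruhat_le x w then evalq (Q x) else 0).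
Proof.
move=> ->.
rewrite hecke_coefZ hecke_coef_sum; congr (_ * _).
under eq_bigr do rewrite hecke_coefZ hecke_coefT.
case: ifP => hx; last first.
  rewrite big1 // => y hy; case: eqP => [e|_]; rewrite ?mulr0 //.
  by rewrite -e hx in hy.
rewrite (bigD1 x) //= eqxx mulr1 big1 ?addr0 // => y /andP[_ ne].
by rewrite eq_sym (negPf ne) mulr0.
Qed.

Lemma is_KL_uniq w C C' : is_KL w C -> is_KL w C' -> C = C'.
Proof.
move=> [P [Pw Pd CE Cb]] [P' [Pw' Pd' CE' Cb']].
pose p x : {poly int} := if bruhat_le x w then P x - P' x else 0.
have coefE x : coef (C - C') x = qhalf ^- cox_length w * evalq (p x).
  rewrite (hecke_coefD C) (hecke_coefN C') (coef_kl_sum x CE) (coef_kl_sum x CE') -mulrBr; congr (_ * _).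
  rewrite /p; case: ifP => _; last by rewrite subr0 raddf0.
  by rewrite raddfB.
have pd x : p x = 0 \/ (2 * (size (p x)).-1 + cox_length x < cox_length w)%N.
  rewrite /p; case: ifP => hx; last by left.
  have [->|ne] := eqVneq x w; first by left; rewrite Pw Pw' subrr.
  have hs : (size (P x - P' x)%R <= maxn (size (P x)) (size (P' x)))%N.
    by rewrite -(size_polyN (P' x)); apply: size_polyD.
  right; move: (Pd x hx ne) (Pd' x hx ne) hs.
  move: (size (P x - P' x)%R) (size (P x)) (size (P' x)) => a b c; lia.
apply/eqP; rewrite -subr_eq0; apply/eqP/hecke_coefP => x0; rewrite hecke_coef0.
apply/eqP/negP => /negP nz0.
case: (@arg_maxnP _ x0 (fun x => coef (C - C') x != 0) (fun x => cox_length x) nz0) => x nz xmax.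
have := @barH_top n (C - C') x xmax; rewrite barHD barHN Cb Cb' coefE.
rewrite rmorphM /= bar_evalq rmorphV ?unitrX ?qhalf_unit // rmorphXn /= bar_qhalf.
rewrite exprVn invrK => e; move: nz; rewrite coefE => /negP[].
suff -> : p x = 0 by rewrite raddf0 mulr0.
case: (pd x) => // lt; apply: (@evalq_flip_eq0 _ (cox_length w - cox_length x)); first by right;
  rewrite ltn_subRL addnC.
have le_xw : (cox_length x <= cox_length w)%N by lia.
have E1 : qhalf ^+ cox_length w * qhalf ^+ cox_length w =
    q ^+ (cox_length w - cox_length x) * q ^+ cox_length x.
  by rewrite -!exprD subnK // addnn -mul2n exprM.
have E2 : q ^+ cox_length x * q^-1 ^+ cox_length x = 1.
  by rewrite -exprMn divrr ?q_unit // expr1n.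
have /= := congr1 (fun r => qhalf ^+ cox_length w * r) e.
rewrite [LHS]mulrA divrr ?unitrX ?qhalf_unit // mul1r => ->.
by rewrite !mulrA E1 -!mulrA [q ^+ cox_length x * _]mulrCA E2 mulr1.
Qed.

Lemma KL_eq w C : is_KL w C -> KL w = C.
Proof. by move=> h; apply: classical_sets.xget_unique => // C' h'; apply: is_KL_uniq h' h. Qed.
End Uniqueness.

(** * Words of permutations and the Bruhat order *)

Section PermWords.
Variables (n z : nat).
Implicit Types (w x y : 'S_n.+1) (i j k : nat).

Definition letter w i : bool := z <= w (inord i).
Definition perm_word w : seq bool := mkseq (letter w) n.+1.
Definition height w k := \sum_(0 <= i < k) letter w i.

Lemma size_perm_word w : size (perm_word w) = n.+1. Proof. exact: size_mkseq. Qed.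

Lemma nth_perm_word b w i : i <= n -> nth b (perm_word w) i = letter w i.
Proof. by move=> hi; rewrite nth_mkseq. Qed.

Lemma heightS w k : height w k.+1 = height w k + letter w k.
Proof. by rewrite /height big_nat_recr. Qed.

Lemma height0 w : height w 0 = 0. Proof. by rewrite /height big_geq. Qed.

Lemma height_take w k : k <= n.+1 -> count id (take k (perm_word w)) = height w k.
Proof.
elim: k => [|k IH] hk; first by rewrite take0 height0.
by rewrite (take_nth true) ?size_perm_word // -cats1 count_cat IH ?(ltnW hk) //= addn0 heightS
  nth_perm_word.
Qed.

Lemma gen_inord k i : 0 < k <= n -> i <= n ->
  gen n k (inord i) = inord (if i == k.-1 then k else if i == k then k.-1 else i).
Proof.
move=> hk hi; apply: val_inj; rewrite /= genE // !val_inord //;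
  by do ![case: eqP => ?]; lia.
Qed.

Lemma letter_genl w k i : 0 < k <= n -> i <= n ->
  letter (gen n k * w)%g i = letter w (if i == k.-1 then k else if i == k then k.-1 else i).
Proof. by move=> hk hi; rewrite /letter permM gen_inord. Qed.

Lemma letter_genr w k i : 0 < k <= n -> k != z -> letter (w * gen n k)%g i = letter w i.
Proof.
move=> hk kz; rewrite /letter permM genE //.
by do ![case: eqP => ?]; lia.
Qed.

Lemma perm_word_genr w k : 0 < k <= n -> k != z -> perm_word (w * gen n k)%g = perm_word w.
Proof. by move=> hk kz; apply: eq_map => i; apply: letter_genr. Qed.

Lemma height_genl w k m : 0 < k <= n -> m <= n.+1 ->
  height (gen n k * w)%g m + (m == k) * letter w k.-1 = height w m + (m == k) * letter w k.
Proof.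
move=> hk; elim: m => [|m IH] hm; first by rewrite !height0; case: eqP => //; lia.
have {}IH := IH (ltnW hm).
rewrite !heightS letter_genl //; move: IH.
have [e1|n1] := eqVneq m k.-1.
  have -> : (m == k) = false by lia.
  have -> : (m.+1 == k) = true by lia.
  rewrite e1 !mul0n; lia.
have -> : (m.+1 == k) = false by lia.
by have [e2|n2] := eqVneq m k; [rewrite e2 | ]; lia.
Qed.

Lemma nth_swap i X j : i.+1 < size X ->
  nth true (swap i X) j = nth true X (if j == i then i.+1 else if j == i.+1 then i else j).
Proof.
elim: i X j => [|i IH] X j.
  by case: X => [|c [|d X]] //; case: j => [|[|j]].
case: X => [|c X] // hX; case: j => [|j] //.
by rewrite [LHS]/= IH // !eqSS; case: (j == i) => //; case: (j == i.+1).
Qed.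

Lemma size_swap i X : size (swap i X) = size X.
Proof. by elim: i X => [|i IH] [|c [|d X]] //=; rewrite ?IH. Qed.

Lemma perm_word_genl w k : 0 < k <= n -> perm_word (gen n k * w)%g = swap k.-1 (perm_word w).
Proof.
move=> hk; apply: (@eq_from_nth _ true); first by rewrite size_swap !size_perm_word.
move=> i; rewrite size_perm_word => hi; rewrite nth_swap ?size_perm_word; last by lia.
rewrite !nth_perm_word //; last by do ![case: eqP => ?]; lia.
rewrite letter_genl // prednK //; lia.
Qed.

Lemma low_letter w k : 0 < k <= n ->
  low_at k.-1 (perm_word w) = ~~ letter w k.-1 && letter w k.
Proof.
move=> hk; rewrite /low_at prednK; last by lia.
by rewrite !nth_perm_word //; [case: letter; case: letter | lia | lia].
Qed.

Lemma asc_right w k : 0 < k <= n ->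
  right_ascent w k = ((w^-1)%g (inord k.-1) < (w^-1)%g (inord k)).
Proof. by move=> hk; rewrite /right_ascent asc_leftV asc_left. Qed.

Lemma ltn_lettersP w i j : ~~ letter w i -> letter w j -> w (inord i) < w (inord j).
Proof. by rewrite /letter; lia. Qed.

(* The words are constant on left cosets of W_J; block_monotone true (resp. *)
(* false) characterizes the shortest (resp. longest) elements of the cosets. *)
Definition block_monotone b w := forall k, 0 < k <= n -> k != z -> right_ascent w k = b.

Definition block_decreasing := block_monotone false.

Lemma inv_neq w k : 0 < k <= n -> (w^-1)%g (inord k.-1) != (w^-1)%g (inord k) :> nat.
Proof.
move=> hk; rewrite (inj_eq val_inj) (inj_eq perm_inj) -val_eqE /= !val_inord; lia.
Qed.

Lemma letter_perm_word x y i : perm_word x = perm_word y -> i <= n -> letter x i = letter y i.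
Proof. by move=> e hi; rewrite -!(nth_perm_word true) // e. Qed.

Lemma inv_bound w : Defs.inv w <= #|{: 'I_n.+1 * 'I_n.+1}|.
Proof. exact: max_card. Qed.

Lemma bruhat_step_tperm y (i j : 'I_n.+1) : i != j -> cox_length y < cox_length (y * tperm i j)%g ->
  bruhat_le y (y * tperm i j)%g.
Proof.
move=> ne lt; apply: connect1; rewrite /bruhat_step lt /=.
by apply/existsP; exists i; apply/existsP; exists j; rewrite ne eqxx.
Qed.

Lemma inord_neq k : 0 < k <= n -> (inord k.-1 : 'I_n.+1) != inord k.
Proof. by move=> hk; rewrite -val_eqE /= !val_inord; lia. Qed.

Lemma bruhat_genr y k : 0 < k <= n -> right_ascent y k -> bruhat_le y (y * gen n k)%g.
Proof. by move=> hk lt; apply: bruhat_step_tperm => //; exact: inord_neq. Qed.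

Lemma bruhat_genl y k : 0 < k <= n -> cox_length y < cox_length (gen n k * y)%g ->
  bruhat_le y (gen n k * y)%g.
Proof.
move=> hk.
have -> : (gen n k * y = y * tperm (y (inord k.-1)) (y (inord k)))%g.
  by rewrite /gen -[tperm (y _) _]tpermJ /conjg !mulgA mulgV mul1g.
by apply: bruhat_step_tperm; rewrite (inj_eq perm_inj) inord_neq.
Qed.

Lemma height_total w : height w n.+1 = \sum_(i < n.+1) (z <= i).
Proof.
rewrite /height big_mkord [RHS](reindex_inj (@perm_inj _ w)) /=.
by apply: eq_bigr => i _; rewrite /letter inord_val.
Qed.

Lemma low_exists X Y : size X = size Y -> count id X = count id Y -> X != Y ->
  (forall k, count id (take k X) <= count id (take k Y)) ->
  exists2 i, low_at i X & count id (take i.+1 X) < count id (take i.+1 Y).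
Proof.
elim: X Y => [|c X IH] [|d Y] //= [hs] hc ne dom.
have := dom 1; rewrite /= !take0 /= !addn0 => h1.
case: c d ne hc dom h1 => [] [] // ne hc dom _; last first.
- move: ne; rewrite eqseq_cons /= => ne.
  have [] := IH Y hs hc ne; first by move=> k; have := dom k.+1.
  by move=> i li lt; exists i.+1.
- have hX : has id X by rewrite has_count; lia.
  exists (find id X).
    have e1 : nth false X (find id X) = true := nth_find false hX.
    rewrite /low_at /= e1.
    rewrite andbT; case e: (find id X) => [|m] //=.
    by rewrite -[nth _ _ _]/(id _) before_find // e.
  rewrite /= add0n (_ : count id (take _ X) = 0) //.
  apply/eqP; rewrite eqn0Ngt -has_count -all_predC; apply/(all_nthP true) => i.
  rewrite size_take_min => hi; rewrite nth_take /=; last by lia.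
  by have /= -> := @before_find _ true id X i; lia.
- move: ne; rewrite eqseq_cons /= => ne.
  have [] := IH Y hs _ ne; [lia | by move=> k; have := dom k.+1 => /=; lia|].
  by move=> i li lt; exists i.+1 => //=; lia.
Qed.

Lemma block_monotoneP b w : block_monotone b w <->
  forall i j, i < j <= n -> letter w i = letter w j -> (w (inord i) < w (inord j)) = b.
Proof.
split=> [h|h k hk kz]; last first.
  have ne := inv_neq w hk; rewrite asc_right //; move: ne.
  set i : 'I_n.+1 := (w^-1)%g (inord k.-1); set j : 'I_n.+1 := (w^-1)%g (inord k).
  have li : letter w i = (z <= k.-1) by rewrite /letter inord_val /i permKV val_inord //; lia.
  have lj : letter w j = (z <= k) by rewrite /letter inord_val /j permKV val_inord //; lia.
  have wi : w (inord i) = k.-1 :> nat by rewrite inord_val /i permKV val_inord //; lia.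
  have wj : w (inord j) = k :> nat by rewrite inord_val /j permKV val_inord //; lia.
  have := ltn_ord i; have := ltn_ord j; have := h i j; have := h j i; rewrite li lj wi wj.
  by case: b {h} => *; lia.
have mono m l : m <= n -> l < m -> (z <= l) = (z <= m) ->
    ((w^-1)%g (inord l) < (w^-1)%g (inord m)) = b.
  elim: m => // m IH hm ltlm e.
  have ne := inv_neq w (k := m.+1) hm; rewrite /= in ne.
  have hz : m.+1 != z by lia.
  have h1 := h m.+1 hm hz; rewrite asc_right //= in h1.
  have [e'|ne'] := eqVneq l m; first by subst l.
  have hm' : m <= n by lia.
  have hl : l < m by lia.
  have e2 : (z <= l) = (z <= m) by lia.
  by have := IH hm' hl e2; move: h1 ne; case: b {h IH} => *; lia.
move=> i j hij e.
have ne : w (inord i) != w (inord j) :> nat.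
  by rewrite (inj_eq val_inj) (inj_eq perm_inj) -val_eqE /= !val_inord; lia.
have := mono (w (inord j)) (w (inord i)); have := mono (w (inord i)) (w (inord j)).
rewrite !inord_val !permK !val_inord; try lia.
have := ltn_ord (w (inord i)); have := ltn_ord (w (inord j)); move: e; rewrite /letter.
case: b {h mono} => e *; lia.
Qed.

Lemma block_decreasingP w : block_decreasing w <->
  forall i j, i < j <= n -> letter w i = letter w j -> w (inord j) < w (inord i).
Proof.
rewrite /block_decreasing block_monotoneP.
have ne i j : i < j <= n -> w (inord i) != w (inord j) :> nat.
  by move=> hij; rewrite (inj_eq val_inj) (inj_eq perm_inj) -val_eqE /= !val_inord; lia.
by split=> h i j hij /(h i j hij); have := ne i j hij; lia.
Qed.

Lemma block_monotone_genl b w k : 0 < k <= n -> letter w k.-1 != letter w k ->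
  block_monotone b w -> block_monotone b (gen n k * w)%g.
Proof.
move=> hk ne /block_monotoneP h; apply/block_monotoneP => i j hij.
have hi : i <= n by lia.
have hj : j <= n by lia.
rewrite !letter_genl // => e; rewrite !permM !gen_inord //; apply: h => //.
have bad : ~~ ((i == k.-1) && (j == k)).
  apply/negP => /andP[/eqP ei /eqP ej]; move: e; rewrite ei ej !eqxx (_ : (k == k.-1) = false); last lia.
  by move=> e; rewrite e eqxx in ne.
by move: bad; do ![case: eqP => ?]; lia.
Qed.

Definition block_decreasing_genl := @block_monotone_genl false.

Lemma block_decreasing_asc w k : 0 < k <= n -> block_decreasing w ->
  (w (inord k.-1) < w (inord k)) = ~~ letter w k.-1 && letter w k.
Proof.
move=> hk /block_decreasingP h; have := h k.-1 k.
case l1: (letter w k.-1); case l2: (letter w k) => //=.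
- by move=> /(_ _ erefl); lia.
- by move=> _; apply/negbTE; rewrite -leqNgt; move: l1 l2; rewrite /letter; lia.
- by move=> _; move: l1 l2; rewrite /letter; lia.
- by move=> /(_ _ erefl); lia.
Qed.

Hypothesis z_range : 0 < z <= n.

Lemma block_decreasing_inj x y : block_decreasing x -> block_decreasing y ->
  perm_word x = perm_word y -> x = y.
Proof.
move=> hx hy e; suff : (y^-1 * x = 1)%g by move/eqP; rewrite -eq_mulVg1 => /eqP ->.
apply: Defs.inv0 => k hk; rewrite !permM.
set i := (y^-1)%g _; set j := (y^-1)%g (inord k).
have hi : i <= n by rewrite -ltnS ltn_ord.
have hj : j <= n by rewrite -ltnS ltn_ord.
have li : letter x i = (z <= k.-1).
  by rewrite (letter_perm_word e) // /letter inord_val /i permKV val_inord //; lia.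
have lj : letter x j = (z <= k).
  by rewrite (letter_perm_word e) // /letter inord_val /j permKV val_inord //; lia.
have [kz|kz] := eqVneq k z.
  by have := @ltn_lettersP x i j; rewrite li lj !inord_val; apply; lia.
have := hy k hk kz; rewrite asc_right // => /negbT h.
have ne := inv_neq y hk.
have := (block_decreasingP x).1 hx j i; rewrite li lj !inord_val; apply; last by lia.
by move: ne h; rewrite -/i -/j; lia.
Qed.

Lemma bruhat_of_height x y : block_decreasing x ->
  (forall k, k <= n.+1 -> height y k <= height x k) -> bruhat_le y x.
Proof.
move=> hx.
move: {2}(#|{: 'I_n.+1 * 'I_n.+1}| - Defs.inv y).+1 (ltnSn (#|{: 'I_n.+1 * 'I_n.+1}| - Defs.inv y)) => m.
elim: m y => // m IH y hm dom.
have up k (y' := (gen n k * y)%g) : Defs.inv y < Defs.inv y' -> #|{: 'I_n.+1 * 'I_n.+1}| -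
  Defs.inv y' < m.
  by have := inv_bound y'; lia.
have [e|ne] := eqVneq (perm_word y) (perm_word x); last first.
  have hs : size (perm_word y) = size (perm_word x) by rewrite !size_perm_word.
  have full u : count id (perm_word u) = height u n.+1.
    by rewrite -height_take // take_oversize // size_perm_word.
  have hc : count id (perm_word y) = count id (perm_word x) by rewrite !full !height_total.
  have domw k : count id (take k (perm_word y)) <= count id (take k (perm_word x)).
    case: (leqP k n.+1) => hk; first by rewrite !height_take //; apply: dom.
    by rewrite !take_oversize ?size_perm_word ?hc //; lia.
  have [i hl] := low_exists hs hc ne domw.
  have [hi _] := low_split hl; rewrite size_perm_word in hi.
  have hk : 0 < i.+1 <= n by lia.
  rewrite !height_take; try lia; move=> lt.
  have := low_letter y hk; rewrite hl => /esym/andP[l1 l2].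
  have asc : cox_length y < cox_length (gen n i.+1 * y)%g.
    by rewrite asc_left //; apply: ltn_lettersP.
  apply: connect_trans (bruhat_genl hk asc) _.
  apply: IH => [|k hk']; first by apply: up; rewrite -!lengthE.
  have := height_genl y hk hk'; rewrite l2 (negPf l1).
  by have := dom k hk'; case: eqP => [->|_]; lia.
have [hy|] := pselect (block_decreasing y).
  by rewrite (block_decreasing_inj hy hx e); apply: connect0.
move=> /existsNP[k /not_implyP[hk /not_implyP[kz /eqP]]]; rewrite eqbF_neg negbK => asc.
apply: connect_trans (bruhat_genr hk asc) _.
apply: IH => [|j hj].
  by have := inv_bound (y * gen n k)%g; move: asc; rewrite /right_ascent !lengthE; lia.
by rewrite -height_take // perm_word_genr // height_take // dom.
Qed.
End PermWords.

Section Bruhat.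
Variables (n z : nat).
Implicit Types (w x y : 'S_n.+1) (i j k : nat).

(* With s the transposition of p and q, send an inversion (i, j) of s * y to *)
(* (s i, s j) when s i < s j, and to itself otherwise. *)
Lemma inv_tperm_lt y (p q : 'I_n.+1) : p < q -> y q < y p ->
  Defs.inv (tperm p q * y)%g <= Defs.inv y.
Proof.
move=> pq ypq; set s := tperm p q.
pose f (r : 'I_n.+1 * 'I_n.+1) := if s r.1 < s r.2 then (s r.1, s r.2) else r.
have sK (i : 'I_n.+1) : s (s i) = i by rewrite /s tpermK.
have f_inj : {in inversions (s * y)%g &, injective f}.
  move=> [i j] [i' j']; rewrite !inE /= => /andP[l1 _] /andP[l2 _]; rewrite /f /=.
  case: ifP => h1; case: ifP => h2 e; case: (e) => e1 e2.
  - by rewrite -[i]sK -[j]sK e1 e2 !sK.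
  - by move: h2; rewrite -e1 -e2 !sK l1.
  - by move: h1; rewrite e1 e2 !sK l2.
  - by rewrite e1 e2.
rewrite /Defs.inv -(card_in_imset f_inj); apply: subset_leq_card.
apply/subsetP => _ /imsetP[[i j] + ->]; rewrite !inE /f /= !permM => /andP[lij].
case: ifP => hs /=; first by rewrite hs.
rewrite lij /= => lt; move: hs lt lij.
rewrite /s; case: (tpermP p q i) => [->|->|ip iq]; case: (tpermP p q j) => [->|->|jp jq]; lia.
Qed.

Lemma height_tperm y (p q : 'I_n.+1) k : p < q -> y p < y q -> k <= n.+1 ->
  height z y k <= height z (tperm p q * y)%g k.
Proof.
move=> pq ypq hk.
rewrite /height !big_mkord.
pose P (i : 'I_n.+1) := i < k.
have E x : \sum_(i < k) (letter z x i : nat) = \sum_(i < n.+1 | i < k) (z <= x i).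
  rewrite (big_ord_widen n.+1 (fun i => letter z x i : nat)) //.
  by apply: eq_bigr => i _; rewrite /letter inord_val.
rewrite !E; have [qk|kq] := ltnP q k.
  rewrite [leqLHS](reindex_inj (@perm_inj _ (tperm p q))) /=.
  rewrite (eq_bigl (fun i : 'I_n.+1 => i < k)).
    by apply: leq_sum => i _; rewrite permM.
  by move=> i /=; case: tpermP => [->|->|//]; lia.
apply: leq_sum => i; rewrite permM; case: tpermP => [->|->|//] hi; last by lia.
by move: ypq; case: (leqP z (y p)); case: (leqP z (y q)); lia.
Qed.

Lemma height_bruhat x y k : k <= n.+1 -> bruhat_le y x -> height z y k <= height z x k.
Proof.
move=> hk /connectP[p + ->]; elim: p y => //= x' p IH y /andP[/andP[lt /existsP[i /existsP[j]]]].
move=> /andP[ne /eqP e] hp; apply: leq_trans (IH _ hp).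
wlog lij : i j ne e / (y^-1 i < y^-1 j)%g.
  move=> h; case: (ltngtP (y^-1 i)%g (y^-1 j)%g) => [l|l|/val_inj/perm_inj ij].
  - exact: h l.
  - by apply: (h j i) => //; rewrite ?[_ == i]eq_sym // tpermC.
  - by rewrite ij eqxx in ne.
set a := (y^-1 i)%g in lij; set b := (y^-1 j)%g in lij.
have {}e : x' = (tperm a b * y)%g.
  have -> : tperm a b = (tperm i j ^ y^-1)%g by rewrite tpermJ.
  by rewrite e /conjg invgK !mulgA -[RHS]mulgA mulVg mulg1.
rewrite e; apply: height_tperm => //.
rewrite ltnNge leq_eqVlt; apply/negP => /orP[/eqP/val_inj/perm_inj ab|lt'].
  by rewrite ab ltnn in lij.
by have := inv_tperm_lt lij lt'; rewrite -e; move: lt; rewrite !lengthE; lia.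
Qed.

Definition longest : 'S_n.+1 := perm (@rev_ord_inj n.+1).

Lemma longest_asc w : w != longest -> exists2 k, 0 < k <= n & cox_length w < cox_length (gen n k * w)%g.
Proof.
move=> ne; have [//|h] := pselect (exists2 k, 0 < k <= n & cox_length w < cox_length (gen n k * w)%g).
case/eqP: ne; suff e : (w * longest = 1)%g.
  have lK : (longest * longest = 1)%g.
    by apply/permP => i; rewrite permM !permE /= rev_ordK.
  by rewrite -[w]mulg1 -lK mulgA e mul1g.
apply: Defs.inv0 => k hk; rewrite !permM !permE /=.
have : ~~ (cox_length w < cox_length (gen n k * w)%g) by apply/negP => lt; apply: h; exists k.
rewrite asc_left //.
have ne : w (inord k.-1) != w (inord k) :> nat.
  by rewrite (inj_eq val_inj) (inj_eq perm_inj) -val_eqE /= !val_inord; lia.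
by move: ne (ltn_ord (w (inord k.-1))) (ltn_ord (w (inord k))); lia.
Qed.

Lemma genl_ind (P : 'S_n.+1 -> Prop) :
  P longest ->
  (forall x k, 0 < k <= n -> cox_length x < cox_length (gen n k * x)%g -> P (gen n k * x)%g -> P x) ->
  forall x, P x.
Proof.
move=> P0 PS x.
move: {2}(#|{: 'I_n.+1 * 'I_n.+1}| - Defs.inv x).+1 (ltnSn (#|{: 'I_n.+1 * 'I_n.+1}| - Defs.inv x)) => m.
elim: m x => // m IH x hm.
have [->//|ne] := eqVneq x longest.
have [k hk lt] := longest_asc ne; apply: (PS x k) => //; apply: IH.
by have := inv_bound (gen n k * x)%g; move: lt; rewrite !lengthE; lia.
Qed.

Lemma longest_max w : cox_length w <= cox_length longest.
Proof. by elim/genl_ind: w => // x k hk lt; lia. Qed.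

Definition area w := \sum_(0 <= k < n.+1) height z w k.

Lemma area_genl w k : 0 < k <= n ->
  area (gen n k * w)%g + letter z w k.-1 = area w + letter z w k.
Proof.
move=> hk; rewrite /area !big_mkord.
have lk : k < n.+1 by lia.
rewrite (bigD1 (Ordinal lk)) // [in RHS](bigD1 (Ordinal lk)) //=.
have := height_genl z w hk (ltnW lk); rewrite eqxx !mul1n.
rewrite (eq_bigr (fun i : 'I_n.+1 => height z w i)) => [|i ne]; first by lia.
have := height_genl z w hk (ltnW (ltn_ord i)).
rewrite -val_eqE /= in ne; rewrite (negPf ne); lia.
Qed.

Hypothesis z_range : 0 < z <= n.

(* Every permutation reaches, by right ascents s_k with k != z, the longest *)
(* element of its coset. *)
Lemma coset_ind (P : 'S_n.+1 -> Prop) :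
  (forall x, block_decreasing z x -> P x) ->
  (forall x k, 0 < k <= n -> k != z -> right_ascent x k -> P (x * gen n k)%g -> P x) ->
  forall x, P x.
Proof.
move=> P0 PS x.
move: {2}(#|{: 'I_n.+1 * 'I_n.+1}| - Defs.inv x).+1 (ltnSn (#|{: 'I_n.+1 * 'I_n.+1}| - Defs.inv x)) => m.
elim: m x => // m IH x hm.
have [hx|] := pselect (block_decreasing z x); first exact: P0.
move=> /existsNP[k /not_implyP[hk /not_implyP[kz /eqP]]]; rewrite eqbF_neg negbK => asc.
apply: (PS _ k) => //; apply: IH.
by have := inv_bound (x * gen n k)%g; move: asc; rewrite /right_ascent !lengthE; lia.
Qed.

Lemma coset_eq (T : Type) (f : 'S_n.+1 -> T) :
  (forall x k, 0 < k <= n -> k != z -> f (x * gen n k)%g = f x) ->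
  forall x y, perm_word z x = perm_word z y -> f x = f y.
Proof.
move=> fJ; elim/coset_ind => [x hx|x k hk kz asc IH] y e; last first.
  by rewrite -(fJ x k hk kz); apply: IH; rewrite perm_word_genr.
elim/coset_ind: y e => [y hy|y k hk kz asc IH] e.
  by move/(block_decreasing_inj z_range hx hy): e => ->.
by rewrite -(fJ y k hk kz); apply: IH; rewrite perm_word_genr.
Qed.

Lemma length_area w : block_decreasing z w ->
  cox_length w + area longest = cox_length longest + area w.
Proof.
elim/genl_ind: w => // x k hk lt IH hx.
have := lt; rewrite (asc_left x hk) (block_decreasing_asc hk hx) => /andP[l1 l2].
have := area_genl x hk; rewrite (negPf l1) l2.
have hx' : block_decreasing z (gen n k * x)%g.
  by apply: block_decreasing_genl => //; rewrite l2 (negPf l1).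
have := IH hx'; have : cox_length (gen n k * x)%g = (cox_length x).+1.
  by rewrite !lengthE Defs.inv_gen // -asc_left // lt.
by lia.
Qed.
End Bruhat.

(** * Bar invariance of the candidates *)

Section Scalars.
Local Open Scope ring_scope.

Lemma scale_bar (K : comNzRingType) (L : lmodType K) (r ri p : K) (b c : L) : r * p = ri ->
  ri *: b - r *: ((p - 1) *: b + p *: c) = r *: b - ri *: c.
Proof.
by move=> e; rewrite scalerDr !scalerA mulrBr e mulr1 opprD addrA -scalerBl opprB addrC addrCA
  subrr addr0 addrC.
Qed.

Lemma high_scale (K : comUnitRingType) (r a b : K) m : r \is a GRing.unit ->
  r ^+ m.+1 * (r^-1 * (a - b)) = r^-1 * (r ^+ m.+1 * a) - r ^+ m * b.
Proof. by move=> ur; rewrite exprSr -!mulrA mulVKr // [r^-1 * (_ * _)]mulrCA mulKr // mulrBr. Qed.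

Lemma low_scale (K : comUnitRingType) (r a b : K) m :
  r ^+ m * (r * (a - b)) = r * (r ^+ m * a) - r ^+ m.+1 * b.
Proof. by rewrite exprSr; ring. Qed.

Lemma kappa_scale (K : comUnitRingType) (a b r s : K) m : b ^+ m * a ^+ m = 1 ->
  a ^+ m * r * s = a ^+ (2 * m) * s * (b ^+ m * r).
Proof.
move=> e; have -> : a ^+ (2 * m) * s * (b ^+ m * r) = b ^+ m * a ^+ m * (a ^+ m * r * s).
  by rewrite mul2n -addnn exprD; ring.
by rewrite e mul1r.
Qed.

Lemma const_bar (K : comUnitRingType) (a b : K) l m l0 m0 : (forall k, b ^+ k * a ^+ k = 1) ->
  a \is a GRing.unit -> (l + m0 = l0 + m)%N ->
  a ^+ (2 * m0) * b ^+ (2 * l0) * (a ^+ l * b ^+ m) = b ^+ l * a ^+ m.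
Proof.
move=> ba ua e; apply: (mulrI (unitrX (2 * l0 + m + l) ua)).
transitivity (a ^+ (2 * m0 + l + l) * (b ^+ (2 * l0) * a ^+ (2 * l0)) * (b ^+ m * a ^+ m)).
  by rewrite !exprD; ring.
transitivity (a ^+ (2 * l0 + m + m) * (b ^+ l * a ^+ l)); last by rewrite !exprD; ring.
by rewrite !ba !mulr1; congr (_ ^+ _); lia.
Qed.
End Scalars.

Section Transfer.
Local Open Scope ring_scope.
Variables (n z : nat).
Hypothesis z_range : (0 < z <= n)%N.
Notation H := (heckeL n).
Notation v := qhalf.
Notation q := (qhalf ^+ 2).
Implicit Types (w x y : 'S_n.+1) (h : H) (k : nat).

Definition coset_invariant h := forall y k, (0 < k <= n)%N -> k != z ->
  coef h (y * gen n k)%g = coef h y.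

Lemma coset_invariantP h : coset_invariant h <->
  forall k, (0 < k <= n)%N -> k != z -> h * Tb q (gen n k) = q *: h.
Proof.
split=> [hJ k hk kz|hT y k hk kz].
  apply: hecke_coefP => y; rewrite coef_Tr // hecke_coefZ hJ //.
  by case: ifP => // _; ring.
have asc x : (cox_length x < cox_length (x * gen n k)%g)%N -> coef h (x * gen n k)%g = coef h x.
  move=> lt; have := congr1 (fun g => coef g x) (hT k hk kz) => /=.
  by rewrite coef_Tr // lt hecke_coefZ => /(mulrI q_unit).
have [|ge] := ltnP (cox_length y) (cox_length (y * gen n k)%g); first exact: asc.
have lt : (cox_length (y * gen n k)%g < cox_length (y * gen n k * gen n k)%g)%N.
  by rewrite (desc_right _ hk) -leqNgt.
by rewrite -(asc _ lt) -mulgA genK mulg1.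
Qed.

Lemma coset_invariant_eq h x y : coset_invariant h -> perm_word z x = perm_word z y ->
  coef h x = coef h y.
Proof. by move=> hJ; apply: (coset_eq z_range). Qed.

Definition wordfun h (s : seq bool) : laurent :=
  if [pick y | perm_word z y == s] is Some y then v ^+ area z y * coef h y else 0.

Lemma area_word x y : perm_word z x = perm_word z y -> area z x = area z y.
Proof.
move=> e; apply: eq_big_nat => k hk; apply: eq_big_nat => i hi.
by rewrite (letter_perm_word e) //; lia.
Qed.

Lemma wordfunE h y : coset_invariant h -> wordfun h (perm_word z y) = v ^+ area z y * coef h y.
Proof.
move=> hJ; rewrite /wordfun; case: pickP => [y' /eqP e|/(_ y)]; last by rewrite eqxx.
by rewrite (area_word e) (coset_invariant_eq hJ e).
Qed.

Definition Umul k h : H := v *: h - v^-1 *: (Tb q (gen n k) * h).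

Lemma coset_invariantU k h : (0 < k <= n)%N -> coset_invariant h -> coset_invariant (Umul k h).
Proof.
move=> hk /coset_invariantP hJ; apply/coset_invariantP => j hj jz.
rewrite /Umul mulrBl -!scalerAl -mulrA hJ // -scalerAr scalerBr !scalerA.
by rewrite ![q * _]mulrC.
Qed.

Lemma bar_Umul k h : (0 < k <= n)%N -> barH (Umul k h) = Umul k (barH h).
Proof.
move=> hk; rewrite /Umul barHD barHN (barHZ v) (barHZ v^-1) bar_qhalf bar_qhalfV (barH_Ts h hk).
have vq : v * q^-1 = v^-1 by rewrite -exprVn expr2 mulVKr ?qhalf_unit.
by rewrite (TsV hk) affine_mul; apply: scale_bar.
Qed.

Lemma coset_invariant_bar h : coset_invariant h -> coset_invariant (barH h).
Proof.
move=> /coset_invariantP hJ; apply/coset_invariantP => j hj jz.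
have := congr1 (@barH n) (hJ j hj jz); rewrite barHM barHZ bar_q => e.
have : barH h * barH (Tb q (gen n j)) * Tb q (gen n j) = q^-1 *: (barH h * Tb q (gen n j)).
  by rewrite e scalerAl.
rewrite barHT Defs.genV -(mulrA (barH h)) (mulVr (gen_unit hj)) mulr1 => {2}->.
by rewrite (scalerA q q^-1) (mulrV q_unit) scale1r.
Qed.

Lemma coef_Umul k h y : (0 < k <= n)%N -> coset_invariant h ->
  coef (Umul k h) y =
    if letter z y k.-1 == letter z y k then 0
    else if letter z y k then v * (coef h y - coef h (gen n k * y)%g)
    else v^-1 * (coef h y - coef h (gen n k * y)%g).
Proof.
move=> hk hJ; rewrite hecke_coefD hecke_coefN !hecke_coefZ coef_Ts //.
have vq r : v^-1 * (q * r) = v * r by rewrite expr2 -mulrA mulKr ?qhalf_unit.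
have vq1 r s : v^-1 * (r + (q - 1) * s) = v^-1 * r - v^-1 * s + v * s.
  by rewrite mulrBl mul1r !mulrDr vq mulrN; ring.
case: eqP => e.
  have -> : coef h (gen n k * y)%g = coef h y.
    apply: coset_invariant_eq => //; rewrite perm_word_genl //.
    apply: (@eq_from_nth _ true); rewrite size_swap // => i.
    rewrite size_perm_word => hi; rewrite nth_swap ?size_perm_word; last lia.
    rewrite prednK; last lia.
    case: eqP => [->|_]; first by rewrite !nth_perm_word ?e //; lia.
    by case: eqP => [->|_] //; rewrite !nth_perm_word ?e //; lia.
  by case: ifP => _; rewrite ?vq ?vq1 ?subrr //; ring.
rewrite asc_left //; case l2: (letter z y k) e; case l1: (letter z y k.-1) => // _.
  rewrite (@ltn_lettersP n z y k.-1 k) ?l1 ?l2 // vq; ring.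
rewrite ifF ?vq1; last first.
  by apply/negbTE; rewrite -leqNgt ltnW // (@ltn_lettersP n z y k k.-1) ?l1 ?l2.
ring.
Qed.

Lemma wordfun_U k h s : (0 < k <= n)%N -> coset_invariant h ->
  wordfun (Umul k h) s = cup v k.-1 (cap v k.-1 (wordfun h)) s.
Proof.
move=> hk hJ; rewrite cup_capE ?qhalf_unit //.
have [[y ys]|no] := pselect (exists y, perm_word z y = s); last first.
  have w0 h' s' : (forall y, perm_word z y <> s') -> wordfun h' s' = 0.
    by move=> hs; rewrite /wordfun; case: pickP => // y /eqP /hs.
  have no' y : perm_word z y <> s by move=> e; apply: no; exists y.
  rewrite !w0 //; last first.
    move=> y e; apply: (no' (gen n k * y)%g); rewrite perm_word_genl // e.
    by rewrite swapK.
  by rewrite !mulr0 subrr !if_same.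
subst s; rewrite size_perm_word prednK; last lia.
have -> : (k < n.+1)%N by lia.
rewrite -perm_word_genl // !wordfunE //; last exact: coset_invariantU.
rewrite coef_Umul // !nth_perm_word; try lia.
have := area_genl z y hk.
case: (letter z y k.-1); case: (letter z y k) => /=; rewrite ?mulr0 // => e.
  have -> : area z y = (area z (gen n k * y)%g).+1 by lia.
  by rewrite high_scale ?qhalf_unit.
have -> : area z (gen n k * y)%g = (area z y).+1 by lia.
by rewrite low_scale.
Qed.

Lemma coset_top x : exists2 y : 'S_n.+1, block_decreasing z y & perm_word z y = perm_word z x.
Proof.
elim/(coset_ind z_range): x => [x hx|x k hk kz _ [y hy e]]; first by exists x.
by exists y; rewrite // e perm_word_genr.
Qed.

Lemma sorted_low i (s : seq bool) : sorted (fun c d => d ==> c) s -> ~~ low_at i s.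
Proof.
elim: i s => [|i IH] [|c s] //= hs.
  by case: c s hs => [] [|[] s].
by apply: IH; case: s hs => //= d s /andP[].
Qed.

Lemma sorted_longest y : sorted (fun c d => d ==> c) (perm_word z y) ->
  perm_word z y = perm_word z (longest n).
Proof.
have [x hx <-] := coset_top y => hs.
have [-> //|/longest_asc[k hk]] := eqVneq x (longest n).
rewrite asc_left // (@block_decreasing_asc n z) // -low_letter // => hl.
by have := sorted_low k.-1 hs; rewrite hl.
Qed.

Definition kappa : laurent := v ^+ (2 * area z (longest n)) * q^-1 ^+ cox_length (longest n).

(* Both sides agree at the longest element, and an ascent of y is resolved by *)
(* dual_raise, since v - v^-1 T_s commutes with the bar involution. *)
Lemma dual_bar y h : coset_invariant h ->
  dual v 0 (perm_word z y) (wordfun (barH h)) = kappa * bar (dual v 0 (perm_word z y) (wordfun h)).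
Proof.
move: {2}(cox_length (longest n) - cox_length y).+1 (ltnSn (cox_length (longest n) - cox_length y)) => m.
elim: m y h => // m IH y h hm hJ.
have hJb := coset_invariant_bar hJ.
case: (boolP (sorted (fun c d => d ==> c) (perm_word z y))) => hs.
  rewrite !dual_sorted // sorted_longest // !wordfunE //.
  rewrite barH_top => [|x _]; last exact: longest_max.
  rewrite /kappa rmorphM rmorphXn /= bar_qhalf; move: (area _ _) (bar _) (q^-1 ^+ _) => A r s.
  by rewrite mulrA; apply: kappa_scale; apply: qhalfVK.
have [i [hl hd]] : exists i, low_at i (perm_word z y) /\ forall f, dual v 0 (perm_word z y) f =
    - dual v 0 (swap i (perm_word z y)) (cup v i (cap v i f)) := dual_raise qhalf_unit (b := 0) hs.
have [hi _] := low_split hl; rewrite size_perm_word in hi.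
have hk : (0 < i.+1 <= n)%N by lia.
have hl' : low_at i.+1.-1 (perm_word z y) by [].
rewrite low_letter // in hl'; case/andP: hl' => l1 l2.
have lt : (cox_length y < cox_length (gen n i.+1 * y)%g)%N.
  by rewrite asc_left //; apply: ltn_lettersP l1 l2.
have E g : coset_invariant g -> dual v 0 (perm_word z y) (wordfun g) =
    - dual v 0 (perm_word z (gen n i.+1 * y)%g) (wordfun (Umul i.+1 g)).
  move=> hg; rewrite hd perm_word_genl //; congr (- _); apply: dual_ext => // s _ _.
  by rewrite wordfun_U.
rewrite (E _ hJb) (E _ hJ) -bar_Umul // IH; last exact: coset_invariantU.
  by rewrite rmorphN mulrN.
by have := longest_max (gen n i.+1 * y)%g; lia.
Qed.

Lemma count_perm_word x y : count id (perm_word z x) = count id (perm_word z y).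
Proof.
have full (u : 'S_n.+1) : count id (perm_word z u) = height z u n.+1 by rewrite -(height_take z u
  (leqnn n.+1)) take_oversize // size_perm_word.
by rewrite !full !height_total.
Qed.

Lemma perm_word_surj s : size s = n.+1 -> count id s = count id (perm_word z (1%g : 'S_n.+1)) ->
  exists y : 'S_n.+1, perm_word z y = s.
Proof.
move=> hs hc; pose t := tcast (size_perm_word z (1%g : 'S_n.+1)) (in_tuple (perm_word z (1%g :
  'S_n.+1))).
have et : tval t = perm_word z (1%g : 'S_n.+1) by rewrite val_tcast.
have /tuple_permP[p ep] : perm_eq s t.
  rewrite et; have cnt u : count_mem true u = count id u by apply: eq_count; case.
  have cnf u : count_mem false u = (size u - count id u)%N.
    by rewrite -(count_predC id) addKn; apply: eq_count; case.
  by apply/allP => b _; apply/eqP; case: b; [rewrite !cnt | rewrite !cnf hs hc size_perm_word].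
exists p; rewrite ep; apply: (@eq_from_nth _ true);
  first by rewrite size_perm_word size_map size_enum_ord.
move=> i; rewrite size_perm_word => hi; rewrite nth_perm_word //.
rewrite (nth_map (Ordinal hi)) ?size_enum_ord // (tnth_nth true) et nth_perm_word.
  by rewrite /letter perm1 inord_val (_ : nth _ _ _ = inord i) //; apply: val_inj;
    rewrite /= nth_enum_ord // val_inord.
by rewrite -ltnS ltn_ord.
Qed.

Variable w : 'S_n.+1.
Hypothesis w_top : block_decreasing z w.

Definition kl_const : laurent := v^-1 ^+ cox_length w * v ^+ area z w.

Definition LSw (s : seq bool) : laurent := LS v (perm_word z w) s 0 0 [:: 1%N].

Definition kl_elt : H :=
  \sum_y (v^-1 ^+ area z y * (kl_const * LSw (perm_word z y))) *: Tb q y.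

Lemma coef_kl_elt y : coef kl_elt y = v^-1 ^+ area z y * (kl_const * LSw (perm_word z y)).
Proof.
by rewrite hecke_coef_sum; under eq_bigr do rewrite hecke_coefZ hecke_coefT; exact: sum_delta.
Qed.

Lemma coset_invariant_kl_elt : coset_invariant kl_elt.
Proof.
by move=> y k hk kz; rewrite !coef_kl_elt perm_word_genr // (area_word (perm_word_genr y hk kz)).
Qed.

Lemma wordfun_kl_elt y : wordfun kl_elt (perm_word z y) = kl_const * LSw (perm_word z y).
Proof.
rewrite wordfunE ?coef_kl_elt; last exact: coset_invariant_kl_elt.
by rewrite mulrA [v ^+ _ * _]mulrC qhalfVK mul1r.
Qed.

Lemma dual_kl_elt y : dual v 0 (perm_word z y) (wordfun kl_elt) =
  kl_const * (perm_word z w == perm_word z y)%:R.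
Proof.
rewrite -(@dual_LS _ v qhalf_unit 0) ?size_perm_word //; last exact: count_perm_word.
rewrite -dualZ; apply: dual_ext; rewrite ?size_perm_word => s hs hc.
have [x <-] := perm_word_surj hs (etrans hc (count_perm_word _ _)).
exact: wordfun_kl_elt.
Qed.

Lemma bar_kl_const : kappa * bar kl_const = kl_const.
Proof.
rewrite /kl_const rmorphM !rmorphXn /= bar_qhalfV bar_qhalf /kappa.
have := length_area z_range w_top.
move: (cox_length w) (area z w) (cox_length _) (area _ _) => l A l0 A0 e.
rewrite -[q^-1]exprVn -exprM; exact: (const_bar qhalfVK qhalf_unit).
Qed.

Theorem bar_kl_elt : barH kl_elt = kl_elt.
Proof.
have hJ := coset_invariant_kl_elt; have hJb := coset_invariant_bar hJ.
have E s : size s = n.+1 -> wordfun (barH kl_elt) s - wordfun kl_elt s = 0.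
  move=> hs; move: s hs.
  apply: (@dual_inj _ v _ (fun s => `[< exists y : 'S_n.+1, perm_word z y = s >])).
    move=> s _ /asboolPn no; rewrite /wordfun; case: pickP => [y /eqP e|_]; last by rewrite subr0.
    by case: no; exists y.
  move=> _ _ /asboolP[y <-]; rewrite dualB dual_bar // dual_kl_elt.
  by rewrite rmorphM rmorph_nat mulrA bar_kl_const subrr.
apply: hecke_coefP => y; have /eqP := E _ (size_perm_word z y).
rewrite subr_eq0 !wordfunE // => /eqP.
by apply: mulrI; rewrite unitrX // qhalf_unit.
Qed.

End Transfer.

(** * Labelings *)

(* The label lists counted by LS: entry l is the label of the pair closed at *)
(* site l, and 0 if no pair is. *)
Fixpoint labs (X Y : seq bool) (p m : nat) (S : seq nat) : seq (seq nat) :=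
  match X, Y with
  | [::], [::] => if all (fun b => 0 < b) S then [:: [::]] else [::]
  | c :: X', d :: Y' =>
      let p' := p + c in let m' := m + d in let e := p'.+1 - m' in
      if c then
        match S with
        | [:: b1, b0 & S'] =>
            flatten [seq map (cons j) (labs X' Y' p' m' (minn b0 (minn j.+1 e) :: S')) | j <- iota 0 b1]
        | [:: b] => map (cons 0) (labs X' Y' p' m' [:: minn b e])
        | [::] => [::]
        end
      else map (cons 0) (labs X' Y' p' m' (e :: S))
  | _, _ => [::]
  end.

Fixpoint okl (X Y : seq bool) (p m : nat) (S : seq nat) (T : seq nat) : bool :=
  match X, Y, T with
  | [::], [::], [::] => all (fun b => 0 < b) S
  | c :: X', d :: Y', j :: T' =>
      let p' := p + c in let m' := m + d in let e := p'.+1 - m' in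
      if c then
        match S with
        | [:: b1, b0 & S'] => (j < b1) && okl X' Y' p' m' (minn b0 (minn j.+1 e) :: S') T'
        | [:: b] => (j == 0) && okl X' Y' p' m' [:: minn b e] T'
        | [::] => false
        end
      else (j == 0) && okl X' Y' p' m' (e :: S) T'
  | _, _, _ => false
  end.

Fixpoint dsum (X Y : seq bool) (p m : nat) : nat :=
  match X, Y with
  | c :: X', d :: Y' => ((p + c).+1 - (m + d)).-1 + dsum X' Y' (p + c) (m + d)
  | _, _ => 0
  end.

Lemma mem_map_cons (T : seq nat) j (L : seq (seq nat)) :
  (T \in map (cons j) L) = if T is i :: T' then (i == j) && (T' \in L) else false.
Proof.
case: T => [|i T]; first by apply/mapP => -[].
apply/mapP/andP => [[T' h [-> ->]]|[/eqP-> h]]; first by [].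
by exists T.
Qed.

Lemma mem_labs X Y p m S T : (T \in labs X Y p m S) = okl X Y p m S T.
Proof.
elim: X Y p m S T => [|c X IH] [|d Y] p m S T //=.
- by case: ifP; case: T => // *; rewrite ?inE.
- case: c; last by rewrite mem_map_cons; case: T => // j T; rewrite IH.
  case: S => [|b1 [|b0 S]]; [by case: T | by rewrite mem_map_cons; case: T => // j T; rewrite IH |].
  case: T => [|j T]; first by apply/flatten_mapP => -[j _]; rewrite mem_map_cons.
  apply/flatten_mapP/andP => [[i]|[hj hT]].
    by rewrite mem_iota mem_map_cons IH => hi /andP[/eqP -> ->].
  by exists j; rewrite ?mem_iota // mem_map_cons eqxx IH.
Qed.

Lemma labs_uniq X Y p m S : uniq (labs X Y p m S).
Proof.
elim: X Y p m S => [|c X IH] [|d Y] p m S //=; first by case: ifP.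
have inj j : injective (cons j : seq nat -> seq nat) by move=> ? ? [].
case: c; last by rewrite map_inj_uniq.
case: S => [|b1 [|b0 S]] //; first by rewrite map_inj_uniq.
have := iota_uniq 0 b1; elim: (iota 0 b1) => //= j r IHr /andP[jr ur].
rewrite cat_uniq map_inj_uniq // IH IHr // andbT.
apply/hasPn => T /flatten_mapP[i ir]; rewrite !mem_map_cons; case: T => // k T /andP[/eqP -> _].
by apply/negP => /andP[/eqP e _]; rewrite -e ir in jr.
Qed.

Lemma okl_size (X Y : seq bool) (p m : nat) (S T : seq nat) : okl X Y p m S T -> size T = size X.
Proof.
elim: X Y p m S T => [|c X IH] [|d Y] p m S [|j T] //=.
case: c; last by move=> /andP[_ /IH ->].
by case: S => [|b1 [|b0 S]] // /andP[_ /IH ->].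
Qed.

Section LabelSum.
Variables (R : comUnitRingType) (v : R).
Local Open Scope ring_scope.

Lemma LS_labs X Y p m S :
  LS v X Y p m S = v^-1 ^+ dsum X Y p m * \sum_(T <- labs X Y p m S) v ^+ (2 * sumn T).
Proof.
elim: X Y p m S => [|c X IH] [|d Y] p m S //=; rewrite ?big_nil ?mulr0 //.
  by rewrite expr0 mul1r; case: ifP => _; rewrite ?big_seq1 ?big_nil.
rewrite exprD -mulrA; congr (_ * _).
case: c; last by rewrite IH big_map.
case: S => [|b1 [|b0 S]]; rewrite ?big_nil ?mulr0 ?IH ?big_map //.
rewrite big_flatten big_map mulr_sumr /index_iota subn0; apply: eq_bigr => j _.
rewrite IH big_map mulrCA mulr_sumr; congr (_ * _); apply: eq_bigr => T _.
by rewrite /= mulnDr exprD.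
Qed.
End LabelSum.

Section Walk.
Variables (N : nat) (X Y : seq bool) (T : seq nat).
Hypotheses (sX : size X = N) (sY : size Y = N).
Notation gX s := (count id (take s X)).
Notation gY s := (count id (take s Y)).
Notation lt s := (nth 0 T s).
Implicit Types (k l s c j b : nat) (K S : seq nat).

(* The height of the walk with an up-step for each opening letter, shifted to *)
(* stay nonnegative. *)
Definition walk s := s + 2 * (count id X - gX s).

Definition gap s := (gX s).+1 - gY s.

Definition matches k l := [/\ k < l, l < N, walk l.+1 = walk k & forall c, k < c <= l -> walk k <
  walk c].

Lemma count_take s : s < N -> gX s.+1 = gX s + nth false X s.
Proof. by move=> hs; rewrite (take_nth false) ?sX // -cats1 count_cat /= addn0. Qed.

Lemma count_takeY s : s < N -> gY s.+1 = gY s + nth false Y s.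
Proof. by move=> hs; rewrite (take_nth false) ?sY // -cats1 count_cat /= addn0. Qed.

Lemma count_take_le s : gX s <= count id X.
Proof. by rewrite -{2}(cat_take_drop s X) count_cat leq_addr. Qed.

Lemma walkS s : s < N -> if nth false X s then walk s = (walk s.+1).+1 else walk s.+1 = (walk s).+1.
Proof.
move=> hs; have := count_take hs; have := count_take_le s.+1; rewrite /walk.
by case: ifP => _; lia.
Qed.

Fixpoint stack_wf K s : Prop :=
  if K is k :: K' then
    [/\ k < s, walk s = (walk k).+1, forall c, k < c <= s -> walk k < walk c & stack_wf K' k]
  else forall c, c <= s -> walk s <= walk c.

Definition level_bound k s j := (forall c, k < c <= s -> j < gap c) /\
  (forall k' l, matches k' l -> k < k' -> l < s -> j <= lt l).

(* K lists the positions of the opening letters that are still open. *)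
Fixpoint bounds_wf K S s : Prop :=
  match K, S with
  | k :: K', b :: S' => (forall j, j < b <-> level_bound k s j) /\ bounds_wf K' S' k
  | [::], [:: b] => 0 < b <-> (forall c, c <= s -> 0 < gap c)
  | _, _ => False
  end.

Definition label_ok l := (forall k, matches k l -> level_bound k l (lt l)) /\
  ((forall k, ~ matches k l) -> lt l = 0).

Lemma matches_inj (k k' l : nat) : matches k l -> matches k' l -> k = k'.
Proof.
clear sX sY => -[kl _ e h] [kl' _ e' h'].
case: (ltngtP k k') => // lt.
  by have := h k'; lia.
by have := h' k; lia.
Qed.

Lemma okl_walk s K S : s <= N -> size T = N -> stack_wf K s -> bounds_wf K S s ->
  okl (drop s X) (drop s Y) (gX s) (gY s) S (drop s T) <->
  (forall l, s <= l < N -> label_ok l) /\ (forall c, c <= N -> 0 < gap c).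
Proof.
move=> hs sT; move: {2}(N - s) (erefl (N - s)) => m; elim: m s K S hs => [|m IH] s K S hs hm hK hS.
  have es : s = N by lia.
  rewrite !drop_oversize ?sX ?sY ?sT ?es //=.
  have : all (fun b => 0 < b) S <-> (forall c, c <= N -> 0 < gap c).
    rewrite -[X in _ <-> (forall c, c <= X -> _)]es;
      elim: K S (s) hK hS {hs hm es} => [|k K IHK] [|b S] s' //=.
      case: S => // hK hb; rewrite /= andbT; exact: hb.
    move=> [ks _ _ hK] [hb hS]; split=> [/andP[/hb[h _] h2] c hc|h].
      case: (leqP c k) => hck; last by apply: h; lia.
      by apply: (IHK S k hK hS).1.
    apply/andP; split; first by apply/hb; split=> // c hc; apply: h; lia.
    by apply/(IHK S k hK hS) => c hc; apply: h; lia.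
  move=> h; split=> [/h h2|[_ /h]] //.
  by split=> // l; lia.
have {hm} [lsN hm] : s < N /\ N - s.+1 = m by lia.
rewrite (drop_nth false) ?sX // [drop s Y](drop_nth false) ?sY // (drop_nth 0) ?sT //=.
rewrite -count_take // -count_takeY // -/(gap s.+1).
have step : (forall l, s <= l < N -> label_ok l) <-> label_ok s /\ (forall l, s.+1 <= l < N ->
  label_ok l).
  split=> [h|[h1 h2] l hl]; first by split; [apply: h; lia | move=> l hl; apply: h; lia].
  by have [e|ne] := eqVneq l s; [rewrite e | apply: h2; lia].
have IHs := IH s.+1 _ _ lsN hm; have := walkS lsN.
case ls: (nth false X s) => ws; last first.
  have nomatch k : ~ matches k s by move=> [hk _ e h]; have := h s; lia.
  have {}IHs := IHs (s :: K) (gap s.+1 :: S).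
  have hK' : stack_wf (s :: K) s.+1.
    split=> //.
    by move=> c hc; have -> : c = s.+1 by [lia]; rewrite ws.
  have hS' : bounds_wf (s :: K) (gap s.+1 :: S) s.+1.
    split=> // j; split=> [hj|[h _]]; last by apply: h; lia.
    split=> [c hc|k' l [h1 h2 _ _] h3 h4]; last by lia.
    by have -> : c = s.+1 by lia.
  rewrite step; split=> [/andP[/eqP T0 /(IHs hK' hS')[h1 h2]]|[[[_ h0] h1] h2]].
    by split=> //; split=> //; split=> // k /nomatch.
  by rewrite h0 //=; apply/(IHs hK' hS').
case: K S hK hS => [|k K] [|b1 S] //=.
  case: S => //= hK hb.
  have nomatch k : ~ matches k s by move=> [hk _ e h]; have := hK k; lia.
  have {}IHs := IHs [::] [:: minn b1 (gap s.+1)].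
  have hK' : stack_wf [::] s.+1.
    by move=> c hc; have [->//|ne] := eqVneq c s.+1; have := hK c; lia.
  have hS' : bounds_wf [::] [:: minn b1 (gap s.+1)] s.+1.
    rewrite /= leq_min; split=> [/andP[/hb h1 h2] c hc|h].
      by have [->//|ne] := eqVneq c s.+1; apply: h1; lia.
    by apply/andP; split; [apply/hb => c hc|]; apply: h; lia.
  rewrite step; split=> [/andP[/eqP T0 /(IHs hK' hS')[h1 h2]]|[[[_ h0] h1] h2]].
    by split=> //; split=> //; split=> // k /nomatch.
  by rewrite h0 //=; apply/(IHs hK' hS').
move=> [ks wk hk hK] [hb1 hS].
have mks : matches k s by split=> //; lia.
have okE : label_ok s <-> lt s < b1.
  split=> [[h _]|/hb1 h]; first by apply/hb1/h.
  by split=> [k' /matches_inj -/(_ _ mks) ->|/(_ k)].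
case: S hS => [|b0 S] hS; first by case: K hK hS.
have hK' : stack_wf K s.+1.
  have wks : walk s.+1 = walk k by lia.
  case: K hK {hS IHs} => [|k0 K] /=.
    move=> h c hc; case: (leqP c k) => hck; first by have := h c; lia.
    have [->//|ne] := eqVneq c s.+1; have := hk c; lia.
  move=> [h1 h2 h3 h4]; split=> //; try lia.
  move=> c hc; case: (leqP c k) => hck; first by apply: h3; lia.
  have [->|ne] := eqVneq c s.+1; first by lia.
  by have := hk c; lia.
have nested k' l : matches k' l -> k' < k -> l < s -> l < k.
  move=> [h1 h2 h3 h4] h5 h6; rewrite ltnNge; apply/negP => h7.
  have := h4 k; have := hk l.+1; lia.
have hS' : lt s < b1 -> bounds_wf K (minn b0 (minn (lt s).+1 (gap s.+1)) :: S) s.+1.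
  move=> /hb1[hT1 hT2]; case: K hK hS hK' {IHs} => [|k0 K] /=.
    case: S => //= hK hb _; rewrite !leq_min /=; split=> [/andP[/hb h1 h2] c hc|h].
      case: (leqP c k) => hck; first exact: h1.
      by have [->//|ne] := eqVneq c s.+1; have := hT1 c; lia.
    by apply/andP; split; [apply/hb => c hc|]; apply: h; lia.
  move=> [kk0 wk0 hk0 hK] [hb0 hS] _; split=> // j; rewrite !leq_min; split.
    move=> /and3P[/hb0[h1 h2] h3 h4]; split=> [c hc|k' l hm' hk' hl].
      case: (leqP c k) => hck; first by apply: h1; lia.
      by have [->//|ne] := eqVneq c s.+1; have := hT1 c; lia.
    have [els|nls] := eqVneq l s; first by rewrite els; lia.
    case: (ltngtP k' k) => hkk.
    - by apply: (h2 k') => //; apply: (nested k') => //; lia.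
    - by have := hT2 k' l hm' hkk; lia.
    - by case: (hm') => + _ + _; rewrite hkk; have := hk l.+1; lia.
  move=> [h1 h2]; apply/and3P; split.
  - by apply/hb0; split=> [c hc|k' l hm' hk' hl]; [apply: h1; lia | apply: (h2 k') => //; lia].
  - by have := h2 k s mks; lia.
  - by apply: h1; lia.
rewrite step; split=> [/andP[hT /(IHs _ _ hK' (hS' hT))[h1 h2]]|[[/okE h0 h1] h2]].
  by split=> //; split=> //; apply/okE.
by rewrite h0 /=; apply/(IHs _ _ hK' (hS' h0)).
Qed.

Lemma okl_labels : size T = N -> okl X Y 0 0 [:: 1] T <->
  (forall l, l < N -> label_ok l) /\ (forall c, c <= N -> 0 < gap c).
Proof.
move=> sT; have := @okl_walk 0 [::] [:: 1] (leq0n _) sT; rewrite !drop0 !take0 /= => -> //.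
- by move=> c; rewrite leqn0 => /eqP ->.
- by split=> // _ c; rewrite leqn0 => /eqP ->; rewrite /gap !take0.
Qed.
End Walk.

(** * The heap and the masks *)

Section Growing.
Variables (n z : nat).
Implicit Types (w x y : 'S_n.+1) (i j k m : nat) (u a : seq nat) (keep : pred nat).
Notation prod u := (word_prod n u).
Notation letter := (letter z).
Notation height := (height z).
Notation one := (1%g : 'S_n.+1).

(* Reading u from right to left, every letter adds a box to a partition. *)
Fixpoint growing u : bool :=
  if u is k :: u' then
    [&& 0 < k <= n, ~~ letter (prod u') k.-1, letter (prod u') k & growing u']
  else true.

Lemma prod_cons k u : prod (k :: u) = (gen n k * prod u)%g.
Proof. by rewrite /word_prod big_cons. Qed.

Lemma prod_nil : prod [::] = 1%g.
Proof. by rewrite /word_prod big_nil. Qed.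

Lemma growing_drop m u : growing u -> growing (drop m u).
Proof. by elim: m u => [|m IH] [|k u] //= /and4P[_ _ _ /IH]. Qed.

Lemma growing_word u : growing u -> is_word n u.
Proof. by elim: u => //= k u IH /and4P[-> _ _ /IH]. Qed.

Lemma height_growing u m : growing u -> m <= n.+1 ->
  height (prod u) m = height one m + count_mem m u.
Proof.
move=> + hm; elim: u => [|k u IH] /=; first by rewrite prod_nil addn0.
case/and4P=> hk l1 l2 /IH{}IH; rewrite prod_cons.
by have := height_genl z (prod u) hk hm;
  rewrite l2 (negPf l1) IH muln0 muln1 addn0 [m == k]eq_sym => ->; rewrite addnAC addnA.
Qed.

Lemma letter_height x i : letter x i = height x i.+1 - height x i :> nat.
Proof. by rewrite heightS addKn. Qed.

Lemma letter_notin u k : growing u -> k <= n -> k \notin u -> k.+1 \notin u ->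
  letter (prod u) k = letter one k.
Proof.
move=> hu hk k1 k2; apply: (can_inj oddb); rewrite !letter_height !height_growing //; try lia.
by rewrite (count_memPn k1) (count_memPn k2); rewrite !addn0.
Qed.

Lemma letter_true_index u k : growing u -> 0 < k <= n -> k \in u -> letter (prod u) k ->
  index k.+1 u < index k u.
Proof.
elim: u => // c u IH /and4P[hc l1 l2 hu] hk; rewrite inE prod_cons letter_genl //; last lia.
have [ek|ne] := eqVneq k c; first subst c.
  by have -> : (k == k.-1) = false by [lia]; rewrite ?eqxx /= (negPf l1).
rewrite /= [c == k]eq_sym (negPf ne); have [e|ne'] := eqVneq c k.+1 => //.
by rewrite (_ : (k == c.-1) = false) => [ku lk|]; [apply: IH | lia].
Qed.

Lemma letter_false_index u k : growing u -> 0 < k < n -> k.+1 \in u -> ~~ letter (prod u) k ->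
  index k u < index k.+1 u.
Proof.
elim: u => // c u IH /and4P[hc l1 l2 hu] hk; rewrite inE prod_cons letter_genl //; last lia.
have [ek|ne] := eqVneq k.+1 c; first subst c.
  by rewrite /= eqxx l2.
rewrite /= [c == k.+1]eq_sym (negPf ne); have [e|ne'] := eqVneq c k => //.
by rewrite (_ : (k == c.-1) = false) => [ku lk|]; [apply: IH | lia].
Qed.

Lemma growing_monotone u : growing u -> block_monotone z true (prod u).
Proof.
elim: u => [_|k u IH /= /and4P[hk l1 l2 /IH hu]].
  rewrite prod_nil => k hk kz; rewrite asc_right // invg1 !perm1 !val_inord; lia.
by rewrite prod_cons; apply: block_monotone_genl; rewrite // (negPf l1) l2.
Qed.

Lemma reduced_growing (v : 'S_n.+1) a : block_monotone z true v -> reduced_word a v -> growing a.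
Proof.
elim: a v => //= k a IH v hv /and3P[/= /andP[hk ha] /eqP e /eqP hs].
have ve : v = (gen n k * prod a)%g by rewrite -e prod_cons.
have := length_word ha; have := length_genl (prod a) hk; rewrite -ve -hs => l1 l2.
have la : size a = cox_length (prod a) by lia.
have := asc_left (prod a) hk; rewrite -ve -hs -la ltnSn => /esym lt.
have ne : letter v k.-1 != letter v k.
  apply/eqP => e'; have := (block_monotoneP z true v).1 hv k.-1 k.
  have v1 : v (inord k.-1) = prod a (inord k) by rewrite ve permM /gen tpermL.
  have v2 : v (inord k) = prod a (inord k.-1) by rewrite ve permM /gen tpermR.
  have hk' : k.-1 < k <= n by lia.
  by rewrite v1 v2 => /(_ hk' e'); lia.
have pa : prod a = (gen n k * v)%g by rewrite ve mulgA genK mul1g.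
have mono : block_monotone z true (prod a) by rewrite pa; apply: block_monotone_genl.
rewrite hk (IH (prod a)) //= ?andbT; last by rewrite /reduced_word ha eqxx la eqxx.
have hk1 : k.-1 <= n by lia.
have hk2 : k <= n by lia.
move: ne; rewrite ve !letter_genl // !eqxx (_ : (k == k.-1) = false); last lia.
by move: lt; rewrite /letter; case: leqP; case: leqP; lia.
Qed.

Fixpoint kept (keep : pred nat) u : seq nat :=
  if u is k :: u' then (if keep 0 then cons k else id) (kept (fun i => keep i.+1) u') else [::].

Lemma count_kept keep u k :
  (forall i, i < size u -> nth 0 u i = k -> keep i) -> count_mem k (kept keep u) = count_mem k u.
Proof.
elim: u keep => //= c u IH keep h.
have IH' := IH (fun i => keep i.+1) (fun i => h i.+1).
case: eqP (h 0) => [e ->//|ne _] /=; first by rewrite /= e eqxx IH'.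
by case: (keep 0); rewrite /= ?IH' //; case: eqP.
Qed.

Lemma count_kept_le keep u k : count_mem k (kept keep u) <= count_mem k u.
Proof. by elim: u keep => //= c u IH keep; have := IH (fun i => keep i.+1); case: (keep 0) => /=;
  lia. Qed.

Lemma count_kept_top keep u k m : m <= count_mem k u ->
  (forall i, i < size u -> nth 0 u i = k -> count_mem k (take i u) < m -> ~~ keep i) ->
  count_mem k (kept keep u) + m <= count_mem k u.
Proof.
elim: u keep m => [|c u IH] keep m; first by rewrite leqn0 => /eqP ->.
case: m => [|m] hm h; first by rewrite addn0 count_kept_le.
have [e|ne] := eqVneq c k.
  move: hm; rewrite /= e eqxx => hm; have := h 0 isT e isT => /negPf -> /=.
  have := IH (fun i => keep i.+1) m; rewrite -[m <= _]ltnS => /(_ hm) h2.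
  have := h2 _; rewrite addnS => h3; apply: h3 => i hi ei lt.
  by apply: (h i.+1) => //=; rewrite e eqxx.
move: hm; rewrite /= (negPf ne) => hm.
have h2 : count_mem k (kept (fun i => keep i.+1) u) + m.+1 <= count_mem k u.
  apply: IH => // i hi ei lt; apply: (h i.+1) => //=.
  by rewrite (negPf ne).
by case: (keep 0) => //=; rewrite (negPf ne).
Qed.

Lemma kept_prod keep u : prod (kept keep u) = (\prod_(i < size u | keep i) gen n (nth 0 u i))%g.
Proof.
elim: u keep => [|c u IH] keep; first by rewrite prod_nil big_ord0.
rewrite big_mkcond big_ord_recl /= -big_mkcond /= -(IH (fun i => keep i.+1)).
by case: (keep 0); rewrite ?prod_cons ?mul1g.
Qed.

Lemma growing_kept keep u : growing u ->
  (forall i j, i < j < size u -> keep i ->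
     nth 0 u j <= (nth 0 u i).+1 -> nth 0 u i <= (nth 0 u j).+1 -> keep j) ->
  growing (kept keep u).
Proof.
elim: u keep => //= k u IH keep /and4P[hk l1 l2 hu] h.
have gu : growing (kept (fun i => keep i.+1) u).
  by apply: IH => // i j hij; apply: (h i.+1 j.+1).
case k0: (keep 0) => //=.
have cnt m : k.-1 <= m <= k.+1 -> count_mem m (kept (fun i => keep i.+1) u) = count_mem m u.
  by move=> hm; apply: count_kept => i hi ei; apply: (h 0 i.+1); rewrite //= ei; lia.
have hh m : m <= n.+1 -> k.-1 <= m <= k.+1 ->
    height (prod (kept (fun i => keep i.+1) u)) m = height (prod u) m.
  by move=> h1 h2; rewrite !height_growing // cnt.
have ll m : m <= n -> k.-1 <= m <= k ->
    letter (prod (kept (fun i => keep i.+1) u)) m = letter (prod u) m.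
  by move=> h1 h2; apply: (can_inj oddb); rewrite !letter_height !hh //; lia.
by rewrite hk gu andbT !ll // ?l1 ?l2 //; lia.
Qed.
End Growing.

Section LongestParabolic.
Variable n : nat.
Implicit Types (x : 'I_n.+1).
Notation prod u := (word_prod n u).

Lemma prod_cat u s : prod (u ++ s) = (prod u * prod s)%g.
Proof. by rewrite /word_prod big_cat. Qed.

Lemma prod_flatten s ss : prod (flatten (s :: ss)) = (prod s * prod (flatten ss))%g.
Proof. exact: prod_cat. Qed.

Lemma map_iotaS (T : Type) (f : nat -> T) m :
  [seq f j | j <- iota 0 m.+1] = f 0 :: [seq f j.+1 | j <- iota 0 m].
Proof. by rewrite [iota 0 m.+1]/= (iotaDl 1 0) map_cons -map_comp. Qed.

Lemma prod_iota m x : m <= n ->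
  prod (iota 1 m) x = (if x == 0 :> nat then m else if x <= m then x.-1 else x) :> nat.
Proof.
elim: m x => [|m IH] x hm.
  by rewrite prod_nil perm1; case: eqP => // ?; case: leqP => //; lia.
have -> : iota 1 m.+1 = iota 1 m ++ [:: m.+1] by rewrite -[in LHS](addn1 m) iotaD.
rewrite prod_cat permM prod_cons prod_nil mulg1 genE ?IH; try lia.
case: (nat_of_ord x =P 0) => h0; last case: (leqP x m) => h1; case: (leqP x m.+1) => h2;
  do ![case: eqP => ?]; lia.
Qed.

Lemma prod_staircase m x : m <= n ->
  prod (flatten [seq iota 1 (m - j) | j <- iota 0 m]) x = (if x <= m then m - x else x) :> nat.
Proof.
elim: m x => [|m IH] x hm.
  by rewrite prod_nil perm1; case: leqP; lia.
rewrite map_iotaS prod_flatten permM.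
rewrite (eq_map (_ : _ =1 (fun j => iota 1 (m - j)))) // IH; last lia.
have -> : prod (iota 1 (m.+1 - 0)) x = (if x == 0 :> nat then m.+1 else if x <= m.+1 then x.-1
  else x) :> nat.
  by rewrite subn0 prod_iota.
case: (nat_of_ord x =P 0) => h0; case: (leqP x m.+1) => h2; case: leqP => ?; lia.
Qed.

Lemma prod_rev_iota c m x : 0 < c -> c + m <= n.+1 ->
  prod (rev (iota c m)) x =
    (if x == c.-1 + m :> nat then c.-1 else if c.-1 <= x < c.-1 + m then x.+1 else x) :> nat.
Proof.
elim: m c x => [|m IH] c x hc hm.
  rewrite prod_nil perm1; case: (nat_of_ord x =P _) => h; last case: ifP; lia.
rewrite /= rev_cons -cats1 prod_cat permM prod_cons prod_nil mulg1 genE ?IH; try lia.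
case: (nat_of_ord x =P c + m) => h1; case: (nat_of_ord x =P c.-1 + m.+1) => h2; try lia.
  by do ![case: eqP => ?]; lia.
case h3: (c.-1 <= x < c.-1 + m.+1); case h4: (c <= x < c + m); do ![case: eqP => ?]; lia.
Qed.

Lemma prod_rev_staircase c m x : 0 < c -> c + m <= n.+1 ->
  prod (flatten [seq rev (iota (c + j) (m - j)) | j <- iota 0 m]) x =
    (if c.-1 <= x < c + m then c.-1 + (c.-1 + m) - x else x) :> nat.
Proof.
elim: m c x => [|m IH] c x hc hm.
  rewrite prod_nil perm1; case: ifP; lia.
rewrite map_iotaS prod_flatten permM.
rewrite (eq_map (_ : _ =1 (fun j => rev (iota (c.+1 + j) (m - j))))); last first.
  by move=> j /=; congr (rev (iota _ _)); lia.
rewrite IH; try lia.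
rewrite addn0 subn0 prod_rev_iota //.
case: (nat_of_ord x =P c.-1 + m.+1) => h1; case h2: (c.-1 <= x < c + m.+1);
  case h3: (c.-1 <= x < c.-1 + m.+1);
  case: ifP; lia.
Qed.

Lemma prod_w0J z x : 0 < z <= n ->
  prod (w0J_word n z) x = (if x < z then z.-1 - x else z + n - x) :> nat.
Proof.
move=> hz; rewrite /w0J_word prod_cat permM -/(w0J_word n z).
rewrite (eq_map (_ : _ =1 (fun j => rev (iota (z.+1 + j) (n - z - j))))); last first.
  by move=> j /=; congr (rev (iota _ _)); lia.
have := ltn_ord x; rewrite prod_rev_staircase ?(@prod_staircase (z - 1)); try lia.
case: (leqP x (z - 1)) => h1; case: (ltnP x z) => h2; try lia; case: ifP; lia.
Qed.

Lemma gen_commute c d : 0 < c <= n -> 0 < d <= n ->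
  (gen n c * gen n d != gen n d * gen n c)%g = (d == c.+1) || (c == d.+1).
Proof.
move=> hc hd.
have noncomm k : 0 < k -> k.+1 <= n -> (gen n k * gen n k.+1 != gen n k.+1 * gen n k)%g.
  move=> k0 kn; have e1 : gen n k (inord k.-1) = inord k by rewrite /gen tpermL.
  have e2 : gen n k.+1 (inord k) = inord k.+1 by rewrite /gen tpermL.
  have e3 : gen n k.+1 (inord k.-1) = inord k.-1.
    by rewrite /gen tpermD // -val_eqE /= !val_inord; lia.
  apply/eqP => /permP /(_ (inord k.-1)); rewrite !permM e1 e2 e3 e1.
  by move=> /(congr1 (@nat_of_ord n.+1)); rewrite !val_inord; lia.
apply/idP/idP => [|/orP[]/eqP e].
- apply: contraR; rewrite negb_or => /andP[/eqP n1 /eqP n2]; apply/eqP/permP => x.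
  rewrite !permM; apply: val_inj; rewrite /= !genE //.
  case: (nat_of_ord x =P c.-1) => h1; case: (nat_of_ord x =P c) => h2;
  case: (nat_of_ord x =P d.-1) => h3; case: (nat_of_ord x =P d) => h4; do ![case: eqP => ?]; lia.
- by rewrite e; apply: noncomm; lia.
- by rewrite e eq_sym; apply: noncomm; lia.
Qed.
End LongestParabolic.

Section CosetRep.
Variables (n z : nat).
Implicit Types (w x : 'S_n.+1).

Lemma perm_word_parabolic w x : x \in parabolic n z -> perm_word z (w * x)%g = perm_word z w.
Proof.
move=> /gen_prodgP[m [c hc ->]]; elim: m c hc => [|m IH] c hc; first by rewrite big_ord0 mulg1.
rewrite big_ord_recr /= mulgA; have /imsetP[k hk ->] := hc ord_max.
rewrite inE in hk.
by rewrite perm_word_genr ?ltn_ord //; apply: IH => i; apply: hc.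
Qed.

Lemma min_coset_repP w : min_coset_rep z w \in (w *: parabolic n z)%g /\
  forall x, x \in (w *: parabolic n z)%g -> cox_length (min_coset_rep z w) <= cox_length x.
Proof.
rewrite /min_coset_rep; case: arg_minnP => [|x hx hmin]; first exact: lcoset_refl.
by split.
Qed.

Lemma perm_word_min_coset_rep w : perm_word z (min_coset_rep z w) = perm_word z w.
Proof. by have [/lcosetP[x hx ->] _] := min_coset_repP w; apply: perm_word_parabolic. Qed.

Lemma min_coset_rep_monotone w : block_monotone z true (min_coset_rep z w).
Proof.
have [hin hmin] := min_coset_repP w; set v := min_coset_rep z w in hin hmin *.
move=> k hk kz; apply/negPn/negP => hasc.
have lt := desc_right v hk; rewrite -/(right_ascent v k) hasc -mulgA genK mulg1 in lt.
have : (v * gen n k)%g \in (w *: parabolic n z)%g.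
  move: hin; rewrite !mem_lcoset mulgA => hin; rewrite groupM //.
  have lk : k.-1 < n by lia.
  apply: mem_gen; apply/imsetP; exists (Ordinal lk); rewrite ?inE /= prednK //; lia.
by move/hmin; rewrite leqNgt lt.
Qed.
End CosetRep.

Section Heap.
Variables (n z : nat) (a : seq nat).
Hypothesis z_range : 0 < z <= n.
Hypothesis a_growing : growing n z a.
Notation prod u := (word_prod n u).
Notation letter := (letter z).
Notation height := (height z).
Notation one := (1%g : 'S_n.+1).
Notation full := (full_word n z a).
Notation pos := (position n z a).
Notation v := (prod a).
Implicit Types (i j : pos) (k l m : nat).

Lemma size_full : size full = size a + size (w0J_word n z).
Proof. exact: size_cat. Qed.

Lemma column_lt i : i < size a -> column i = nth 0 a i.
Proof. by move=> hi; rewrite /column nth_cat hi. Qed.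

Lemma w0J_letters k : k \in w0J_word n z -> 0 < k <= n /\ k != z.
Proof.
rewrite mem_cat => /orP[] /flatten_mapP[j]; rewrite mem_iota => hj.
  by rewrite mem_iota; lia.
by rewrite mem_rev mem_iota; lia.
Qed.

Lemma a_letters k : k \in a -> 0 < k <= n.
Proof. by have /allP := growing_word a_growing; exact. Qed.

Lemma column_range i : 0 < column i <= n.
Proof.
have := mem_nth 0 (ltn_ord i); rewrite /= mem_cat => /orP[/a_letters//|/w0J_letters[]//].
Qed.

Lemma heap_stepE i j : heap_step i j =
  (j < i) && ((column j == (column i).+1) || (column i == (column j).+1)).
Proof. by rewrite /heap_step gen_commute ?column_range. Qed.

Lemma heap_le_leq i j : heap_le i j -> j <= i.
Proof.
case/connectP=> p + ->; elim: p i => //= i' p IH i /andP[/andP[lt _] /IH]; lia.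
Qed.

Lemma low_at_pos p : p < size a ->
  let k := nth 0 a p in let u := drop p.+1 a in
  [/\ growing n z u, ~~ letter (prod u) k.-1 & letter (prod u) k].
Proof.
move=> hp; have := growing_drop p a_growing; rewrite (drop_nth 0) //=.
by case/and4P.
Qed.

Lemma adjacent_after p : p < size a -> nth 0 a p != z \/ nth 0 a p \in drop p.+1 a ->
  exists2 q, p < q < size a & (nth 0 a q == (nth 0 a p).+1) || (nth 0 a p == (nth 0 a q).+1).
Proof.
move=> hp hz; have [gu l1 l2] := low_at_pos hp; set k := nth 0 a p in hz l1 l2 *;
  set u := drop p.+1 a in hz gu l1 l2.
have su : size u = size a - p.+1 by rewrite size_drop.
have kr : 0 < k <= n by apply: a_letters; rewrite mem_nth.
have from c : c \in u -> (c == k.+1) || (k == c.+1) ->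
    exists2 q, p < q < size a & (nth 0 a q == k.+1) || (k == (nth 0 a q).+1).
  move=> cu hc; exists (p.+1 + index c u); last by rewrite -nth_drop nth_index.
  by have := index_mem c u; rewrite cu su; lia.
case: (boolP (k \in u)) => ku.
  have lt := letter_true_index gu kr ku l2.
  by apply: (from k.+1); rewrite ?eqxx // -index_mem (leq_trans lt) // index_size.
have kz : k != z by case: hz => // h; rewrite h in ku.
case: (boolP (k.+1 \in u)) => k1u; first by apply: (from k.+1); rewrite ?eqxx.
case: (boolP (k.-1 \in u)) => k2u; first by apply: (from k.-1); rewrite ?eqxx ?orbT //; lia.
have kn : k <= n by lia.
have kn' : k.-1 <= n by lia.
have ku' : k.-1.+1 \notin u by rewrite prednK //; lia.
have e1 := letter_notin gu kn ku k1u; have e2 := letter_notin gu kn' k2u ku'.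
by move: l1 l2 kz kr; rewrite e1 e2 /letter !perm1 !val_inord //; clear; lia.
Qed.

Lemma between p q : p < q -> q < size a -> nth 0 a p = nth 0 a q ->
  exists2 r, p < r < q & nth 0 a r = (nth 0 a p).+1.
Proof.
move=> pq hq e; have hp : p < size a by lia.
have [gu l1 l2] := low_at_pos hp; set k := nth 0 a p in e l1 l2 *; set u := drop p.+1 a in gu l1 l2.
have kr : 0 < k <= n by apply: a_letters; rewrite mem_nth.
have qs : q - p.+1 < size u by rewrite size_drop; lia.
have eq' : nth 0 u (q - p.+1) = k by rewrite nth_drop e; congr nth; lia.
have ku : k \in u by rewrite -eq' mem_nth.
have lt := letter_true_index gu kr ku l2.
have k1u : k.+1 \in u by rewrite -index_mem (leq_trans lt) // index_size.
have le : index k u <= q - p.+1.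
  by rewrite leqNgt; apply/negP => /(before_find 0); rewrite /= eq' eqxx.
exists (p.+1 + index k.+1 u); first lia.
by rewrite -nth_drop nth_index.
Qed.

Lemma heap_step_adj i j : j < i -> (column j == (column i).+1) || (column i == (column j).+1) ->
  heap_le i j.
Proof. by move=> lt adj; apply: connect1; rewrite heap_stepE lt. Qed.

Lemma heap_le_same i j : i < size a -> j <= i -> column i = column j -> heap_le i j.
Proof.
move=> hi; rewrite leq_eqVlt => /orP[/eqP/val_inj ->|ji] e; first exact: connect0.
have hj : j < size a by lia.
rewrite !column_lt // in e; have [r hr er] := between ji hi (esym e).
have hr' : r < size full by rewrite size_full; lia.
have hra : r < size a by lia.
apply: (@connect_trans _ _ (Ordinal hr')); apply: heap_step_adj; rewrite ?column_lt /=; try lia.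
Qed.

Lemma heap_le_tail i j : size a <= i -> j < size a -> column i = column j -> heap_le i j.
Proof.
move=> hi hj e.
have cz : column i != z.
  have : column i \in w0J_word n z.
    rewrite /column nth_cat ltnNge hi /= mem_nth //.
    by rewrite -(ltn_add2l (size a)) subnKC // -size_full ltn_ord.
  by case/w0J_letters.
rewrite e column_lt // in cz.
have [r hr er] := adjacent_after hj (or_introl cz).
have hr' : r < size full by rewrite size_full; lia.
have hra : r < size a by lia.
apply: (@connect_trans _ _ (Ordinal hr')); apply: heap_step_adj; rewrite ?e ?column_lt /=; lia.
Qed.

Definition above_set j := [set i : pos | (column i == column j) && heap_lt j i].

Definition earlier_set j := [set i : pos | (i < minn j (size a)) && (column i == column j)].

Lemma card_earlier j : #|earlier_set j| = count_mem (column j) (take j a).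
Proof.
set k := column j; set m := minn j (size a).
have -> : count_mem k (take j a) = \sum_(p < m) (nth 0 full p == k).
  have sm : size (take j a) = m by rewrite size_take_min.
  rewrite -sum1_count big_mkcond (big_nth 0) big_mkord sm; apply: eq_bigr => p _ /=.
  have := ltn_ord p; rewrite leq_min => /andP[hpj hpa].
  by rewrite nth_take // /full_word nth_cat hpa; case: eqP.
rewrite (big_ord_widen (size full) (fun p => (nth 0 full p == k) : nat));
  last by have := ltn_ord j; rewrite /m; lia.
rewrite -sum1dep_card big_mkcondr /=; apply: eq_bigr => i _.
by rewrite /column; case: eqP.
Qed.

Lemma earlier_above j : earlier_set j \subset above_set j.
Proof.
apply/subsetP => i; rewrite !inE => /andP[hi /eqP e]; rewrite e eqxx /=.
have ia : i < size a by lia.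
rewrite /heap_lt; apply/andP; split; first by apply/eqP => e'; rewrite e' in hi; lia.
by case: (ltnP j (size a)) => ja; [apply: heap_le_same | apply: heap_le_tail]; rewrite ?e //; lia.
Qed.

Lemma above_earlier j : j < size a -> above_set j \subset earlier_set j.
Proof.
move=> ja; apply/subsetP => i; rewrite !inE => /andP[-> /andP[ne le]].
have := heap_le_leq le; rewrite leq_eqVlt => /orP[/eqP/val_inj e|lt]; first by rewrite e eqxx in ne.
by rewrite andbT; lia.
Qed.

Lemma among_topE m j : j < size a -> among_top m j = (count_mem (column j) (take j a) < m).
Proof.
move=> ja; rewrite /among_top -/(above_set j); congr (_ < _).
by rewrite -card_earlier; apply: eq_card; apply/subset_eqP; rewrite above_earlier // earlier_above.
Qed.

Lemma among_top_lt m j : m <= count_mem (column j) a -> among_top m j -> j < size a.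
Proof.
rewrite /among_top -/(above_set j) => hm lt; rewrite ltnNge; apply/negP => ja.
have := subset_leq_card (earlier_above j); rewrite card_earlier take_oversize // => le.
by have := leq_trans hm le; rewrite leqNgt lt.
Qed.
End Heap.

Section Masks.
Variables (n z : nat) (a : seq nat).
Hypothesis z_range : 0 < z <= n.
Hypothesis a_growing : growing n z a.
Notation prod u := (word_prod n u).
Notation letter := (letter z).
Notation height := (height z).
Notation one := (1%g : 'S_n.+1).
Notation full := (full_word n z a).
Notation pos := (position n z a).
Notation v := (prod a).
Implicit Types (i j : pos) (k l m : nat).

Lemma pos_exists q : q < size a -> exists i : pos, i = q :> nat.
Proof.
move=> hq; have h : q < size full by rewrite size_full ltn_addr.
by exists (Ordinal h).
Qed.

Lemma is_topE k i : is_top k i = (i < size a) && (column i == k) && (i == index k a :> nat).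
Proof.
rewrite /is_top -andbA; case: (ltnP i (size a)) => //= ia; case: eqP => //= ci.
have ka : k \in a by rewrite -ci column_lt // mem_nth.
have lt : index k a < size a by rewrite index_mem.
apply/forallP/eqP => [h|e j].
  have [j ej] := pos_exists lt.
  have := h j; rewrite ej lt column_lt ?ej // nth_index // eqxx /= => /(heap_le_leq z_range a_growing).
  rewrite ej => le; apply/eqP; rewrite eqn_leq le /= leqNgt; apply/negP => lt'.
  by have := before_find 0 lt'; rewrite /= -column_lt // ci eqxx.
apply/implyP => /andP[ja /eqP cj]; apply: heap_le_same => //; last by rewrite ci cj.
rewrite e leqNgt; apply/negP => lt'; have := before_find 0 lt'.
by rewrite /= -column_lt // cj eqxx.
Qed.

Lemma lparenE k : lparen n z a k = has_symbol a k && ~~ letter v k.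
Proof.
rewrite /lparen /has_symbol; case: (boolP (k \in a)) => //= ka; case: (boolP (k.+1 \in a)) => //= k1a.
have kr := a_letters a_growing ka; have k1r := a_letters a_growing k1a.
have -> : ~~ letter v k = (index k a < index k.+1 a).
  apply/idP/idP => h.
    by apply: (letter_false_index a_growing _ k1a h); lia.
  apply/negP => h'; have := letter_true_index a_growing kr ka h'; lia.
have [i ei] : exists i : pos, i = index k a :> nat by apply: pos_exists; rewrite index_mem.
have [j ej] : exists j : pos, j = index k.+1 a :> nat by apply: pos_exists; rewrite index_mem.
have ia : i < size a by rewrite ei index_mem.
have ja : j < size a by rewrite ej index_mem.
have ci : column i = k by rewrite column_lt // ei nth_index.
have cj : column j = k.+1 by rewrite column_lt // ej nth_index.
apply/existsP/idP => [[i' /existsP[j' /and3P[]]]|lt].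
  rewrite !is_topE => /andP[_ /eqP ei'] /andP[_ /eqP ej'] /andP[ne /(heap_le_leq z_range a_growing)].
  rewrite -ei' -ej' leq_eqVlt => /orP[/eqP/val_inj e|//].
  by rewrite e eqxx in ne.
exists i; apply/existsP; exists j; rewrite !is_topE ia ja ci cj ei ej !eqxx /=.
rewrite /heap_lt; apply/andP; split; first by apply/eqP => e; move: lt; rewrite -ei -ej e ltnn.
by apply: heap_step_adj => //; rewrite ?ci ?cj ?eqxx ?orbT // ei ej.
Qed.

Variable t : labeling n z a.
Hypothesis t_leaf : forall p, is_leaf p -> t p <= capacity a (valley_column p).

Definition keep : pred nat := fun q => [forall i : pos, (i == q :> nat) ==> ~~ masked t i].

Lemma keepE i : keep i = ~~ masked t i.
Proof.
apply/forallP/idP => [/(_ i)|h j]; first by rewrite eqxx.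
by apply/implyP => /eqP/val_inj ->.
Qed.

Lemma masked_lt i : masked t i -> i < size a.
Proof.
case/existsP=> p /existsP[j /and4P[lf /eqP cj top /(heap_le_leq z_range a_growing) le]].
apply: leq_ltn_trans le _; apply: (among_top_lt z_range a_growing _ top).
by rewrite cj; apply: t_leaf.
Qed.

Lemma masked_up i j : masked t i -> heap_le i j -> masked t j.
Proof.
case/existsP=> p /existsP[r /and4P[lf cj top le]] ij.
apply/existsP; exists p; apply/existsP; exists r; rewrite lf cj top /=.
exact: connect_trans ij.
Qed.

Lemma masked_prodE : masked_prod t = (prod (kept keep a) * prod (w0J_word n z))%g.
Proof.
have -> : masked_prod t = (\prod_(i < size full | keep i) gen n (nth 0 full i))%g.
  by apply: eq_bigl => i; rewrite keepE.
rewrite -kept_prod -prod_cat; congr (word_prod n _).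
have tail : forall i : nat, size a <= i -> keep i.
  move=> i hi; apply/forallP => j; apply/implyP => /eqP e; apply/negP => /masked_lt; lia.
rewrite /full_word; elim: a (keep) tail => [|c u IH] kp hk /=.
  elim: (w0J_word n z) kp hk => //= d s IH kp hk.
  by rewrite hk // IH // => i _; apply: hk.
by case: (kp 0) => /=; rewrite IH // => i hi; apply: hk.
Qed.

Lemma growing_keep : growing n z (kept keep a).
Proof.
apply: growing_kept => // q r hqr hq c1 c2.
have [i ei] := pos_exists (ltn_trans (proj1 (andP hqr)) (proj2 (andP hqr))).
have [j ej] := pos_exists (proj2 (andP hqr)).
have ia : i < size a by lia.
have ja : j < size a by lia.
rewrite -ei keepE in hq; rewrite -ej keepE; apply: contra hq => hj.
apply: (masked_up hj); rewrite -ei -ej -!column_lt // in c1 c2.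
have [e|ne] := eqVneq (column i) (column j); first by apply: heap_le_same; rewrite ?ei ?ej //; lia.
by apply: heap_step_adj; rewrite // ?ei ?ej; lia.
Qed.

Lemma letter_w0J x m : m <= n -> letter (x * prod (w0J_word n z))%g m = letter x m.
Proof.
move=> hm; rewrite /letter permM prod_w0J //; have := ltn_ord (x (inord m)).
move: (nat_of_ord (x _)) => r; by case: (ltnP r z); lia.
Qed.

Lemma height_w0J x m : m <= n.+1 -> height (x * prod (w0J_word n z))%g m = height x m.
Proof. by move=> hm; apply: eq_big_nat => q hq; rewrite letter_w0J //; lia. Qed.

Lemma block_decreasing_w0J x : block_monotone z true x ->
  block_decreasing z (x * prod (w0J_word n z))%g.
Proof.
move=> /block_monotoneP hx; apply/block_decreasingP => i j hij.
have hi : i <= n by lia.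
have hj : j <= n by lia.
rewrite !letter_w0J // => e; have := hx i j hij e; move: e; rewrite /letter !permM !prod_w0J //.
have := ltn_ord (x (inord j)); have := ltn_ord (x (inord i)).
move: (nat_of_ord (x (inord i))) (nat_of_ord (x (inord j))) => r s.
by case: (ltnP r z); case: (ltnP s z); lia.
Qed.

Lemma masked_prod_top : block_decreasing z (masked_prod t).
Proof. by rewrite masked_prodE; apply/block_decreasing_w0J/growing_monotone/growing_keep. Qed.

Lemma height_masked_prod m : m <= n.+1 ->
  height (masked_prod t) m = height one m + count_mem m (kept keep a).
Proof. by move=> hm; rewrite masked_prodE height_w0J // height_growing // growing_keep. Qed.

Lemma height_masked_le m : m <= n.+1 -> height (masked_prod t) m <= height v m.
Proof. by move=> hm; rewrite height_masked_prod // height_growing // leq_add2l count_kept_le. Qed.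

Lemma height_masked_leaf p : is_leaf p ->
  height (masked_prod t) (valley_column p) + t p <= height v (valley_column p).
Proof.
move=> lf; set l := valley_column p.
have hl : l <= n.+1 by have := ltn_ord (val p).2; rewrite /l /valley_column; lia.
rewrite height_masked_prod // height_growing // -addnA leq_add2l.
apply: count_kept_top => [|q hq eq lt]; first exact: t_leaf.
have [i ei] := pos_exists hq; rewrite -ei keepE negbK.
apply/existsP; exists p; apply/existsP; exists i; rewrite lf column_lt ei // eq eqxx /=.
rewrite among_topE ?ei // column_lt ?ei // eq lt /=; exact: connect0.
Qed.

Lemma heightS_le (x : 'S_n.+1) m : height x m <= height x m.+1 <= (height x m).+1.
Proof. by rewrite heightS; case: letter => /=; lia. Qed.

(* The boxes of a partition form a heap ideal. *)
Lemma rank_heap_le (y : 'S_n.+1) i j : heap_le j i -> j < size a ->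
  height one (column i) + count_mem (column i) (drop i a) <= height y (column i) ->
  height one (column j) + count_mem (column j) (drop j a) <= height y (column j).
Proof.
move=> /connectP[p]; elim: p j i => [|i' p IH] j i /=; first by move=> _ ->.
move=> /andP[st hp] e ja hi; have ji := heap_stepE z_range a_growing j i'.
rewrite st in ji; case/esym/andP: ji => lt adj.
have {IH hi} := IH i' i hp e (ltn_trans lt ja) hi.
have i'a := ltn_trans lt ja.
have [gu l1 l2] := low_at_pos a_growing i'a; rewrite -(column_lt i'a) in l1 l2.
have ci : 0 < column i' <= n := column_range z_range a_growing i'.
set k := column i' in l1 l2 adj ci *.
have dr : count_mem k (drop i' a) = (count_mem k (drop i'.+1 a)).+1.
  by rewrite (drop_nth 0) //= -column_lt // -/k eqxx.
rewrite dr => hi.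
have sub c : count_mem c (drop j a) <= count_mem c (drop i'.+1 a).
  by rewrite -(subnK lt) -drop_drop -{2}(cat_take_drop (j - i'.+1) (drop i'.+1 a)) count_cat leq_addl.
have hx m : m <= n.+1 -> height (prod (drop i'.+1 a)) m = height one m + count_mem m (drop i'.+1 a).
  by move=> hm; rewrite height_growing.
have hk1 : k.+1 <= n.+1 by lia.
have hk0 : k <= n.+1 by lia.
case/orP: adj => /eqP ec; last first.
  rewrite ec; have := heightS z (prod (drop i'.+1 a)) k; rewrite l2 !hx //.
  have := heightS_le y k; have := sub k.+1; move: hi; rewrite addn1; clear.
  move: (height one k) (height one k.+1) (height y k) (height y k.+1) => h1 h2 h3 h4.
  move: (count_mem _ _) (count_mem _ _) (count_mem _ _) => c1 c2 c3; lia.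
set c := column j in ec *; rewrite ec /= in l1 hi hk0; have hc : c <= n.+1 by lia.
have := heightS z (prod (drop i'.+1 a)) c; rewrite (negPf l1) !hx //.
have := heightS_le y c; have := sub c; move: hi; rewrite addn0; clear.
move: (height one c) (height one c.+1) (height y c) (height y c.+1) => h1 h2 h3 h4.
by move: (count_mem _ _) (count_mem _ _) (count_mem _ _) => c1 c2 c3; lia.
Qed.

Lemma count_drop_exists (s : seq nat) c r : 0 < r <= count_mem c s ->
  exists q, [/\ q < size s, nth 0 s q = c & count_mem c (drop q s) = r].
Proof.
elim: s => [|d s IH] hr; first by move: hr => /=; lia.
have [e|ne] := eqVneq r (count_mem c (d :: s)); last first.
  have [|q [h1 h2 h3]] := IH; last by exists q.+1.
  by move: hr ne => /=; case: (d == c); lia.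
have [ed|nd] := eqVneq d c; first by exists 0; split=> //=; rewrite drop0.
have [|q [h1 h2 h3]] := IH; last by exists q.+1.
by move: hr; rewrite /= (negPf nd).
Qed.

Lemma count_kept_drop (kp : pred nat) (s : seq nat) c q :
  (forall r, q <= r < size s -> nth 0 s r = c -> kp r) ->
  count_mem c (drop q s) <= count_mem c (kept kp s).
Proof.
elim: s kp q => //= d s IH kp [|q] h.
  have := IH (fun r => kp r.+1) 0 (fun r => h r.+1); rewrite drop0 => le.
  have [e|ne] := eqVneq d c; first by rewrite (h 0 isT e) /= e eqxx leq_add2l.
  by case: (kp 0); rewrite /= (negPf ne).
have := IH (fun r => kp r.+1) q (fun r => h r.+1) => le.
by case: (kp 0) => //=; apply: leq_trans le (leq_addl _ _).
Qed.

Lemma bruhat_masked y : bruhat_le y (masked_prod t) <->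
  (forall k, k <= n.+1 -> height y k <= height v k) /\
  (forall p, is_leaf p -> height y (valley_column p) + t p <= height v (valley_column p)).
Proof.
split=> [le|[dom leaf]].
  have h k (hk : k <= n.+1) := height_bruhat z hk le.
  split=> [k hk|p lf]; first exact: leq_trans (h k hk) (height_masked_le hk).
  have hl : valley_column p <= n.+1 by have := ltn_ord (val p).2; rewrite /valley_column; lia.
  by apply: leq_trans (height_masked_leaf lf); rewrite leq_add2r h.
apply: (bruhat_of_height z_range masked_prod_top) => k hk.
rewrite height_masked_prod // leqNgt; apply/negP => lt.
have := dom k hk; rewrite height_growing // => le.
have [|q [hq ek er]] := @count_drop_exists a k (height y k - height one k); first lia.
have [i ei] := pos_exists hq.
have ia : i < size a by rewrite ei.
have ci : column i = k by rewrite column_lt // ei.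
have mi : masked t i.
  case: (boolP (masked t i)) => // nmi; exfalso.
  have : count_mem k (drop q a) <= count_mem k (kept keep a); last by rewrite er; lia.
  apply: count_kept_drop => r /andP[qr hr] er'; have [j ej] := pos_exists hr.
  rewrite -ej keepE; apply: contra nmi => hj.
  apply: (masked_up hj); apply: heap_le_same => //; rewrite ?column_lt ?ei ?ej //; try lia.
case/existsP: (mi) => p /existsP[j /and4P[lf /eqP cj top le']].
have ja : j < size a by apply: (among_top_lt z_range a_growing _ top); rewrite cj t_leaf.
have := rank_heap_le (y := y) le' ja; rewrite ci ei er subnKC; last lia.
move=> /(_ (leqnn _)); have := leaf p lf; rewrite -cj.
rewrite among_topE // in top; have := count_cat (pred1 (column j)) (take j a) (drop j a).
rewrite cat_take_drop height_growing //.
  move: top; move: (count_mem _ (take _ _)) (count_mem _ (drop _ _)) (count_mem _ a) => c1 c2 c3.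
  by move: (height one _) (height y _) (nat_of_ord (t p)) => h1 h2 h3; clear; lia.
by rewrite cj; apply: ltnW; rewrite ltnS ltnW // ltn_ord.
Qed.
End Masks.

Lemma matches_injl N X k l l' : matches N X k l -> matches N X k l' -> l = l'.
Proof.
move=> [kl _ e h] [kl' _ e' h']; case: (ltngtP l l') => // lt.
  by have := h' l.+1; lia.
by have := h l'.+1; lia.
Qed.

Lemma dsumE X Y p m : size X = size Y ->
  dsum X Y p m = \sum_(1 <= c < (size X).+1) ((p + count id (take c X)).+1 - (m + count id (take
    c Y))).-1.
Proof.
elim: X Y p m => [|c X IH] [|d Y] p m //=; first by rewrite big_geq.
move=> [hs]; rewrite big_nat_recl //= !take0 /= !addn0 IH //; congr (_ + _).
by apply: eq_bigr => i _; rewrite /= !addnA.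
Qed.

Section Labelings.
Variables (n z : nat) (w : 'S_n.+1) (a : seq nat).
Notation prod u := (word_prod n u).
Notation letter := (letter z).
Notation height := (height z).
Notation one := (1%g : 'S_n.+1).
Notation X := (perm_word z w).
Notation N := n.+1.
Implicit Types (x y : 'S_n.+1) (k l m c : nat).

Lemma height_eq_word x y m : perm_word z x = perm_word z y -> m <= N -> height x m = height y m.
Proof. by move=> e hm; rewrite -!height_take // e. Qed.

Lemma walk_height s : s <= N -> walk X s + 2 * height w s = s + 2 * count id X.
Proof.
move=> hs; rewrite /walk height_take //.
have := count_take_le X s; rewrite height_take //; lia.
Qed.

Lemma count_letter_iota k r : count (letter w) (iota k r) + height w k = height w (k + r).
Proof.
elim: r => [|r IH]; first by rewrite addn0.
have -> : iota k r.+1 = iota k r ++ [:: k + r] by rewrite -[in LHS](addn1 r) iotaD.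
by rewrite count_cat /= addn0 addnAC IH addnS heightS.
Qed.

Lemma balancedE k L : balanced [seq ~~ letter w m | m <- iota k L] <->
  2 * (height w (k + L) - height w k) = L /\
  (forall r, r < L -> 2 * (height w (k + r) - height w k) <= r).
Proof.
have cn r : r <= L -> count negb (take r [seq ~~ letter w m | m <- iota k L]) = height w (k + r)
  - height w k.
  move=> hr; rewrite -map_take take_iota (minn_idPl hr) count_map -(count_letter_iota k r) addnK.
  by apply: eq_count => m /=; rewrite negbK.
have cp r : r <= L -> count negb (take r [seq ~~ letter w m | m <- iota k L]) +
    count id (take r [seq ~~ letter w m | m <- iota k L]) = r.
  move=> hr; rewrite -[RHS](size_takel (s := [seq ~~ letter w m | m <- iota k L])).
    by rewrite -(count_predC negb); congr (_ + _); apply: eq_count => b /=; rewrite negbK.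
  by rewrite size_map size_iota.
have full s : s = [seq ~~ letter w m | m <- iota k L] -> take L s = s.
  by move=> ->; rewrite take_oversize // size_map size_iota.
have e := full _ (erefl _).
have := cn L (leqnn _); have := cp L (leqnn _); rewrite e => cpL cnL.
rewrite /balanced; split=> [/andP[/eqP h1 /allP h2]|[h1 h2]].
  split=> [|r hr]; first lia.
  have := h2 r; rewrite mem_iota size_map size_iota => /(_ hr).
  by have := cn r (ltnW hr); have := cp r (ltnW hr); lia.
apply/andP; split; first by apply/eqP; lia.
apply/allP => r; rewrite mem_iota size_map size_iota => /andP[_ hr].
have := h2 r hr; have := cn r (ltnW hr); have := cp r (ltnW hr); lia.
Qed.

Lemma matches_letters k l : matches N X k l -> [/\ ~~ letter w k, letter w l & k < l <= n].
Proof.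
move=> -[kl lN e h]; have h1 : walk X k < walk X k.+1 by apply: h; lia.
have h2 : walk X k < walk X l by apply: h; lia.
have w1 := @walk_height k _; have w2 := @walk_height k.+1 _.
have w3 := @walk_height l _; have w4 := @walk_height l.+1 _.
rewrite !heightS in w2 w4; split; last by rewrite kl -ltnS.
  by case: (letter w k) w2 => // w2; lia.
by case: (letter w l) w4 => // w4; lia.
Qed.

Lemma matches_valley c : 0 < c <= n -> ~~ letter w c.-1 -> letter w c -> matches N X c.-1 c.
Proof.
move=> hc l1 l2; have e : c.-1.+1 = c by lia.
have := @walk_height c.-1 _; have := @walk_height c _; have := @walk_height c.+1 _.
have := heightS z w c.-1; have := heightS z w c; rewrite e (negPf l1) l2 addn0 addn1 => h1 h2 h3 h4 h5.
split; try lia.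
by move=> c' hc'; have -> : c' = c by [lia]; lia.
Qed.

Hypothesis z_range : 0 < z <= n.
Hypothesis a_growing : growing n z a.
Hypothesis w_word : perm_word z (word_prod n a) = perm_word z w.

Lemma height_w m : m <= N -> height w m = height one m + count_mem m a.
Proof. by move=> hm; rewrite -(height_eq_word w_word) // height_growing. Qed.

Lemma height_one_le y m : m <= N -> height one m <= height y m.
Proof.
move=> hm; have [u hu] := exists_reduced (min_coset_rep z y).
have gu := reduced_growing (@min_coset_rep_monotone n z y) hu.
have /and3P[_ /eqP eu _] := hu.
rewrite -(height_eq_word (@perm_word_min_coset_rep n z y)) // -eu height_growing //.
exact: leq_addr.
Qed.

Lemma letter_w k : k <= n -> letter (prod a) k = letter w k.
Proof. exact: letter_perm_word. Qed.

Lemma matched_matches k l : matched n z a k l <->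
  matches N X k l /\ (forall c, k <= c <= l.+1 -> c \in a).
Proof.
have lpE m : lparen n z a m = has_symbol a m && ~~ letter w m.
  rewrite (lparenE z_range a_growing); case hm: (has_symbol a m) => //=.
  by move: hm => /andP[/(a_letters a_growing) hm _]; rewrite letter_w //; lia.
rewrite /matched /rparen !lpE; split.
  move=> /and5P[/andP[sk lk] /andP[sl]]; rewrite sl /= negbK => ll kl /allP hs.
  have -> : [seq lparen n z a m | m <- iota k.+1 (l - k.+1)] = [seq ~~ letter w m | m <- iota
    k.+1 (l - k.+1)].
    by apply/eq_in_map => m hm; rewrite lpE hs.
  move=> /balancedE; rewrite subnKC // => -[h1 h2].
  have /andP[_ /(a_letters a_growing) lN] := sl.
  have hk : height w k.+1 = height w k by rewrite heightS (negPf lk) addn0.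
  have hl : height w l.+1 = (height w l).+1 by rewrite heightS ll addn1.
  have mono : height w k.+1 <= height w l.
    by rewrite -[l](subnKC kl) -count_letter_iota leq_addl.
  split; first split=> //; try lia.
  - have := @walk_height k; have := @walk_height l.+1; lia.
  - move=> c hc; have := @walk_height k; have := @walk_height c.
    have [->|ne] := eqVneq c l; first lia.
    have := h2 (c - k.+1); rewrite subnKC; last lia.
    have : height w k.+1 <= height w c.
      have hkc : k.+1 <= c by lia.
      by rewrite -[c](subnKC hkc) -count_letter_iota leq_addl.
    lia.
  move=> c hc; case/andP: sk => ka k1a; case/andP: sl => la l1a.
  have [->|n1] := eqVneq c k; first by [].
  have [->|n2] := eqVneq c l.+1; first by [].
  have [->|n3] := eqVneq c l; first by [].
  have : has_symbol a c by apply: hs; rewrite mem_iota; lia.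
  by case/andP.
move=> [mt ha]; have [lk ll hkl] := matches_letters mt; case: mt => kl lN e h.
have sym c : k <= c <= l -> has_symbol a c by move=> hc; apply/andP; split; apply: ha; lia.
have hs : all (has_symbol a) (iota k.+1 (l - k.+1)).
  by apply/allP => c; rewrite mem_iota => hc; apply: sym; lia.
rewrite lk ll kl hs !sym ?leqnn ?(ltnW kl) //=.
have -> : [seq lparen n z a m | m <- iota k.+1 (l - k.+1)] = [seq ~~ letter w m | m <- iota k.+1
  (l - k.+1)].
  by apply/eq_in_map => m; rewrite mem_iota => hm; rewrite lpE sym //; lia.
apply/balancedE; rewrite subnKC //.
have hk : height w k.+1 = height w k by rewrite heightS (negPf lk) addn0.
have hl : height w l.+1 = (height w l).+1 by rewrite heightS ll addn1.
split.
  have := @walk_height k; have := @walk_height l.+1; lia.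
move=> r hr; have := h (k.+1 + r); have := @walk_height k; have := @walk_height (k.+1 + r); lia.
Qed.

Lemma matches_columns k l : matches N X k l -> (forall c, k < c <= l -> c \in a) ->
  forall c, k <= c <= l.+1 -> c \in a.
Proof.
move=> mt ha c hc; have [lk ll hkl] := matches_letters mt.
have hk : height w k.+1 = height w k by rewrite heightS (negPf lk) addn0.
have hl : height w l.+1 = (height w l).+1 by rewrite heightS ll addn1.
have [ec|n1] := eqVneq c k.
  subst c; apply/negPn/negP => /count_memPn ka; have k1a : k.+1 \in a by apply: ha; lia.
  rewrite !height_w in hk; try lia; rewrite ka in hk.
  have := heightS z one k; move: k1a; rewrite -has_pred1 has_count; lia.
have [ec|n2] := eqVneq c l.+1; last by apply: ha; lia.
subst c; apply/negPn/negP => /count_memPn ka; have la : l \in a by apply: ha; lia.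
rewrite !height_w in hl; try lia; rewrite ka in hl.
have := heightS z one l; move: la; rewrite -has_pred1 has_count.
by case: (letter one l); rewrite ?addn1 ?addn0; move: hl; rewrite addn0;
  move: (height _ _) (height _ _) (count_mem _ _) => h1 h2 h3; lia.
Qed.

Notation Vtx := (vertex n z a).
Implicit Types (p : Vtx) (t : labeling n z a).

Lemma vertex_matches p : matches N X (val p).1 (val p).2.
Proof. by have /matched_matches[] := valP p. Qed.

Lemma vertex_in p c : (val p).1 <= c <= (val p).2.+1 -> c \in a.
Proof. by have /matched_matches[_] := valP p; apply. Qed.

Lemma vertex_exists k l : matches N X k l -> (forall c, k < c <= l -> c \in a) ->
  exists p, (val p).1 = k :> nat /\ (val p).2 = l :> nat.
Proof.
move=> mt ha; have hc := matches_columns mt ha.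
have m : matched n z a k l by apply/matched_matches.
have := a_letters a_growing (hc l.+1 _); have [_ _ hkl] := matches_letters mt.
move=> hl; have ln : l < n by have := hl _; lia.
have kn : k < n by lia.
by exists (exist (fun q : 'I_n * 'I_n => matched n z a q.1 q.2) (Ordinal kn, Ordinal ln) m).
Qed.

Lemma vertex_inj p p' : (val p).2 = (val p').2 :> nat -> p = p'.
Proof.
move=> e; apply: val_inj; have := vertex_matches p; rewrite e => /matches_inj /(_ (vertex_matches p')).
move: (val p) (val p') e => [k l] [k' l'] /= e1 e2; by rewrite (ord_inj e1) (ord_inj e2).
Qed.

Lemma vertex_injl p p' : (val p).1 = (val p').1 :> nat -> p = p'.
Proof.
move=> e; apply: vertex_inj; have := vertex_matches p; rewrite e => /matches_injl.
by apply; apply: vertex_matches.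
Qed.

Definition site_label t l := \sum_(p : Vtx | (val p).2 == l :> nat) t p.

Lemma site_labelE t p : site_label t (val p).2 = t p.
Proof.
rewrite /site_label (big_pred1 p) // => p'; apply/eqP/eqP => [/vertex_inj //|->//].
Qed.

Lemma site_label0 t l : (forall p : Vtx, (val p).2 != l :> nat) -> site_label t l = 0.
Proof. by move=> h; rewrite /site_label big_pred0 // => p; apply/negbTE. Qed.

Definition label_list t : seq nat := mkseq (site_label t) N.

Lemma nth_label_list t l : l < N -> nth 0 (label_list t) l = site_label t l.
Proof. exact: nth_mkseq. Qed.

Lemma sumn_label_list t : sumn (label_list t) = weight t.
Proof.
clear z_range a_growing w_word; rewrite sumnE big_map -[iota 0 N]/(index_iota 0 N) big_mkord /weight.
rewrite (exchange_big_dep xpredT) //=; apply: eq_bigr => p _.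
have h : (val p).2 < N by have := ltn_ord (val p).2; lia.
by rewrite (big_pred1 (Ordinal h)) // => l; rewrite eq_sym.
Qed.

Lemma label_list_inj : injective label_list.
Proof.
move=> t t' e; apply/ffunP => p; apply: val_inj; rewrite /= -!site_labelE.
have h : (val p).2 < N by have := ltn_ord (val p).2; lia.
by rewrite -!nth_label_list // e.
Qed.

Section Below.
Variable y : 'S_n.+1.
Notation Y := (perm_word z y).

Lemma gapE c : c <= N -> gap X Y c = (height w c).+1 - height y c.
Proof. by move=> hc; rewrite /gap !height_take. Qed.

(* From c, descending to a valley does not increase the gap. *)
Lemma valley_exists k l c : ~~ letter w k -> letter w l -> k < c <= l ->
  exists2 c', k < c' <= l & [/\ ~~ letter w c'.-1, letter w c' &
     height w c' + height y c <= height w c + height y c'].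
Proof.
move=> lk ll.
have left d : forall c, c - k <= d -> k < c <= l -> letter w c -> exists2 c', k < c' <= l &
    [/\ ~~ letter w c'.-1, letter w c' & height w c' + height y c <= height w c + height y c'].
  elim: d => [|d IH] {}c hd hc lc; first by lia.
  case l1: (letter w c.-1); last by exists c; rewrite ?l1.
  have ne : c.-1 != k by apply/eqP => e; rewrite e (negPf lk) in l1.
  have c1 : c.-1 - k <= d by lia.
  have c2 : k < c.-1 <= l by lia.
  have [c' hc' [h1 h2 h3]] := IH _ c1 c2 l1; exists c' => //; split=> //.
  have ec : c = c.-1.+1 by lia.
  have := heightS z w c.-1; have := heightS z y c.-1; rewrite l1 -ec addn1.
  by case: (letter y c.-1); rewrite ?addn1 ?addn0; lia.
move=> hc; move: {2}(l - c) (leqnn (l - c)) => d; elim: d c hc => [|d IH] c hc hd.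
  have -> : c = l by lia.
  by apply: (left _ l (leqnn _)); rewrite ?ll //; lia.
case lc: (letter w c); first exact: (left _ c (leqnn _)).
have ne : c != l by apply/eqP => e; rewrite e ll in lc.
have [c' hc' [h1 h2 h3]] : exists2 c', k < c' <= l &
    [/\ ~~ letter w c'.-1, letter w c' & height w c' + height y c.+1 <= height w c.+1 + height y c'].
  by apply: IH; lia.
exists c' => //; split=> //.
have := heightS z w c; have := heightS z y c; rewrite lc addn0.
by case: (letter y c); rewrite ?addn1 ?addn0; lia.
Qed.

Lemma label_okP t :
  ((forall l, l < N -> label_ok N X Y (label_list t) l) /\ (forall c, c <= N -> 0 < gap X Y c)) <->
  (t \in labelings n z a) && bruhat_le y (masked_prod t).
Proof.
have vN p : (val p).2 < N by have := ltn_ord (val p).2; lia.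
have colN p c : (val p).1 < c <= (val p).2 -> c <= N by have := vN p; lia.
have domE : (forall c, c <= N -> 0 < gap X Y c) <-> (forall c, c <= N -> height y c <= height
  (prod a) c).
  by split=> h c hc; have := h c hc; rewrite gapE // (height_eq_word w_word) //; lia.
split=> [[ok gp]|].
  have lb p : level_bound N X Y (label_list t) (val p).1 (val p).2 (t p).
    by have [/(_ _ (vertex_matches p))] := ok _ (vN p); rewrite nth_label_list // site_labelE.
  have tl p : is_leaf p -> t p <= capacity a (valley_column p).
    move=> lf; have [/(_ (val p).2) + _] := lb p; rewrite gapE; last by have := vN p; lia.
    have h1 := height_one_le y (m := (val p).2) (ltnW (vN p)); have := height_w (ltnW (vN p)).
    have [hk _ _ _] := vertex_matches p; rewrite hk leqnn => h2 /(_ isT).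
    by rewrite /capacity /valley_column; lia.
  have adm : t \in labelings n z a.
    rewrite inE; apply/andP; split.
      apply/forallP => p; apply/forallP => p'; apply/implyP => /andP[d1 d2].
      have [_ /(_ _ _ (vertex_matches p') d1 d2)] := lb p.
      by rewrite nth_label_list // site_labelE.
    by apply/forallP => p; apply/implyP => /tl.
  rewrite adm; apply/(bruhat_masked z_range a_growing tl); split; first exact/domE.
  move=> p lf; rewrite (height_eq_word w_word); last exact: ltnW (vN p).
  have [/(_ (val p).2) + _] := lb p; rewrite gapE; last exact: ltnW (vN p).
  have [hk _ _ _] := vertex_matches p; rewrite hk leqnn => /(_ isT).
  by rewrite /valley_column; lia.
move=> /andP[]; rewrite inE => /andP[/forallP mono /forallP cap].
have tl p : is_leaf p -> t p <= capacity a (valley_column p) by move=> lf; apply: (implyP (cap p)).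
move=> /(bruhat_masked z_range a_growing tl)[/domE gp leaf]; split=> // l lN.
split; last first.
  by move=> nm; rewrite nth_label_list // site_label0 // => p; apply/eqP => e;
     apply: (nm (val p).1); rewrite -e; apply: vertex_matches.
move=> k mt; rewrite nth_label_list //.
have [|noV] := pselect (exists p, (val p).2 = l :> nat); last first.
  rewrite site_label0; last by move=> p; apply/eqP => e; apply: noV; exists p.
  by split=> // c hc; apply: gp; lia.
case=> p ep; rewrite -ep site_labelE.
have ek : (val p).1 = k :> nat.
  by apply: (@matches_inj N X _ _ l) => //; rewrite -ep; apply: vertex_matches.
have [lk ll hkl] := matches_letters mt.
split=> [c hc|k' l' mt' kk' ll'].
  rewrite ep in hc; have [c' hc' [l1 l2 hle]] := valley_exists lk ll hc.
  have mv : matches N X c'.-1 c' by apply: matches_valley => //; lia.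
  have [p' [e1 e2]] : exists p', (val p').1 = c'.-1 :> nat /\ (val p').2 = c' :> nat.
    by apply: vertex_exists mv _ => d hd; apply: (vertex_in (p := p)); rewrite ek ep; lia.
  have lf : is_leaf p' by rewrite /is_leaf e1 e2; apply/eqP; lia.
  have tpp : t p <= t p'.
    have [epp|npp] := eqVneq p p'; first by rewrite epp.
    have := implyP (forallP (mono p) p'); apply; rewrite /descendant e1 e2 ek ep.
    have n1 : k != c'.-1 by apply: contra npp => /eqP e; apply/eqP/vertex_injl; rewrite ek e1.
    have n2 : l != c' by apply: contra npp => /eqP e; apply/eqP/vertex_inj; rewrite ep e2.
    by lia.
  have := leaf p' lf; rewrite /valley_column e2 (height_eq_word w_word); last lia.
  by have := gp c; rewrite gapE; lia.
rewrite ep in ll'.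
have [p' [e1 e2]] : exists p', (val p').1 = k' :> nat /\ (val p').2 = l' :> nat.
  by apply: vertex_exists mt' _ => d hd; apply: (vertex_in (p := p)); rewrite ek ep; lia.
rewrite nth_label_list -?e2 ?site_labelE //.
by have := implyP (forallP (mono p) p'); apply; rewrite /descendant e1 e2 ek ep kk'.
Qed.

Lemma perm_labs : perm_eq (labs X Y 0 0 [:: 1])
  [seq label_list t | t in [pred t | (t \in labelings n z a) && bruhat_le y (masked_prod t)]].
Proof.
have sX := size_perm_word z w; have sY := size_perm_word z y.
apply: uniq_perm; first exact: labs_uniq.
  by rewrite map_inj_uniq ?enum_uniq //; apply: label_list_inj.
move=> T; rewrite mem_labs; apply/idP/imageP => [ok|[t ht ->]]; last first.
  apply/(okl_labels sX sY); first by rewrite size_mkseq.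
  by apply/label_okP.
have sT := okl_size ok; rewrite sX in sT; move/(okl_labels sX sY sT): (ok) => [lok gp].
pose t : labeling n z a := [ffun p : Vtx => inord (nth 0 T (val p).2)].
have eT : T = label_list t.
  apply: (@eq_from_nth _ 0); first by rewrite size_mkseq.
  move=> l; rewrite sT => lN; rewrite nth_label_list //.
  have [|noV] := pselect (exists p, (val p).2 = l :> nat).
    case=> p ep; rewrite -ep site_labelE ffunE inordK //.
    have mt := vertex_matches p; rewrite ep in mt *; have [/(_ _ mt)[hb _] _] := lok l lN.
    have [kl _ _ _] := mt; have := hb l; rewrite kl leqnn gapE; last exact: ltnW.
    move=> /(_ isT); have := height_one_le y (m := l) (ltnW lN); have := height_w (ltnW lN).
    have := count_size (pred1 l) a;
      move: (height _ _) (height _ _) (height _ _) (count_mem _ _) (nth _ _ _) => h1 h2 h3 c1 r;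
        move: (size a) => sa; clear; lia.
  rewrite site_label0; last by move=> p; apply/eqP => e; apply: noV; exists p.
  have [hm h0] := lok l lN; have [[k mt]|nm] := pselect (exists k, matches N X k l); last first.
    by apply: h0 => k mt; apply: nm; exists k.
  have [hc|nc] := pselect (forall c, k < c <= l -> c \in a).
    by have [p [_ ep]] := vertex_exists mt hc; case: noV; exists p.
  have [hb _] := hm k mt; apply/eqP; rewrite -leqn0 leqNgt; apply/negP => pos; apply: nc => c hc.
  apply/negPn/negP => /count_memPn ca; have cN : c <= N by lia.
  have := hb c hc; rewrite gapE // height_w // ca; have := height_one_le y cN; lia.
exists t => //; rewrite inE; apply/label_okP; rewrite -eT; split=> //.
Qed.

End Below.
End Labelings.

(** * The degree bound and the formula *)

Section Degree.
Variables (n z : nat) (w : 'S_n.+1) (a : seq nat).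
Hypothesis z_range : 0 < z <= n.
Hypothesis a_growing : growing n z a.
Hypothesis w_word : perm_word z (word_prod n a) = perm_word z w.
Notation letter := (letter z).
Notation height := (height z).
Notation X := (perm_word z w).
Notation N := n.+1.
Notation Vtx := (vertex n z a).
Variable t : labeling n z a.
Hypothesis t_adm : t \in labelings n z a.
Notation y := (masked_prod t).
Implicit Types (p : Vtx) (k l s c : nat).
Let d c := height w c - height y c.

Let t_leaf p : is_leaf p -> t p <= capacity a (valley_column p).
Proof. by move: t_adm; rewrite inE => /andP[_ /forallP cap] lf; apply: (implyP (cap p)). Qed.

Lemma masked_dominated c : c <= N -> height y c <= height w c.
Proof. by move=> hc; rewrite -(height_eq_word w_word) //; apply: height_masked_le. Qed.

Lemma label_gap p c : (val p).1 < c <= (val p).2 -> t p <= d c.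
Proof.
have vN : (val p).2 < N by have := ltn_ord (val p).2; lia.
have [_ [|ok _]] := label_okP z_range a_growing w_word y t; first by rewrite t_adm; apply: connect0.
have [/(_ _ (vertex_matches z_range a_growing w_word p))[h _] _] := ok _ vN.
move=> hc; have := h c hc; rewrite nth_label_list // (site_labelE z_range a_growing w_word) gapE;
  last lia.
have := masked_dominated (c := c); rewrite /d; lia.
Qed.

Lemma label_site p : t p <= d (val p).1 /\ t p <= d (val p).2.
Proof.
have mt := vertex_matches z_range a_growing w_word p.
have [l1 l2 hkl] := matches_letters mt; split; last by apply: label_gap; lia.
have := label_gap (p := p) (c := (val p).1.+1); rewrite /d !heightS (negPf l1) addn0.
by move: (height _ _) (height _ _) => h1 h2; case: letter; rewrite ?addn1 ?addn0; lia.
Qed.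

Definition site_charge s :=
  \sum_(p : Vtx | (val p).1 == s :> nat) t p + \sum_(p : Vtx | (val p).2 == s :> nat) t p.

Lemma sum_site_charge : \sum_(s < N) site_charge s = 2 * weight t.
Proof.
rewrite big_split /= mul2n -addnn; congr (_ + _); rewrite (exchange_big_dep xpredT) //=;
  apply: eq_bigr => p _.
  have h : (val p).1 < N by have := ltn_ord (val p).1; lia.
  by rewrite (big_pred1 (Ordinal h)) // => l; rewrite eq_sym.
have h : (val p).2 < N by have := ltn_ord (val p).2; lia.
by rewrite (big_pred1 (Ordinal h)) // => l; rewrite eq_sym.
Qed.

Lemma site_charge_le s : site_charge s <= d s.
Proof.
have mt p := matches_letters (vertex_matches z_range a_growing w_word p).
rewrite /site_charge; case ls: (letter w s).
  rewrite big_pred0 => [|p]; last by apply/eqP => e; have [] := mt p; rewrite e ls.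
  have [[p ep]|no] := pselect (exists p, (val p).2 = s :> nat).
    rewrite (big_pred1 p); first by have [_] := label_site p; rewrite ep.
    move=> p'; apply/eqP/eqP => [e|-> //].
    by apply: (vertex_inj z_range a_growing w_word); rewrite e ep.
  by rewrite big_pred0 // => p; apply/eqP => e; apply: no; exists p.
rewrite addnC big_pred0 => [|p]; last by apply/eqP => e; have [_] := mt p; rewrite e ls.
have [[p ep]|no] := pselect (exists p, (val p).1 = s :> nat).
  rewrite (big_pred1 p); first by have [] := label_site p; rewrite ep.
  move=> p'; apply/eqP/eqP => [e|-> //].
  by apply: (vertex_injl z_range a_growing w_word); rewrite e ep.
by rewrite big_pred0 // => p; apply/eqP => e; apply: no; exists p.
Qed.

Lemma weight_lt : 0 < weight t -> 2 * weight t < \sum_(s < N) d s.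
Proof.
rewrite lt0n sum_nat_eq0 negb_forall => /existsP[p0 /= hp0].
case: (@arg_maxnP _ p0 (fun p => t p != 0 :> nat) (fun p => (val p).2 : nat)) => // p hp hmax.
have mt p' := matches_letters (vertex_matches z_range a_growing w_word p').
set l := nat_of_ord (val p).2.
have hl : l.+1 < N by have := ltn_ord (val p).2; rewrite /l; lia.
have ch0 : site_charge l.+1 = 0.
  rewrite /site_charge !big1 // => p' /eqP e; apply/eqP/negPn/negP => /hmax /=; rewrite -/l.
    by rewrite e ltnn.
  move=> h; have [_ _] := mt p'; rewrite e => /andP[h' _].
  by have := leq_trans (ltnW h') h; rewrite ltnn.
have dl : 0 < d l.+1.
  have [_] := label_site p; rewrite -/l; have [_ l2 _] := mt p; rewrite /d !heightS l2.
  by move: hp (height _ _) (height _ _) => /= hp h1 h2; case: letter; rewrite ?addn1 ?addn0; lia.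
rewrite -sum_site_charge (bigD1 (Ordinal hl)) //= [ltnRHS](bigD1 (Ordinal hl)) //= ch0.
rewrite -[ltnLHS]/(\sum_(i < N | i != Ordinal hl) site_charge i).
apply: leq_ltn_trans (_ : \sum_(i < N | i != Ordinal hl) d i < _);
  last by rewrite -addn1 addnC leq_add2r.
by apply: leq_sum => i _; apply: site_charge_le.
Qed.

Hypothesis w_top : block_decreasing z w.

Lemma weight_length : 0 < weight t -> 2 * weight t + cox_length y + 1 <= cox_length w.
Proof.
move=> /weight_lt; rewrite sumnB => [|s _]; last by apply: masked_dominated; rewrite ltnW.
have := length_area z_range w_top;
  have := length_area z_range (masked_prod_top z_range a_growing t_leaf).
rewrite /area !big_mkord => e1 e2 lt; clear -e1 e2 lt.
move: (\sum_(_ < _) _) (\sum_(_ < _) _) (\sum_(_ < _) _) e1 e2 lt => s1 s2 s3.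
by move: (cox_length _) (cox_length _) (cox_length _) (weight _) => c1 c2 c3 m; lia.
Qed.
End Degree.

Lemma bruhat_length n (x y : 'S_n.+1) : bruhat_le x y -> x = y \/ cox_length x < cox_length y.
Proof.
move=> /connectP[p + ->] {y}; elim: p x => [|x' p IH] x /=; first by left.
move=> /andP[/andP[lt _] /IH h]; right; case: h => [<- //|]; exact: ltn_trans.
Qed.

Section Formula.
Variables (n z : nat) (w : 'S_n.+1) (a : seq nat).
Hypothesis z_range : 0 < z <= n.
Hypothesis a_growing : growing n z a.
Hypothesis w_word : perm_word z (word_prod n a) = perm_word z w.
Hypothesis w_top : block_decreasing z w.
Notation height := (height z).
Implicit Types (x y : 'S_n.+1) (t : labeling n z a).
Notation lab := (labelings n z a).

Lemma masked_prod_le t : t \in lab -> bruhat_le (masked_prod t) w.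
Proof.
by move=> ht; apply: (bruhat_of_height z_range w_top) => k;
  apply: (masked_dominated z_range a_growing w_word ht).
Qed.

Lemma labeling_top : [pred t | (t \in lab) && bruhat_le w (masked_prod t)] =1 pred1 [ffun=> ord0].
Proof.
move=> t /=; have hw k (hk : k <= n.+1) := height_eq_word w_word hk.
have vN p : valley_column (p : vertex n z a) <= n.+1.
  by have := ltn_ord (val p).2; rewrite /valley_column; lia.
apply/andP/eqP => [[ht le]|->].
  have := ht; rewrite inE => /andP[/forallP mono /forallP cap].
  have [|_ leaf] := (bruhat_masked z_range a_growing (t := t) _ w).1 le.
    by move=> p lf; apply: (implyP (cap p)).
  have leaf0 p : is_leaf p -> t p = 0 :> nat.
    by move=> lf; have := leaf p lf; rewrite hw // -[leqRHS]addn0 leq_add2l leqn0 => /eqP.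
  apply/ffunP => p; apply: val_inj; rewrite ffunE /=; have [p' lf hp] := leaf_below p.
  case: hp => [<-|dp]; first exact: leaf0.
  by have := implyP (forallP (mono p) p') dp; rewrite (leaf0 p') // leqn0 => /eqP.
have t0 p : ([ffun=> ord0] : labeling n z a) p = 0 :> nat by rewrite ffunE.
split; first by rewrite inE; apply/andP; split; apply/forallP => p;
  [apply/forallP => p'|]; apply/implyP => _; rewrite t0.
apply/(bruhat_masked z_range a_growing); first by move=> p _; rewrite t0.
by split=> [k hk|p _]; rewrite ?t0 ?addn0 hw.
Qed.

Lemma dsum_area y : (forall c, c <= n.+1 -> height y c <= height w c) ->
  dsum (perm_word z w) (perm_word z y) 0 0 + area z y = area z w.
Proof.
move=> dom; rewrite dsumE ?size_perm_word //.
have -> : \sum_(1 <= c < n.+2) ((0 + count id (take c (perm_word z w))).+1 -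
    (0 + count id (take c (perm_word z y)))).-1 = \sum_(0 <= c < n.+1) (height w c - height y c).
  transitivity (\sum_(1 <= c < n.+2) (height w c - height y c)).
    apply: eq_big_nat => c /andP[_ hc]; rewrite !add0n !height_take //.
    by have := dom c hc; lia.
  rewrite [RHS]big_ltn // big_add1 /= big_nat_recr //= big_add1 /=.
  by rewrite !height_total !height0 !subnn addn0.
rewrite /area -big_split; apply: eq_big_nat => c /andP[_ hc] /=.
by rewrite subnK // dom // ltnW.
Qed.

Local Open Scope ring_scope.
Notation v := qhalf.

Definition kl_poly y : {poly int} := \sum_(t in lab | bruhat_le y (masked_prod t)) 'X^(weight t).

Lemma evalq_kl_poly y : evalq (kl_poly y) =
  \sum_(t in lab | bruhat_le y (masked_prod t)) v ^+ (2 * weight t).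
Proof. by rewrite raddf_sum; apply: eq_bigr => t _; rewrite /= evalqXn exprM. Qed.

Lemma kl_poly_out y : ~~ bruhat_le y w -> kl_poly y = 0.
Proof.
move=> ny; apply: big1 => t /andP[ht le]; case/negP: ny.
exact: connect_trans le (masked_prod_le ht).
Qed.

Lemma kl_poly_top : kl_poly w = 1.
Proof.
rewrite /kl_poly (eq_bigl _ _ labeling_top) big_pred1_eq /weight big1 ?expr0 // => p _.
by rewrite ffunE.
Qed.

Lemma kl_poly_size y : bruhat_le y w -> y != w ->
  (2 * (size (kl_poly y)).-1 + cox_length y + 1 <= cox_length w)%N.
Proof.
move=> le ne; have lt : (cox_length y < cox_length w)%N.
  by case: (bruhat_length le) => // e; rewrite e eqxx in ne.
have : (size (kl_poly y) <= (half (cox_length w - cox_length y).-1).+1)%N.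
  apply: leq_trans (size_sum _ _ _) _; apply/bigmax_leqP => t /andP[ht hy].
  rewrite size_polyXn ltnS; have [-> //|pos] := posnP (weight t).
  have := weight_length z_range a_growing w_word ht w_top pos.
  have : (cox_length y <= cox_length (masked_prod t))%N by case: (bruhat_length hy) => [->|/ltnW].
  by move: (cox_length _) (cox_length _) (cox_length _) (weight _) => c1 c2 c3 m; lia.
by move: (size _) (cox_length _) (cox_length _) lt => m c1 c2 lt; lia.
Qed.

Lemma coef_kl_elt_poly y : coef (kl_elt z w) y = v^-1 ^+ cox_length w * evalq (kl_poly y).
Proof.
rewrite coef_kl_elt /LSw LS_labs.
have -> : \sum_(T <- labs (perm_word z w) (perm_word z y) 0 0 [:: 1%N]) v ^+ (2 * sumn T) = evalq
  (kl_poly y).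
  rewrite (perm_big _ (perm_labs z_range a_growing w_word y)) big_image evalq_kl_poly.
  by apply: eq_bigr => t _; rewrite sumn_label_list.
have [dom|ndom] := pselect (forall c, (c <= n.+1)%N -> (height y c <= height w c)%N).
  rewrite /kl_const -(dsum_area dom);
    move: (dsum _ _ _ _) (area _ _) (cox_length _) (evalq _) => d A l s.
  rewrite -!mulrA [v^-1 ^+ A * _]mulrCA; congr (_ * _).
  by rewrite [X in _ * X]mulrCA mulrA -exprD [(A + d)%N]addnC mulrA qhalfVK mul1r.
rewrite kl_poly_out ?raddf0 ?mulr0 //; apply/negP => le.
by case: ndom => c hc; apply: height_bruhat.
Qed.

Definition bprime_sum : heckeL n := v ^- cox_length w *:
  \sum_(t in lab) v ^+ (2 * weight t + cox_length (masked_prod t)) *: Bprime (masked_prod t).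

Lemma coef_Bprime x y : coef (Bprime x) y = v ^- cox_length x * (bruhat_le y x)%:R.
Proof.
rewrite hecke_coefZ hecke_coef_sum; congr (_ * _).
under eq_bigr do rewrite hecke_coefT.
case: (boolP (bruhat_le y x)) => h.
  by rewrite (bigD1 y) //= eqxx big1 ?addr0 // => y' /andP[_ /negPf ne]; rewrite eq_sym ne.
by rewrite big1 // => y' h'; case: eqP => // e; rewrite e h' in h.
Qed.

Lemma coef_bprime_sum y : coef bprime_sum y = v ^- cox_length w * evalq (kl_poly y).
Proof.
rewrite hecke_coefZ hecke_coef_sum evalq_kl_poly; congr (_ * _).
rewrite big_mkcondr; apply: eq_bigr => t _; rewrite hecke_coefZ coef_Bprime exprD mulrA.
rewrite mulrK ?unitrX ?qhalf_unit //.
by case: (bruhat_le _ _); rewrite ?mulr1 ?mulr0.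
Qed.

Lemma bprime_sum_is_KL : is_KL w bprime_sum.
Proof.
exists kl_poly; split.
- exact: kl_poly_top.
- exact: kl_poly_size.
- apply: hecke_coefP => y; rewrite coef_bprime_sum (coef_kl_sum y (erefl _)).
  by case: ifP => // /negbT/kl_poly_out ->; rewrite raddf0.
have -> : bprime_sum = kl_elt z w; last exact: bar_kl_elt.
by apply: hecke_coefP => y; rewrite coef_bprime_sum coef_kl_elt_poly exprVn.
Qed.
End Formula.

Lemma cograssmannian_top n z (w : 'S_n.+1) : 0 < z <= n -> cograssmannian w -> right_ascent w z ->
  block_decreasing z w.
Proof.
move=> hz cg az k hk kz; apply/negP => h; case/eqP: kz.
by apply: cg.
Qed.

Local Open Scope ring_scope.

Theorem theorem4p2 (n z : nat) (w : 'S_n.+1) (a : seq nat)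
  (w_cograssmannian : cograssmannian w)
  (z_range : (0 < z <= n)%N)
  (z_ascent : right_ascent w z)
  (a_reduced : reduced_word a (min_coset_rep z w)) :
  KL w = qhalf ^- cox_length w *:
    \sum_(t in labelings n z a)
      qhalf ^+ (2 * weight t + cox_length (masked_prod t)) *: Bprime (masked_prod t).
Proof.
have gr := reduced_growing (@min_coset_rep_monotone n z w) a_reduced.
have w_top := cograssmannian_top z_range w_cograssmannian z_ascent.
apply/KL_eq/(bprime_sum_is_KL z_range gr) => //.
have /and3P[_ /eqP -> _] := a_reduced; exact: perm_word_min_coset_rep.
Qed.
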